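(* Let $a>b>0$ be arbitrary but fixed, and for $q>1$ let $$\beta^{\ast}(q)=\sup_{r>\sqrt{2}\pi/2}\ \max\left\{\beta>0:\ (q\beta,\beta)\in\Sigma^{D}_r\right\}.$$ Then a travelling wave solution of $$u_{tt}+u_{xxxx}+au^+-bu^-=1\ \ (x\in\mathbb{R},\,t>0),\qquad u(x,t)\to 1/a,\ u_x(x,t)\to 0\ \text{ for } |x|\to+\infty,$$ exists for any wave speed $c$ satisfying $$|c|\in\left(\sqrt[4]{\frac{4b}{\beta^{\ast}(a/b)}},\ \sqrt[4]{4a}\right).$$
   Context: Here $u^{\pm}=\max\{\pm u,0\}$, so $u=u^+-u^-$. A travelling wave solution with wave speed $c$ is a (classical) solution of the problem $$u_{tt}+u_{xxxx}+au^+-bu^-=1\ \ (x\in\mathbb{R},\,t>0),\qquad u(x,t)\to 1/a,\ u_x(x,t)\to 0\ \text{ for } |x|\to+\infty,$$ of the form $u(x,t)=y(x-ct)$ which is nontrivial, i.e. $y\not\equiv 1/a$; equivalently, $z=y-1/a$ is a nontrivial solution of $z^{(4)}+c^2z''+a(z+1/a)^+-b(z+1/a)^--1=0$ on $\mathbb{R}$ with $z,z'\to0$ as $|s|\to+\infty$. For $r>0$, the Fučík spectrum $\Sigma^{D}_r$ is the set of all $(\alpha,\beta)\in\mathbb{R}^2$ for which the Dirichlet problem $$v^{(4)}+2v''+\alpha v^+-\beta v^-=0\ \text{ in } (-r,r),\qquad v(\pm r)=v'(\pm r)=0,$$ has a nontrivial (classical) solution, where $v^{\pm}=\max\{\pm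 v,0\}$. *)

(* Defs.v *)
From Stdlib Require Import Reals.
From Coquelicot Require Import Coquelicot.
Open Scope R_scope.

Definition pos_part (x : R) : R := Rmax x 0.
Definition neg_part (x : R) : R := Rmax (- x) 0.

(* [ex_derive_n f n x] only speaks about the differentiability at [x] of the
   total function [Derive_n f (n-1)], so the existence of every lower
   derivative on the whole domain has to be required as well. *)
Definition n_times_derivable_on (D : R -> Prop) (n : nat) (f : R -> R) : Prop :=
  forall x, D x -> forall k, (k <= n)%nat -> ex_derive_n f k x.

(* The boundary values of v and v' are the limits taken from inside (-r, r);
   the values of [v : R -> R] outside (-r, r) are irrelevant.  The continuity
   of v'''' in (-r, r) follows from the equation. *)
Definition dirichlet_solution (r alpha beta : R) (v : R -> R) : Prop :=
  n_times_derivable_on (fun x => - r < x < r) 4 v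
  /\ (forall x, - r < x < r ->
        Derive_n v 4 x + 2 * Derive_n v 2 x
        + alpha * pos_part (v x) - beta * neg_part (v x) = 0)
  /\ filterlim v (at_right (- r)) (locally 0)
  /\ filterlim v (at_left r) (locally 0)
  /\ filterlim (Derive v) (at_right (- r)) (locally 0)
  /\ filterlim (Derive v) (at_left r) (locally 0).

Definition fucik_spectrum (r : R) (p : R * R) : Prop :=
  exists v : R -> R,
    dirichlet_solution r (fst p) (snd p) v
    /\ exists x, - r < x < r /\ v x <> 0.

Definition is_max (E : R -> Prop) (m : R) : Prop :=
  E m /\ forall x, E x -> x <= m.

(* For q > 1 the set below is nonempty, and it is bounded above by 1: testing
   the equation with v shows that (alpha, beta) is not in the spectrum when
   alpha, beta >= 1.  Hence the supremum is finite and [real] loses nothing. *)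
Definition beta_star (q : R) : R :=
  real (Lub_Rbar (fun m =>
    exists r, r > sqrt 2 * PI / 2
      /\ is_max (fun beta => beta > 0 /\ fucik_spectrum r (q * beta, beta)) m)).

Definition dx (k : nat) (u : R -> R -> R) (x t : R) : R :=
  Derive_n (fun x' => u x' t) k x.
Definition dt (k : nat) (u : R -> R -> R) (x t : R) : R :=
  Derive_n (fun t' => u x t') k t.

Definition classical_solution (a b : R) (u : R -> R -> R) : Prop :=
  (forall t, t > 0 -> n_times_derivable_on (fun _ => True) 4 (fun x => u x t))
  /\ (forall x, n_times_derivable_on (fun t => t > 0) 2 (fun t => u x t))
  /\ (forall k x t, (k <= 4)%nat -> t > 0 ->
        continuous (fun p : R * R => dx k u (fst p) (snd p)) (x, t))
  /\ (forall k x t, (k <= 2)%nat -> t > 0 ->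
        continuous (fun p : R * R => dt k u (fst p) (snd p)) (x, t))
  /\ (forall x t, t > 0 ->
        dt 2 u x t + dx 4 u x t
        + a * pos_part (u x t) - b * neg_part (u x t) = 1)
  /\ (forall t, t > 0 ->
        is_lim (fun x => u x t) p_infty (1 / a)
        /\ is_lim (fun x => u x t) m_infty (1 / a)
        /\ is_lim (fun x => dx 1 u x t) p_infty 0
        /\ is_lim (fun x => dx 1 u x t) m_infty 0).

Definition travelling_wave_solution (a b c : R) (u : R -> R -> R) : Prop :=
  classical_solution a b u
  /\ exists y : R -> R,
       (forall x t, t > 0 -> u x t = y (x - c * t))
       /\ exists s, y s <> 1 / a.

(* Main.v *)
Require Import Defs.
From Stdlib Require Import Reals Lra Lia ZArith ClassicalEpsilon Cantor.
From Coquelicot Require Import Coquelicot.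
Open Scope R_scope.

(** Write the profile as [y = 1/a - w].  The wave equation becomes
    [w'''' + c^2 w'' + a w = (a - b) (w - 1/a)^+] with [w] decaying.  For [c^4 < 4 a]
    the operator on the left is positive; let [G] be its Green function, which decays
    exponentially and oscillates.  A solution is recovered from the density
    [h = (a - b) (w - 1/a)^+] by [w = G * h].

    The existence proof is variational in [h].  Maximise the energy
    [int h (G * h) - int h^2 / (a - b)] over the densities [h >= 0] of mass one.  At a
    maximiser, [h = (a - b) (G * h - mu)^+], where the multiplier [mu] is the maximal
    energy; when [mu > 0], division by [a mu] gives a solution.  So two things are
    needed: a density of positive energy, and a way around the lack of compactness on
    the line.

    Positive energy comes from the Fucik spectrum.  The lower bound on [|c|] says that
    after rescaling some solution [v] of the Dirichlet problem has a spectral parameter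
    [beta > 4 b / c^4]; testing the equation of [v] with [v] shows that the density
    [(a - b) (- v)^+], suitably rescaled, has positive energy
    ([energy_positive], [fucik_test_density]).  To extract such a [v] from [beta_star]
    one has to know that [beta_star] is a genuine supremum of a nonempty set: an
    explicit nonpositive solution gives an element for one [r] ([fucik_one_signed]),
    and the maximum for this [r] exists because the parameters are at most [1]
    ([fucik_le_1]) and form a closed set ([fucik_closed]).

    For the existence of a critical point, the problem is discretised on a cyclic grid
    with mesh tending to zero and period tending to infinity.  There it is the
    maximisation of a quadratic form on a simplex, whose first-order conditions are the
    discrete Euler-Lagrange equation ([qform_max_kkt], [discrete_solution]).  This
    equation makes the discrete densities uniformly bounded and Lipschitz, while
    positive energy bounds the multiplier, hence the maximum of the density, from below
    ([discrete_energy_lower_bound]).  Translate the maximum to [0] and extract a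
    limit ([limit_density]).  It need not be a maximiser, mass may be lost at infinity,
    but it is nonzero and satisfies the Euler-Lagrange equation; having finite mass and
    being Lipschitz it tends to zero, so that [G * h - mu] is eventually negative and
    [h] has compact support ([ground_state_exists]).  Finally the convolution is
    computed by first-order linear systems, which gives its four derivatives and their
    decay ([convolution_tower], [convolution_limits]). *)

Lemma choice {A B : Type} (Q : A -> B -> Prop) :
  (forall x, exists y, Q x y) -> exists f, forall x, Q x (f x).
Proof.
  intros H. exists (fun x => proj1_sig (constructive_indefinite_description _ (H x))).
  intros x. now destruct (constructive_indefinite_description _ (H x)).
Qed.

(** * Finite sums *)

Fixpoint rsum (n : nat) (f : nat -> R) : R :=
  match n with O => 0 | S m => rsum m f + f m end.

Lemma rsum_ext n f g :
  (forall i, (i < n)%nat -> f i = g i) -> rsum n f = rsum n g.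
Proof.
  induction n as [|n IH]; intros H; simpl; [easy|].
  rewrite IH by (intros; apply H; lia). now rewrite H by lia.
Qed.

Lemma rsum_le n f g :
  (forall i, (i < n)%nat -> f i <= g i) -> rsum n f <= rsum n g.
Proof.
  induction n as [|n IH]; intros H; simpl; [lra|].
  apply Rplus_le_compat; [apply IH; intros; apply H; lia | apply H; lia].
Qed.

Lemma rsum_plus n f g : rsum n (fun i => f i + g i) = rsum n f + rsum n g.
Proof. induction n as [|n IH]; simpl; [lra|rewrite IH; ring]. Qed.

Lemma rsum_scal n c f : rsum n (fun i => c * f i) = c * rsum n f.
Proof. induction n as [|n IH]; simpl; [ring|rewrite IH; ring]. Qed.

Lemma rsum_minus n f g : rsum n (fun i => f i - g i) = rsum n f - rsum n g.
Proof. induction n as [|n IH]; simpl; [lra|rewrite IH; ring]. Qed.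

Lemma rsum_const n c : rsum n (fun _ => c) = INR n * c.
Proof.
  induction n as [|n IH]; [simpl; ring|]. rewrite S_INR; simpl; rewrite IH; ring.
Qed.

Lemma rsum_nonneg n f : (forall i, (i < n)%nat -> 0 <= f i) -> 0 <= rsum n f.
Proof.
  intros H. replace 0 with (rsum n (fun _ => 0)).
  - now apply rsum_le.
  - rewrite rsum_const; ring.
Qed.

Lemma rsum_abs n f : Rabs (rsum n f) <= rsum n (fun i => Rabs (f i)).
Proof.
  induction n as [|n IH]; simpl; [rewrite Rabs_R0; lra|].
  eapply Rle_trans; [apply Rabs_triang|lra].
Qed.

Lemma rsum_abs_le n f c :
  (forall i, (i < n)%nat -> Rabs (f i) <= c) -> Rabs (rsum n f) <= INR n * c.
Proof.
  intros H. eapply Rle_trans; [apply rsum_abs|].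
  rewrite <- rsum_const. now apply rsum_le.
Qed.

Lemma rsum_add n m f : rsum (n + m) f = rsum n f + rsum m (fun i => f (n + i)%nat).
Proof.
  induction m as [|m IH]; simpl.
  - rewrite Nat.add_0_r; ring.
  - rewrite Nat.add_succ_r; simpl; rewrite IH; ring.
Qed.

Lemma rsum_delta n k f :
  (k < n)%nat -> rsum n (fun i => if Nat.eq_dec i k then f i else 0) = f k.
Proof.
  induction n as [|n IH]; intros H; [lia|]. simpl.
  destruct (Nat.eq_dec n k) as [->|Hn].
  - rewrite (rsum_ext k _ (fun _ => 0)).
    + rewrite rsum_const; ring.
    + intros i Hi. destruct (Nat.eq_dec i k); [lia|easy].
  - rewrite IH by lia. ring.
Qed.

Lemma rsum_term_le n f k :
  (forall i, (i < n)%nat -> 0 <= f i) -> (k < n)%nat -> f k <= rsum n f.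
Proof.
  intros H Hk. rewrite <- (rsum_delta n k f Hk). apply rsum_le.
  intros i Hi. destruct (Nat.eq_dec i k); [lra|now apply H].
Qed.

Lemma rsum_succ_l n f : rsum (S n) f = f O + rsum n (fun i => f (S i)).
Proof. induction n as [|n IH]; [simpl; ring|]. simpl in *. rewrite IH. ring. Qed.

Lemma rsum_le_longer n m f :
  (n <= m)%nat -> (forall i, 0 <= f i) -> rsum n f <= rsum m f.
Proof.
  intros Hnm Hf. replace m with (n + (m - n))%nat by lia. rewrite rsum_add.
  pose proof (rsum_nonneg (m - n) (fun i => f (n + i)%nat) (fun i _ => Hf _)). lra.
Qed.

Lemma is_lim_seq_rsum n (f : nat -> nat -> R) (l : nat -> R) :
  (forall i, (i < n)%nat -> is_lim_seq (fun k => f k i) (l i)) ->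
  is_lim_seq (fun k => rsum n (f k)) (rsum n l).
Proof.
  induction n as [|n IH]; intros H; simpl.
  - apply is_lim_seq_const.
  - apply is_lim_seq_plus'; [apply IH; intros; apply H; lia|apply H; lia].
Qed.

Lemma is_lim_seq_minus_inv (m : R) : is_lim_seq (fun n => m - / (INR n + 1)) m.
Proof.
  replace (Finite m) with (Finite (m - 0)) by (f_equal; ring).
  apply is_lim_seq_minus'; [apply is_lim_seq_const|].
  apply is_lim_seq_ext with (fun n => / INR (S n)).
  { intros n. now rewrite S_INR. }
  apply (is_lim_seq_incr_1 (fun n => / INR n)).
  replace (Finite 0) with (Rbar_inv p_infty) by easy.
  apply is_lim_seq_inv; [apply is_lim_seq_INR|easy].
Qed.

Lemma sup_sequence (E : R -> Prop) m :
  is_lub E m -> exists u : nat -> R, forall n, E (u n) /\ m - / (INR n + 1) < u n.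
Proof.
  intros [_ Hm]. apply (choice (fun (n : nat) x => E x /\ m - / (INR n + 1) < x)).
  intros n. apply NNPP. intros Hno.
  assert (Hpos : 0 < / (INR n + 1)) by (apply Rinv_0_lt_compat; pose proof (pos_INR n); lra).
  assert (m <= m - / (INR n + 1)); [|lra].
  apply Hm. intros x Hx. apply Rnot_lt_le. intros Hlt. apply Hno. now exists x.
Qed.

(** * Compactness by diagonal extraction *)

Lemma subseq_lt (phi : nat -> nat) :
  (forall n, (phi n < phi (S n))%nat) -> forall n m, (n < m)%nat -> (phi n < phi m)%nat.
Proof.
  intros H n m Hnm. induction Hnm as [|m Hm IH]; [apply H|].
  specialize (H m); lia.
Qed.

Lemma subseq_ge (phi : nat -> nat) :
  (forall n, (phi n < phi (S n))%nat) -> forall n, (n <= phi n)%nat.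
Proof.
  intros H n. induction n as [|n IH]; [lia|]. specialize (H n); lia.
Qed.

Lemma bounded_subseq (u : nat -> R) C :
  (forall n, Rabs (u n) <= C) ->
  exists phi : nat -> nat, (forall n, (phi n < phi (S n))%nat) /\
    ex_finite_lim_seq (fun n => u (phi n)).
Proof.
  intros Hu.
  destruct (Bolzano_Weierstrass u (fun c => - C <= c <= C)) as [l Hl].
  { apply compact_P3. }
  { intros n. now apply Rabs_le_between. }
  assert (Hc : forall n N : nat, exists p, (N <= p)%nat /\ Rabs (u p - l) < / (INR n + 1)).
  { intros n N.
    assert (Hp : 0 < / (INR n + 1)).
    { apply Rinv_0_lt_compat. pose proof (pos_INR n); lra. }
    destruct (Hl (disc l (mkposreal _ Hp)) N) as [p [Hp1 Hp2]].
    - now exists (mkposreal _ Hp).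
    - exists p; split; easy. }
  set (pick := fun n N => proj1_sig (constructive_indefinite_description _ (Hc n N))).
  assert (Hpick : forall n N, (N <= pick n N)%nat /\ Rabs (u (pick n N) - l) < / (INR n + 1)).
  { intros n N. unfold pick. now destruct (constructive_indefinite_description _ (Hc n N)). }
  set (phi := fix phi n := match n with O => pick 0%nat 0%nat | S m => pick (S m) (S (phi m)) end).
  exists phi; split.
  - intros n. simpl. destruct (Hpick (S n) (S (phi n))). lia.
  - exists l. apply is_lim_seq_spec. intros [e He]. simpl.
    destruct (archimed_cor1 e He) as [N [HN1 HN2]].
    exists N. intros n Hn.
    assert (Hn' : Rabs (u (phi n) - l) < / (INR n + 1)).
    { destruct n; apply Hpick. }
    eapply Rlt_le_trans; [apply Hn'|]. apply Rle_trans with (/ INR N); [|lra].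
    apply Rinv_le_contravar; [now apply lt_0_INR|].
    apply le_INR in Hn. lra.
Qed.

(** The extraction for all the coordinates at once: the [k]-th stage refines the
    previous one so that the coordinate [k] converges, and the diagonal is
    eventually a subsequence of every stage. *)
Lemma diagonal_subseq (u : nat -> nat -> R) (C : nat -> R) :
  (forall n k, Rabs (u n k) <= C k) ->
  exists phi : nat -> nat, (forall n, (phi n < phi (S n))%nat) /\
    forall k, ex_finite_lim_seq (fun n => u (phi n) k).
Proof.
  intros Hu.
  assert (Hb : forall (psi : nat -> nat) k, exists sig : nat -> nat,
     (forall n, (sig n < sig (S n))%nat) /\
     ex_finite_lim_seq (fun n => u (psi (sig n)) k)).
  { intros psi k. apply (bounded_subseq (fun n => u (psi n) k) (C k)). intros; apply Hu. }
  set (sg := fun psi k => proj1_sig (constructive_indefinite_description _ (Hb psi k))).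
  assert (Hsg : forall psi k, (forall n, (sg psi k n < sg psi k (S n))%nat) /\
     ex_finite_lim_seq (fun n => u (psi (sg psi k n)) k)).
  { intros psi k. unfold sg.
    now destruct (constructive_indefinite_description _ (Hb psi k)). }
  set (Psi := fix Psi k : nat -> nat :=
     match k with O => fun n => n | S k' => fun n => Psi k' (sg (Psi k') k' n) end).
  assert (Hinc : forall k n, (Psi k n < Psi k (S n))%nat).
  { induction k as [|k IH]; intros n; simpl; [lia|].
    apply subseq_lt; [apply IH|apply Hsg]. }
  (* this makes the diagonal, from rank [k] on, run through stage [k] *)
  assert (Hfac : forall k d n, exists m, (n <= m)%nat /\ Psi (k + d)%nat n = Psi k m).
  { intros k d. induction d as [|d IH]; intros n.
    - exists n. rewrite Nat.add_0_r. split; [lia|easy].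
    - rewrite Nat.add_succ_r. simpl.
      destruct (IH (sg (Psi (k + d)%nat) (k + d)%nat n)) as [m [Hm1 Hm2]].
      exists m; split; [|easy].
      pose proof (subseq_ge _ (proj1 (Hsg (Psi (k + d)%nat) (k + d)%nat)) n). lia. }
  exists (fun n => Psi n n). split.
  - intros n. simpl.
    apply Nat.lt_le_trans with (Psi n (S n)); [apply Hinc|].
    pose proof (subseq_ge _ (proj1 (Hsg (Psi n) n)) (S n)) as Hge.
    destruct (Nat.eq_dec (S n) (sg (Psi n) n (S n))) as [<-|Hne]; [lia|].
    apply Nat.lt_le_incl, subseq_lt; [apply Hinc|lia].
  - intros k. destruct (Hsg (Psi k) k) as [_ [l Hl]].
    exists l. apply is_lim_seq_spec in Hl. apply is_lim_seq_spec.
    intros e. destruct (Hl e) as [N HN].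
    exists (S k + N)%nat. intros n Hn.
    destruct (Hfac (S k) (n - S k)%nat n) as [m [Hm1 Hm2]].
    replace (S k + (n - S k))%nat with n in Hm2 by lia.
    rewrite Hm2. simpl. apply HN. lia.
Qed.

(** An enumeration of the rational numbers, with repetitions. *)
Definition rat (k : nat) : R :=
  let (i, p) := Cantor.of_nat k in
  let (j, l) := Cantor.of_nat p in
  (INR i - INR j) / (INR l + 1).

Lemma rat_dense x e : 0 < e -> exists k, Rabs (rat k - x) < e.
Proof.
  intros He. destruct (archimed_cor1 e He) as [l [Hl1 Hl2]].
  pose proof (lt_0_INR _ Hl2) as Hl3.
  set (z := up (x * (INR l + 1))).
  exists (Cantor.to_nat (Z.to_nat z, Cantor.to_nat (Z.to_nat (- z), l))).
  unfold rat. rewrite !Cantor.cancel_of_to.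
  replace (INR (Z.to_nat z) - INR (Z.to_nat (- z))) with (IZR z).
  2:{ rewrite !INR_IZR_INZ, <- minus_IZR. f_equal. lia. }
  pose proof (archimed (x * (INR l + 1))) as [H1 H2]. fold z in H1, H2.
  apply Rle_lt_trans with (/ (INR l + 1)).
  - replace (IZR z / (INR l + 1) - x) with ((IZR z - x * (INR l + 1)) * / (INR l + 1))
      by (field; lra).
    rewrite Rabs_mult, (Rabs_pos_eq (/ _)), (Rabs_pos_eq (_ - _)).
    + rewrite <- (Rmult_1_l (/ (INR l + 1))) at 2. apply Rmult_le_compat_r; [|lra].
      apply Rlt_le, Rinv_0_lt_compat; lra.
    + lra.
    + apply Rlt_le, Rinv_0_lt_compat; lra.
  - apply Rle_lt_trans with (/ INR l); [|easy]. apply Rinv_le_contravar; lra.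
Qed.

(** The Arzela-Ascoli argument: convergence at the rational points of [D] spreads to
    [D] by equicontinuity.  The defect [e n] lets it apply to step functions, and the
    index [j] extracts one subsequence for several functions at a time. *)
Lemma equicontinuous_subseq (D : R -> Prop) (F : nat -> nat -> R -> R)
    (C L : R) (e : nat -> R) :
  open D ->
  (forall n j x, D x -> Rabs (F n j x) <= C) ->
  (forall n j x y, D x -> D y -> Rabs (F n j x - F n j y) <= L * Rabs (x - y) + e n) ->
  is_lim_seq e 0 ->
  exists phi : nat -> nat, (forall n, (phi n < phi (S n))%nat) /\
    forall j x, D x -> ex_finite_lim_seq (fun n => F (phi n) j x).
Proof.
  intros HD HC HL He.
  set (u := fun n k => let (j, q) := Cantor.of_nat k in
     if excluded_middle_informative (D (rat q)) then F n j (rat q) else 0).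
  destruct (diagonal_subseq u (fun _ => Rabs C)) as [phi [Hphi Hlim]].
  { intros n k. unfold u. destruct (Cantor.of_nat k) as [j q].
    destruct (excluded_middle_informative (D (rat q))) as [Hq|Hq].
    - eapply Rle_trans; [now apply HC|apply Rle_abs].
    - rewrite Rabs_R0; apply Rabs_pos. }
  exists phi; split; [easy|].
  intros j x Hx. apply ex_lim_seq_cauchy_corr.
  intros [ep Hep]; simpl.
  destruct (HD x Hx) as [d Hd].
  set (L' := Rabs L + 1). assert (HL' : 0 < L') by (unfold L'; pose proof (Rabs_pos L); lra).
  destruct (rat_dense x (Rmin d (ep / (8 * L')))) as [q Hq].
  { apply Rmin_pos; [apply cond_pos|]. apply Rdiv_lt_0_compat; lra. }
  assert (HDq : D (rat q)).
  { apply Hd. change (Rabs (rat q - x) < d). eapply Rlt_le_trans; [apply Hq|apply Rmin_l]. }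
  assert (Hq2 : Rabs (rat q - x) < ep / (8 * L'))
    by (eapply Rlt_le_trans; [apply Hq|apply Rmin_r]).
  assert (Hq3 : L * Rabs (x - rat q) <= ep / 8).
  { rewrite Rabs_minus_sym.
    apply Rle_trans with (L' * (ep / (8 * L'))).
    - apply Rle_trans with (L' * Rabs (rat q - x)).
      + apply Rmult_le_compat_r; [apply Rabs_pos|]. unfold L'. pose proof (Rle_abs L); lra.
      + apply Rmult_le_compat_l; lra.
    - right; field; lra. }
  apply (is_lim_seq_subseq _ _ phi) in He; [|now apply eventually_subseq].
  apply is_lim_seq_spec in He.
  assert (H8 : 0 < ep / 8) by lra.
  destruct (He (mkposreal _ H8)) as [N1 HN1]; simpl in HN1.
  pose proof (Cantor.cancel_of_to (j, q)) as Hk.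
  specialize (Hlim (Cantor.to_nat (j, q))).
  set (k := Cantor.to_nat (j, q)) in *. clearbody k.
  apply ex_lim_seq_cauchy_corr in Hlim.
  destruct (Hlim (mkposreal _ H8)) as [N2 HN2]; simpl in HN2.
  exists (N1 + N2)%nat. intros n m Hn Hm.
  specialize (HN2 n m ltac:(lia) ltac:(lia)).
  unfold u in HN2. rewrite Hk in HN2.
  destruct (excluded_middle_informative (D (rat q))) as [_|Hno]; [|easy].
  pose proof (HN1 n ltac:(lia)) as E1. pose proof (HN1 m ltac:(lia)) as E2.
  pose proof (HL (phi n) j x (rat q) Hx HDq) as B1.
  pose proof (HL (phi m) j x (rat q) Hx HDq) as B2.
  apply Rabs_def2 in E1. apply Rabs_def2 in E2. apply Rabs_def2 in HN2.
  apply Rabs_le_between in B1. apply Rabs_le_between in B2.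
  apply Rabs_def1; lra.
Qed.

(** * Quadratic forms on the simplex *)

Definition in_simplex (N : nat) (p : nat -> R) : Prop :=
  (forall i, 0 <= p i) /\ rsum N p = 1.

Definition qform (N : nat) (A : nat -> nat -> R) (p : nat -> R) : R :=
  rsum N (fun i => p i * rsum N (fun j => A i j * p j)).

Lemma in_simplex_le1 N p i : in_simplex N p -> (i < N)%nat -> p i <= 1.
Proof.
  intros [H1 H2] Hi. rewrite <- H2. apply rsum_term_le; [intros; apply H1|easy].
Qed.

Lemma qform_max (N : nat) (A : nat -> nat -> R) :
  (0 < N)%nat ->
  exists p, in_simplex N p /\ forall q, in_simplex N q -> qform N A q <= qform N A p.
Proof.
  intros HN.
  set (E := fun v => exists p, in_simplex N p /\ v = qform N A p).
  assert (Hbd : bound E).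
  { exists (rsum N (fun i => rsum N (fun j => Rabs (A i j)))).
    intros v [p [Hp ->]]. unfold qform. apply rsum_le. intros i Hi.
    rewrite <- rsum_scal. apply rsum_le. intros j Hj.
    pose proof (in_simplex_le1 N p i Hp Hi). pose proof (in_simplex_le1 N p j Hp Hj).
    destruct Hp as [Hp _]. pose proof (Hp i). pose proof (Hp j).
    pose proof (Rle_abs (A i j)). pose proof (Rabs_pos (A i j)).
    apply Rle_trans with (Rabs (A i j) * (p i * p j)).
    { replace (p i * (A i j * p j)) with (A i j * (p i * p j)) by ring.
      apply Rmult_le_compat_r; nra. }
    rewrite <- (Rmult_1_r (Rabs (A i j))) at 2. apply Rmult_le_compat_l; nra. }
  assert (Hne : exists v, E v).
  { eexists; exists (fun i => if Nat.eq_dec i 0 then 1 else 0); split; [|reflexivity].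
    split.
    - intros i; destruct (Nat.eq_dec i 0); lra.
    - exact (rsum_delta N 0 (fun _ => 1) HN). }
  destruct (completeness E Hbd Hne) as [M [HM1 HM2]].
  destruct (sup_sequence E M (conj HM1 HM2)) as [v Hv].
  assert (Happ : forall n, exists p, in_simplex N p /\ M - / (INR n + 1) < qform N A p).
  { intros n. destruct (Hv n) as [[p [Hp E1]] E2]. exists p. now rewrite <- E1. }
  apply choice in Happ. destruct Happ as [P HP].
  set (u := fun n k => if lt_dec k N then P n k else 0).
  destruct (diagonal_subseq u (fun _ => 1)) as [phi [Hphi Hlim]].
  { intros n k. unfold u. destruct (lt_dec k N) as [Hk|Hk].
    - rewrite Rabs_pos_eq; [|apply (HP n)].
      apply (in_simplex_le1 N); [apply HP|easy].
    - rewrite Rabs_R0; lra. }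
  apply choice in Hlim. destruct Hlim as [p Hp].
  assert (Hp' : forall i, (i < N)%nat -> is_lim_seq (fun n => P (phi n) i) (p i)).
  { intros i Hi. eapply is_lim_seq_ext; [|apply Hp].
    intros n. unfold u. now destruct (lt_dec i N). }
  assert (Hsimp : in_simplex N p).
  { split.
    - intros i.
      change (Rbar_le 0 (p i)).
      eapply is_lim_seq_le; [|apply is_lim_seq_const|apply Hp].
      intros n. unfold u. destruct (lt_dec i N); [apply HP|simpl; lra].
    - pose proof (is_lim_seq_rsum N (fun n => P (phi n)) p Hp') as H.
      assert (H1 : is_lim_seq (fun n => rsum N (P (phi n))) 1).
      { eapply is_lim_seq_ext; [|apply is_lim_seq_const].
        intros n. symmetry. apply (HP (phi n)). }
      apply is_lim_seq_unique in H. apply is_lim_seq_unique in H1.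
      rewrite H in H1. now injection H1. }
  exists p; split; [easy|]. intros q Hq.
  apply Rle_trans with M; [apply HM1; now exists q|].
  assert (HQ : is_lim_seq (fun n => qform N A (P (phi n))) (qform N A p)).
  { unfold qform. apply is_lim_seq_rsum. intros i Hi.
    apply is_lim_seq_mult'; [now apply Hp'|].
    apply is_lim_seq_rsum. intros j Hj.
    apply is_lim_seq_mult'; [apply is_lim_seq_const|now apply Hp']. }
  assert (HM : is_lim_seq (fun n => M - / (INR n + 1)) M).
  { apply is_lim_seq_minus_inv. }
  change (Rbar_le M (qform N A p)).
  eapply is_lim_seq_le; [|apply HM|apply HQ].
  intros n. destruct (HP (phi n)) as [_ H]. apply Rlt_le.
  eapply Rle_lt_trans; [|apply H].
  assert (H' : / (INR (phi n) + 1) <= / (INR n + 1)); [|lra].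
  pose proof (subseq_ge phi Hphi n) as Hge. apply le_INR in Hge.
  pose proof (pos_INR n).
  apply Rinv_le_contravar; lra.
Qed.

(** First-order optimality: moving mass from an index [i] with [p i > 0] to any
    other index [j] cannot increase the form, so the gradient is maximal on the
    support of [p]; its value there is the value of the form. *)
Lemma qform_max_kkt (N : nat) (A : nat -> nat -> R) :
  (0 < N)%nat -> (forall i j, A i j = A j i) ->
  exists p M, in_simplex N p /\
    (forall q, in_simplex N q -> qform N A q <= M) /\
    qform N A p = M /\
    (forall i, (i < N)%nat -> rsum N (fun j => A i j * p j) <= M) /\
    (forall i, (i < N)%nat -> 0 < p i -> rsum N (fun j => A i j * p j) = M).
Proof.
  intros HN Hsym. destruct (qform_max N A HN) as [p [Hp Hmax]].
  set (g := fun i => rsum N (fun j => A i j * p j)).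
  assert (Hkkt : forall i j, (i < N)%nat -> (j < N)%nat -> 0 < p i -> g j <= g i).
  { intros i j Hi Hj Hpi. apply Rnot_lt_le. intros Hlt.
    destruct (Nat.eq_dec i j) as [<-|Hij]; [lra|].
    set (d := fun k => (if Nat.eq_dec k j then 1 else 0) - (if Nat.eq_dec k i then 1 else 0)).
    assert (Hd : forall f, rsum N (fun k => d k * f k) = f j - f i).
    { intros f. rewrite <- (rsum_delta N j f Hj), <- (rsum_delta N i f Hi), <- rsum_minus.
      apply rsum_ext. intros k _. unfold d.
      destruct (Nat.eq_dec k j); destruct (Nat.eq_dec k i); ring. }
    set (c := A j j - A j i - A i j + A i i).
    assert (Hq : forall t, qform N A (fun k => p k + t * d k)
                    = qform N A p + 2 * t * (g j - g i) + t * t * c).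
    { intros t. unfold qform.
      rewrite (rsum_ext N _ (fun k => p k * g k + t * (p k * (A k j - A k i))
                  + t * (d k * g k) + t * t * (d k * (A k j - A k i)))).
      2:{ intros k _. 
          replace (rsum N (fun j0 => A k j0 * (p j0 + t * d j0))) with (g k + t * (A k j - A k i)).
          - ring.
          - rewrite <- (Hd (fun l => A k l)), <- rsum_scal. unfold g.
            rewrite <- rsum_plus. apply rsum_ext; intros; ring. }
      rewrite !rsum_plus, !rsum_scal.
      rewrite (Hd g), (Hd (fun k => A k j - A k i)).
      replace (rsum N (fun k => p k * (A k j - A k i))) with (g j - g i).
      - unfold c, g. ring.
      - unfold g. rewrite <- rsum_minus. apply rsum_ext. intros k _.
        rewrite (Hsym j k), (Hsym i k). ring. }
    (* at most [p i], to stay in the simplex, and so small that the first-order gain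
       beats the second-order term *)
    set (t := Rmin (p i) ((g j - g i) / (Rabs c + 1))).
    pose proof (Rabs_pos c) as Hc.
    assert (Ht : 0 < t).
    { apply Rmin_pos; [easy|]. apply Rdiv_lt_0_compat; lra. }
    assert (Ht2 : t * (Rabs c + 1) <= g j - g i).
    { apply Rle_trans with ((g j - g i) / (Rabs c + 1) * (Rabs c + 1)).
      - apply Rmult_le_compat_r; [lra|apply Rmin_r].
      - right; field; lra. }
    assert (Hin : in_simplex N (fun k => p k + t * d k)).
    { destruct Hp as [Hp1 Hp2]. split.
      - intros k. unfold d. specialize (Hp1 k).
        destruct (Nat.eq_dec k j); destruct (Nat.eq_dec k i) as [->|]; try lra.
        pose proof (Rmin_l (p i) ((g j - g i) / (Rabs c + 1))). fold t in H. lra.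
      - rewrite rsum_plus, rsum_scal.
        rewrite (rsum_ext N d (fun k => d k * 1)) by (intros; ring).
        rewrite (Hd (fun _ => 1)), Hp2. ring. }
    apply Hmax in Hin. rewrite Hq in Hin.
    pose proof (Rle_abs (- c)) as Hc2. rewrite Rabs_Ropp in Hc2.
    assert (0 < t * (2 * (g j - g i) + t * c)); [|nra].
    apply Rmult_lt_0_compat; [easy|]. nra. }
  exists p, (qform N A p). split; [easy|]. split; [easy|]. split; [easy|].
  assert (Heq : forall i, (i < N)%nat -> 0 < p i -> g i = qform N A p).
  { intros i Hi Hpi. unfold qform. fold g.
    rewrite (rsum_ext N _ (fun k => g i * p k)).
    - rewrite rsum_scal, (proj2 Hp). ring.
    - intros k Hk. change (p k * g k = g i * p k). destruct (Req_dec (p k) 0) as [->|Hk0]; [ring|].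
      assert (Hpk : 0 < p k) by (pose proof (proj1 Hp k); lra).
      rewrite (Rle_antisym (g k) (g i)); [ring|now apply Hkkt|now apply Hkkt]. }
  split; [|exact Heq].
  intros j Hj.
  destruct (excluded_middle_informative (exists i, (i < N)%nat /\ 0 < p i)) as [[i [Hi Hpi]]|Hno].
  - change (g j <= qform N A p). rewrite <- (Heq i Hi Hpi). now apply Hkkt.
  - exfalso. destruct Hp as [Hp1 Hp2].
    rewrite (rsum_ext N p (fun _ => 0)), rsum_const in Hp2; [lra|].
    intros i Hi. destruct (Req_dec (p i) 0) as [|Hpi]; [easy|].
    exfalso; apply Hno. exists i; split; [easy|]. pose proof (Hp1 i); lra.
Qed.

(** * Calculus on intervals *)

Lemma is_derive_eq (f : R -> R) (x l l' : R) : is_derive f x l -> l = l' -> is_derive f x l'.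
Proof. now intros H <-. Qed.

Lemma is_derive_continuity_pt (f : R -> R) x l : is_derive f x l -> continuity_pt f x.
Proof.
  intros H. apply continuity_pt_filterlim.
  apply (ex_derive_continuous f x). now exists l.
Qed.

Lemma mean_value (f df : R -> R) x y :
  (forall z, Rmin x y <= z <= Rmax x y -> is_derive f z (df z)) ->
  exists z, Rmin x y <= z <= Rmax x y /\ f y - f x = df z * (y - x).
Proof.
  intros H. apply MVT_gen.
  - intros z Hz. apply H. lra.
  - intros z Hz. eapply is_derive_continuity_pt. now apply H.
Qed.

Lemma lipschitz_of_derive (f df : R -> R) (M a b x y : R) :
  (forall z, a < z < b -> is_derive f z (df z)) ->
  (forall z, a < z < b -> Rabs (df z) <= M) ->
  a < x < b -> a < y < b -> Rabs (f y - f x) <= M * Rabs (y - x).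
Proof.
  intros Hd HM Hx Hy.
  assert (Hin : forall z, Rmin x y <= z <= Rmax x y -> a < z < b).
  { intros z Hz. unfold Rmin, Rmax in Hz. destruct (Rle_dec x y); lra. }
  destruct (mean_value f df x y) as [z [Hz ->]].
  { intros z Hz. now apply Hd, Hin. }
  rewrite Rabs_mult. apply Rmult_le_compat_r; [apply Rabs_pos|]. now apply HM, Hin.
Qed.

Lemma nondecreasing_of_derive (f df : R -> R) (a b x y : R) :
  (forall z, a < z < b -> is_derive f z (df z)) ->
  (forall z, a < z < b -> 0 <= df z) ->
  a < x -> x <= y -> y < b -> f x <= f y.
Proof.
  intros Hd HM Hx Hxy Hy.
  destruct (mean_value f df x y) as [z [Hz E]].
  { intros z Hz. apply Hd. rewrite Rmin_left, Rmax_right in Hz by lra. lra. }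
  rewrite Rmin_left, Rmax_right in Hz by lra.
  specialize (HM z ltac:(lra)). nra.
Qed.

Lemma at_right_spec (P : R -> Prop) a :
  at_right a P <-> exists d, 0 < d /\ forall x, a < x < a + d -> P x.
Proof.
  split.
  - intros [d Hd]. exists d. split; [apply cond_pos|].
    intros x Hx. apply Hd; [|lra]. change (Rabs (x - a) < d). apply Rabs_def1; lra.
  - intros [d [Hd H]]. exists (mkposreal d Hd). intros x Hx Hax. apply H.
    change (Rabs (x - a) < d) in Hx. apply Rabs_def2 in Hx. lra.
Qed.

Lemma at_left_spec (P : R -> Prop) a :
  at_left a P <-> exists d, 0 < d /\ forall x, a - d < x < a -> P x.
Proof.
  split.
  - intros [d Hd]. exists d. split; [apply cond_pos|].
    intros x Hx. apply Hd; [|lra]. change (Rabs (x - a) < d). apply Rabs_def1; lra.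
  - intros [d [Hd H]]. exists (mkposreal d Hd). intros x Hx Hax. apply H.
    change (Rabs (x - a) < d) in Hx. apply Rabs_def2 in Hx. lra.
Qed.

Lemma filterlim_eps {F : (R -> Prop) -> Prop} {FF : Filter F} (f : R -> R) l :
  filterlim f F (locally l) <-> forall e, 0 < e -> F (fun x => Rabs (f x - l) < e).
Proof.
  split.
  - intros H e He. apply (H (fun y => Rabs (y - l) < e)).
    now exists (mkposreal e He).
  - intros H P [e He]. unfold filtermap.
    eapply filter_imp; [|apply (H e), cond_pos]. intros x Hx. now apply He.
Qed.

Lemma filterlim_mult_bounded {F : (R -> Prop) -> Prop} {FF : Filter F} (f g : R -> R) M :
  filterlim f F (locally 0) -> F (fun x => Rabs (g x) <= M) ->
  filterlim (fun x => f x * g x) F (locally 0).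
Proof.
  intros Hf Hg. apply filterlim_eps. intros e He.
  rewrite filterlim_eps in Hf.
  assert (HM : 0 < Rabs M + 1) by (pose proof (Rabs_pos M); lra).
  specialize (Hf (e / (Rabs M + 1)) ltac:(apply Rdiv_lt_0_compat; lra)).
  generalize (filter_and _ _ Hf Hg). apply filter_imp.
  intros x [H1 H2]. rewrite Rminus_0_r in *. rewrite Rabs_mult.
  apply Rle_lt_trans with (Rabs (f x) * (Rabs M + 1)).
  - apply Rmult_le_compat_l; [apply Rabs_pos|]. pose proof (Rle_abs M); lra.
  - apply Rlt_le_trans with (e / (Rabs M + 1) * (Rabs M + 1)).
    + now apply Rmult_lt_compat_r.
    + right; field; lra.
Qed.

Lemma near_right_end (f : R -> R) (a l x e : R) :
  filterlim f (at_right a) (locally l) -> a < x -> 0 < e ->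
  exists y, a < y <= x /\ y < a + e /\ Rabs (f y - l) < e.
Proof.
  intros Ha Hx He. apply (proj1 (filterlim_eps _ _)) with (e := e) in Ha; [|easy].
  apply at_right_spec in Ha. destruct Ha as [d [Hd H]].
  exists (Rmin x (a + Rmin d e / 2)).
  assert (Hm : 0 < Rmin d e) by now apply Rmin_pos.
  pose proof (Rmin_l d e). pose proof (Rmin_r d e).
  pose proof (Rmin_l x (a + Rmin d e / 2)). pose proof (Rmin_r x (a + Rmin d e / 2)).
  assert (a < Rmin x (a + Rmin d e / 2)) by (apply Rmin_glb_lt; lra).
  split; [lra|]. split; [lra|]. apply H. lra.
Qed.

Lemma near_left_end (f : R -> R) (b l x e : R) :
  filterlim f (at_left b) (locally l) -> x < b -> 0 < e ->
  exists y, x <= y < b /\ b - e < y /\ Rabs (f y - l) < e.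
Proof.
  intros Hb Hx He. apply (proj1 (filterlim_eps _ _)) with (e := e) in Hb; [|easy].
  apply at_left_spec in Hb. destruct Hb as [d [Hd H]].
  exists (Rmax x (b - Rmin d e / 2)).
  assert (Hm : 0 < Rmin d e) by now apply Rmin_pos.
  pose proof (Rmin_l d e). pose proof (Rmin_r d e).
  pose proof (Rmax_l x (b - Rmin d e / 2)). pose proof (Rmax_r x (b - Rmin d e / 2)).
  assert (Rmax x (b - Rmin d e / 2) < b) by (apply Rmax_lub_lt; lra).
  split; [lra|]. split; [lra|]. apply H. lra.
Qed.

Lemma nondecreasing_end_limits (f df : R -> R) (a b la lb x : R) :
  (forall z, a < z < b -> is_derive f z (df z)) ->
  (forall z, a < z < b -> 0 <= df z) ->
  filterlim f (at_right a) (locally la) ->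
  filterlim f (at_left b) (locally lb) ->
  a < x < b -> la <= f x <= lb.
Proof.
  intros Hd Hp Ha Hb Hx. split; apply Rnot_lt_le; intros Hlt.
  - destruct (near_right_end f a la x (la - f x) Ha ltac:(lra) ltac:(lra)) as [y [Hy [_ Hf]]].
    pose proof (nondecreasing_of_derive f df a b y x Hd Hp ltac:(lra) ltac:(lra) ltac:(lra)).
    apply Rabs_def2 in Hf. lra.
  - destruct (near_left_end f b lb x (f x - lb) Hb ltac:(lra) ltac:(lra)) as [y [Hy [_ Hf]]].
    pose proof (nondecreasing_of_derive f df a b x y Hd Hp ltac:(lra) ltac:(lra) ltac:(lra)).
    apply Rabs_def2 in Hf. lra.
Qed.

Lemma bounded_of_end_limits (f : R -> R) (a b la lb : R) :
  (forall x, a < x < b -> continuity_pt f x) ->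
  filterlim f (at_right a) (locally la) ->
  filterlim f (at_left b) (locally lb) ->
  exists M, forall x, a < x < b -> Rabs (f x) <= M.
Proof.
  intros Hc Ha Hb. pose proof (proj1 (filterlim_eps _ _) Ha) as Ha'. pose proof (proj1 (filterlim_eps _ _) Hb) as Hb'.
  clear Ha Hb. rename Ha' into Ha, Hb' into Hb.
  specialize (Ha 1 Rlt_0_1). specialize (Hb 1 Rlt_0_1).
  apply at_right_spec in Ha. apply at_left_spec in Hb.
  destruct Ha as [d1 [Hd1 Ha]]. destruct Hb as [d2 [Hd2 Hb]].
  assert (Hmid : exists M, forall x, a + d1 / 2 <= x <= b - d2 / 2 -> Rabs (f x) <= M).
  { destruct (Rle_dec (a + d1 / 2) (b - d2 / 2)) as [Hle|Hgt].
    - destruct (continuity_ab_maj (fun x => Rabs (f x)) _ _ Hle) as [m [Hm _]].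
      + intros c Hcc. apply (continuity_pt_comp f Rabs).
        * apply Hc; lra.
        * apply Rcontinuity_abs.
      + now exists (Rabs (f m)).
    - exists 0. intros x Hx. lra. }
  destruct Hmid as [M HM].
  exists (Rmax M (Rmax (Rabs la + 1) (Rabs lb + 1))).
  intros x Hx.
  destruct (Rlt_dec x (a + d1)) as [H1|H1].
  - eapply Rle_trans; [|apply Rmax_r]. eapply Rle_trans; [|apply Rmax_l].
    specialize (Ha x ltac:(lra)). pose proof (Rabs_triang_inv (f x) la). lra.
  - destruct (Rlt_dec (b - d2) x) as [H2|H2].
    + eapply Rle_trans; [|apply Rmax_r]. eapply Rle_trans; [|apply Rmax_r].
      specialize (Hb x ltac:(lra)). pose proof (Rabs_triang_inv (f x) lb). lra.
    + eapply Rle_trans; [|apply Rmax_l]. apply HM. lra.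
Qed.

Lemma filterlim_of_derive (f : R -> R) x l (F : (R -> Prop) -> Prop) :
  filter_le F (locally x) -> is_derive f x l -> filterlim f F (locally (f x)).
Proof.
  intros HF Hd. eapply filterlim_filter_le_1; [apply HF|].
  apply (ex_derive_continuous f). now exists l.
Qed.

(** A quadratic Taylor remainder is a form of differentiability that survives
    pointwise limits. *)
Lemma is_derive_of_quadratic (f : R -> R) (a b x l C : R) :
  a < x < b ->
  (forall y, a < y < b -> Rabs (f y - f x - l * (y - x)) <= C * (y - x) ^ 2) ->
  is_derive f x l.
Proof.
  intros Hx H. apply is_derive_Reals. intros e He.
  set (C' := Rabs C + 1). assert (HC : 0 < C') by (unfold C'; pose proof (Rabs_pos C); lra).
  assert (Hd : 0 < Rmin (Rmin (x - a) (b - x)) (e / C')).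
  { repeat apply Rmin_pos; try lra. now apply Rdiv_lt_0_compat. }
  exists (mkposreal _ Hd). intros h Hh Hhd. simpl in Hhd.
  assert (H1 : Rabs h < x - a).
  { eapply Rlt_le_trans; [apply Hhd|]. eapply Rle_trans; apply Rmin_l. }
  assert (H2 : Rabs h < b - x).
  { eapply Rlt_le_trans; [apply Hhd|]. eapply Rle_trans; [apply Rmin_l|apply Rmin_r]. }
  assert (H3 : Rabs h < e / C').
  { eapply Rlt_le_trans; [apply Hhd|]. apply Rmin_r. }
  apply Rabs_def2 in H1. apply Rabs_def2 in H2.
  specialize (H (x + h) ltac:(lra)). replace (x + h - x) with h in H by ring.
  assert (Hah : 0 < Rabs h) by now apply Rabs_pos_lt.
  replace ((f (x + h) - f x) / h - l) with ((f (x + h) - f x - l * h) / h) by (field; easy).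
  unfold Rdiv. rewrite Rabs_mult, Rabs_inv.
  apply Rmult_lt_reg_r with (Rabs h); [easy|].
  rewrite Rmult_assoc, Rinv_l, Rmult_1_r by lra.
  eapply Rle_lt_trans; [apply H|].
  apply Rle_lt_trans with (C' * Rabs h * Rabs h).
  - rewrite <- (pow2_abs h). simpl. rewrite Rmult_1_r, <- Rmult_assoc.
    apply Rmult_le_compat_r; [lra|]. apply Rmult_le_compat_r; [lra|].
    unfold C'. pose proof (Rle_abs C); lra.
  - apply Rmult_lt_compat_r; [easy|].
    apply Rlt_le_trans with (C' * (e / C')); [now apply Rmult_lt_compat_l|].
    right; field; lra.
Qed.

(** A net of finitely many points of [D], one in each small cell that meets [D],
    turns pointwise into uniform convergence. *)
Lemma uniform_of_pointwise (D : R -> Prop) (F : nat -> R -> R) (f : R -> R)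
    (L : R) (e : nat -> R) (R0 : R) :
  0 < L ->
  (forall n x y, D x -> D y -> Rabs (F n x - F n y) <= L * Rabs (x - y) + e n) ->
  is_lim_seq e 0 ->
  (forall x, D x -> is_lim_seq (fun n => F n x) (f x)) ->
  (forall x, D x -> Rabs x <= R0) ->
  forall eta, 0 < eta ->
  exists N, forall n, (N <= n)%nat -> forall x, D x -> Rabs (F n x - f x) <= eta.
Proof.
  intros HL HF He Hlim HD eta Heta.
  assert (Hf : forall x y, D x -> D y -> Rabs (f x - f y) <= L * Rabs (x - y)).
  { intros x y Hx Hy.
    change (Rbar_le (Rabs (f x - f y)) (L * Rabs (x - y))).
    apply is_lim_seq_le with (fun n => Rabs (F n x - F n y)) (fun n => L * Rabs (x - y) + e n).
    - intros n. now apply HF.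
    - apply (is_lim_seq_abs _ (f x - f y)). apply is_lim_seq_minus'; now apply Hlim.
    - replace (Finite (L * Rabs (x - y))) with (Finite (L * Rabs (x - y) + 0))
        by (f_equal; ring).
      apply is_lim_seq_plus'; [apply is_lim_seq_const|easy]. }
  set (d := eta / (8 * L)). assert (Hd : 0 < d) by (apply Rdiv_lt_0_compat; lra).
  assert (HLd : L * d = eta / 8) by (unfold d; field; lra).
  assert (Hcell : forall m, exists N, forall n, (N <= n)%nat ->
     forall x, D x -> x <= - R0 + INR m * d -> Rabs (F n x - f x) <= eta).
  { induction m as [|m [N HN]].
    - destruct (excluded_middle_informative (D (- R0))) as [HR|HR].
      + pose proof (Hlim _ HR) as Hl. apply is_lim_seq_spec in Hl.
        destruct (Hl (mkposreal _ Heta)) as [N HN]. exists N. intros n Hn x Hx Hx'.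
        apply HD, Rabs_le_between in Hx. simpl in *.
        replace x with (- R0) by lra. apply Rlt_le. now apply HN.
      + exists O. intros n _ x Hx Hx'. exfalso. apply HR.
        pose proof (HD _ Hx) as Hx2. apply Rabs_le_between in Hx2. simpl in Hx'.
        now replace (- R0) with x by lra.
    - destruct (excluded_middle_informative
        (exists y, D y /\ - R0 + INR m * d <= y <= - R0 + INR (S m) * d)) as [[y [Hy Hy']]|Hno].
      + pose proof (Hlim _ Hy) as Hl. apply is_lim_seq_spec in Hl.
        assert (H4 : 0 < eta / 4) by lra.
        destruct (Hl (mkposreal _ H4)) as [N1 HN1].
        apply is_lim_seq_spec in He. destruct (He (mkposreal _ H4)) as [N2 HN2].
        simpl in HN1, HN2.
        exists (N + (N1 + N2))%nat. intros n Hn x Hx Hx'.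
        destruct (Rle_dec x (- R0 + INR m * d)) as [Hle|Hgt].
        { apply HN; try easy; lia. }
        assert (Hxy : Rabs (x - y) <= d).
        { rewrite S_INR in *. apply Rabs_le. lra. }
        assert (HLxy : L * Rabs (x - y) <= eta / 8).
        { rewrite <- HLd. apply Rmult_le_compat_l; lra. }
        pose proof (HF n x y Hx Hy) as A1. pose proof (Hf x y Hx Hy) as A2.
        specialize (HN1 n ltac:(lia)). specialize (HN2 n ltac:(lia)).
        apply Rabs_le_between in A1. apply Rabs_le_between in A2.
        apply Rabs_def2 in HN1. apply Rabs_def2 in HN2.
        apply Rabs_le. lra.
      + exists N. intros n Hn x Hx Hx'. apply HN; try easy.
        apply Rnot_lt_le. intros Hlt. apply Hno. exists x. split; [easy|lra]. }
  destruct (nfloor_ex (Rabs (2 * R0) / d)) as [m Hm].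
  { apply Rdiv_le_0_compat; [apply Rabs_pos|easy]. }
  destruct (Hcell (S m)) as [N HN]. exists N. intros n Hn x Hx. apply HN; try easy.
  pose proof (HD x Hx) as Hx2. apply Rabs_le_between in Hx2.
  assert (Rabs (2 * R0) <= INR (S m) * d).
  { apply Rle_trans with (Rabs (2 * R0) / d * d).
    - right; field; lra.
    - apply Rmult_le_compat_r; [lra|]. rewrite S_INR. lra. }
  pose proof (Rle_abs (2 * R0)). lra.
Qed.

Definition tower (D : R -> Prop) (n : nat) (Y : nat -> R -> R) : Prop :=
  forall k x, (k < n)%nat -> D x -> is_derive (Y k) x (Y (S k) x).

Lemma tower_Derive_n (D : R -> Prop) n Y :
  open D -> tower D n Y -> forall k, (k <= n)%nat -> forall x, D x ->
  ex_derive_n (Y 0%nat) k x /\ Derive_n (Y 0%nat) k x = Y k x.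
Proof.
  intros HD HY. induction k as [|k IH]; intros Hk x Hx.
  - split; [exact I|easy].
  - assert (Hloc : locally x (fun y => Y k y = Derive_n (Y 0%nat) k y)).
    { destruct (HD x Hx) as [d Hd]. exists d. intros y Hy.
      symmetry. apply IH; [lia|]. now apply Hd. }
    assert (H : is_derive (Derive_n (Y 0%nat) k) x (Y (S k) x)).
    { apply (is_derive_ext_loc (Y k)); [easy|]. apply HY; [lia|easy]. }
    split.
    + now exists (Y (S k) x).
    + simpl. now apply is_derive_unique.
Qed.

Lemma Derive_n_tower (D : R -> Prop) n v :
  n_times_derivable_on D n v -> tower D n (Derive_n v).
Proof.
  intros H k x Hk Hx. simpl. apply Derive_correct.
  exact (H x Hx (S k) ltac:(lia)).
Qed.

Lemma open_interval a b : open (fun x => a < x < b).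
Proof. apply open_and; [apply open_gt|apply open_lt]. Qed.

Lemma is_derive_Rplus (f g : R -> R) x df dg :
  is_derive f x df -> is_derive g x dg -> is_derive (fun y => f y + g y) x (df + dg).
Proof. apply (is_derive_plus (V := R_NormedModule) f g). Qed.

Lemma is_derive_Rminus (f g : R -> R) x df dg :
  is_derive f x df -> is_derive g x dg -> is_derive (fun y => f y - g y) x (df - dg).
Proof. apply (is_derive_minus (V := R_NormedModule) f g). Qed.

Lemma is_derive_Rmult (f g : R -> R) x df dg :
  is_derive f x df -> is_derive g x dg ->
  is_derive (fun y => f y * g y) x (df * g x + f x * dg).
Proof. intros Hf Hg. apply (is_derive_mult f g); try easy. intros; apply Rmult_comm. Qed.

Lemma is_derive_Rconst (c x : R) : is_derive (fun _ => c) x 0.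
Proof. apply (is_derive_const (V := R_NormedModule) c). Qed.

Lemma is_derive_Rid (x : R) : is_derive (fun y => y) x 1.
Proof. apply (is_derive_id (K := R_AbsRing)). Qed.

Ltac derive_tac :=
  lazymatch goal with
  | |- is_derive (fun _ => ?c) _ _ => apply is_derive_Rconst
  | |- is_derive (fun y => y) _ _ => apply is_derive_Rid
  | |- is_derive (fun y => @?f y + @?g y) _ _ => apply (is_derive_Rplus f g); cbv beta; derive_tac
  | |- is_derive (fun y => @?f y - @?g y) _ _ => apply (is_derive_Rminus f g); cbv beta; derive_tac
  | |- is_derive (fun y => @?f y * @?g y) _ _ => apply (is_derive_Rmult f g); cbv beta; derive_tac
  | |- is_derive _ _ _ => eassumption
  end.

(** * The Fucik spectrum of the clamped problem *)

Lemma pos_neg_part x :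
  (0 <= x /\ pos_part x = x /\ neg_part x = 0) \/ (x <= 0 /\ pos_part x = 0 /\ neg_part x = - x).
Proof.
  unfold pos_part, neg_part. destruct (Rle_dec 0 x) as [H|H].
  - left. rewrite Rmax_left, Rmax_right; lra.
  - right. rewrite Rmax_right, Rmax_left; lra.
Qed.

Ltac case_parts x :=
  let Ep := fresh in let En := fresh in
  destruct (pos_neg_part x) as [[? [Ep En]]|[? [Ep En]]]; rewrite ?Ep, ?En; clear Ep En.

Lemma pos_part_lipschitz x y : Rabs (pos_part x - pos_part y) <= Rabs (x - y).
Proof.
  case_parts x; case_parts y; repeat rewrite Rminus_0_r; try lra; unfold Rabs;
    repeat destruct Rcase_abs; lra.
Qed.

Lemma neg_part_lipschitz x y : Rabs (neg_part x - neg_part y) <= Rabs (x - y).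
Proof.
  case_parts x; case_parts y; unfold Rabs; repeat destruct Rcase_abs; lra.
Qed.

Lemma is_lim_seq_pos_part u (l : R) :
  is_lim_seq u l -> is_lim_seq (fun n => pos_part (u n)) (pos_part l).
Proof.
  intros H. apply is_lim_seq_spec in H. apply is_lim_seq_spec. intros e.
  destruct (H e) as [N HN]. exists N. intros n Hn.
  eapply Rle_lt_trans; [apply pos_part_lipschitz|now apply HN].
Qed.

Lemma is_lim_seq_neg_part u (l : R) :
  is_lim_seq u l -> is_lim_seq (fun n => neg_part (u n)) (neg_part l).
Proof.
  intros H. apply is_lim_seq_spec in H. apply is_lim_seq_spec. intros e.
  destruct (H e) as [N HN]. exists N. intros n Hn.
  eapply Rle_lt_trans; [apply neg_part_lipschitz|now apply HN].
Qed.

(** The Dirichlet problem for a function given together with its derivatives, so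
    that explicit solutions and limits need no iterated [Derive_n]. *)
Definition clamped (r al be : R) (Y : nat -> R -> R) : Prop :=
  tower (fun x => - r < x < r) 4 Y
  /\ (forall x, - r < x < r ->
        Y 4%nat x + 2 * Y 2%nat x + al * pos_part (Y 0%nat x) - be * neg_part (Y 0%nat x) = 0)
  /\ filterlim (Y 0%nat) (at_right (- r)) (locally 0)
  /\ filterlim (Y 0%nat) (at_left r) (locally 0)
  /\ filterlim (Y 1%nat) (at_right (- r)) (locally 0)
  /\ filterlim (Y 1%nat) (at_left r) (locally 0).

Lemma dirichlet_clamped r al be v :
  dirichlet_solution r al be v -> clamped r al be (Derive_n v).
Proof.
  intros [H1 [H2 H3]]. split; [now apply Derive_n_tower|]. split; [exact H2|exact H3].
Qed.

Lemma clamped_dirichlet r al be Y :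
  0 < r -> clamped r al be Y -> dirichlet_solution r al be (Y 0%nat).
Proof.
  intros Hr [H1 [H2 [H3 [H4 [H5 H6]]]]].
  pose proof (tower_Derive_n _ _ _ (open_interval (- r) r) H1) as HT.
  split; [|split; [|split; [|split; [|split]]]]; try easy.
  - intros x Hx k Hk. now apply HT.
  - intros x Hx. rewrite (proj2 (HT 4%nat ltac:(lia) x Hx)), (proj2 (HT 2%nat ltac:(lia) x Hx)).
    now apply H2.
  - eapply filterlim_ext_loc; [|apply H5].
    apply at_right_spec. exists r. split; [easy|]. intros x Hx.
    symmetry. apply (HT 1%nat); [lia|lra].
  - eapply filterlim_ext_loc; [|apply H6].
    apply at_left_spec. exists r. split; [easy|]. intros x Hx.
    symmetry. apply (HT 1%nat); [lia|lra].
Qed.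

(** By the equation [v''' + 2 v'] has the bounded derivative [- al v^+ + be v^-];
    since [v] and [v'] are bounded, so are [v'''] and then [v'']. *)
Lemma clamped_bounded r al be Y :
  0 < r -> clamped r al be Y ->
  exists M, 0 < M /\ forall k x, (k <= 3)%nat -> - r < x < r -> Rabs (Y k x) <= M.
Proof.
  intros Hr [H1 [H2 [H3 [H4 [H5 H6]]]]].
  destruct (bounded_of_end_limits (Y 0%nat) (- r) r 0 0) as [M0 HM0]; try easy.
  { intros x Hx. eapply is_derive_continuity_pt. apply (H1 0%nat); [lia|easy]. }
  destruct (bounded_of_end_limits (Y 1%nat) (- r) r 0 0) as [M1 HM1]; try easy.
  { intros x Hx. eapply is_derive_continuity_pt. apply (H1 1%nat); [lia|easy]. }
  set (Q := (Rabs al + Rabs be) * M0).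
  assert (HG : forall x, - r < x < r ->
     Rabs (Y 3%nat x + 2 * Y 1%nat x) <= Rabs (Y 3%nat 0 + 2 * Y 1%nat 0) + Q * (2 * r)).
  { intros x Hx.
    assert (HL : Rabs ((Y 3%nat x + 2 * Y 1%nat x) - (Y 3%nat 0 + 2 * Y 1%nat 0)) <= Q * Rabs (x - 0)).
    { apply (lipschitz_of_derive (fun x => Y 3%nat x + 2 * Y 1%nat x)
         (fun x => Y 4%nat x + 2 * Y 2%nat x) Q (- r) r); try lra.
      - intros z Hz. apply (is_derive_plus (Y 3%nat) (fun x => 2 * Y 1%nat x)).
        + apply H1; [lia|easy].
        + apply is_derive_scal. apply H1; [lia|easy].
      - intros z Hz. specialize (H2 z Hz). specialize (HM0 z Hz).
        replace (Y 4%nat z + 2 * Y 2%nat z)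
          with (be * neg_part (Y 0%nat z) - al * pos_part (Y 0%nat z)) by lra.
        unfold Q. pose proof (Rabs_pos al). pose proof (Rabs_pos be).
        pose proof (Rabs_pos (Y 0%nat z)).
        case_parts (Y 0%nat z).
        + rewrite Rmult_0_r, Rminus_0_l, Rabs_Ropp, Rabs_mult. nra.
        + rewrite Rmult_0_r, Rminus_0_r, Rabs_mult, Rabs_Ropp. nra. }
    assert (Hx2 : Rabs (x - 0) <= 2 * r) by (apply Rabs_le; lra).
    assert (HQ : 0 <= Q).
    { unfold Q. pose proof (Rabs_pos al). pose proof (Rabs_pos be).
      specialize (HM0 0 ltac:(lra)). pose proof (Rabs_pos (Y 0%nat 0)). nra. }
    pose proof (Rabs_triang_inv (Y 3%nat x + 2 * Y 1%nat x) (Y 3%nat 0 + 2 * Y 1%nat 0)).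
    nra. }
  set (M3 := Rabs (Y 3%nat 0 + 2 * Y 1%nat 0) + Q * (2 * r) + 2 * M1).
  assert (HM3 : forall x, - r < x < r -> Rabs (Y 3%nat x) <= M3).
  { intros x Hx. specialize (HG x Hx). specialize (HM1 x Hx).
    apply Rabs_le_between in HG. apply Rabs_le_between in HM1.
    apply Rabs_le. unfold M3. lra. }
  set (M2 := Rabs (Y 2%nat 0) + M3 * (2 * r)).
  assert (HM2 : forall x, - r < x < r -> Rabs (Y 2%nat x) <= M2).
  { intros x Hx.
    assert (HL : Rabs (Y 2%nat x - Y 2%nat 0) <= M3 * Rabs (x - 0)).
    { apply (lipschitz_of_derive (Y 2%nat) (Y 3%nat) M3 (- r) r); try lra; [|easy].
      intros z Hz. apply H1; [lia|easy]. }
    assert (Hx2 : Rabs (x - 0) <= 2 * r) by (apply Rabs_le; lra).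
    assert (H0 : 0 <= M3).
    { eapply Rle_trans; [apply Rabs_pos|apply (HM3 x Hx)]. }
    pose proof (Rabs_triang_inv (Y 2%nat x) (Y 2%nat 0)). unfold M2. nra. }
  exists (Rabs M0 + Rabs M1 + Rabs M2 + Rabs M3 + 1).
  pose proof (Rle_abs M0). pose proof (Rle_abs M1). pose proof (Rle_abs M2).
  pose proof (Rle_abs M3). pose proof (Rabs_pos M0). pose proof (Rabs_pos M1).
  pose proof (Rabs_pos M2). pose proof (Rabs_pos M3).
  split; [lra|].
  intros k x Hk Hx. specialize (HM0 x Hx). specialize (HM1 x Hx).
  specialize (HM2 x Hx). specialize (HM3 x Hx).
  do 4 (destruct k as [|k]; [lra|]). lia.
Qed.

Lemma clamped_ends_near (P : R -> Prop) r :
  0 < r -> (forall x, - r < x < r -> P x) -> at_right (- r) P /\ at_left r P.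
Proof.
  intros Hr H. split.
  - apply at_right_spec. exists r. split; [easy|]. intros x Hx. apply H; lra.
  - apply at_left_spec. exists r. split; [easy|]. intros x Hx. apply H; lra.
Qed.

(** Testing the equation with [v] itself: [v' v'' - v v'''] vanishes at both ends and
    has the derivative [(v'' + v)^2 + (al - 1) (v^+)^2 + (be - 1) (v^-)^2], which
    therefore vanishes identically. *)
Lemma clamped_trivial r al be Y :
  0 < r -> 1 < al -> 1 < be -> clamped r al be Y -> forall x, - r < x < r -> Y 0%nat x = 0.
Proof.
  intros Hr Hal Hbe HY.
  destruct (clamped_bounded r al be Y Hr HY) as [M [HM0 HM]].
  destruct HY as [H1 [H2 [H3 [H4 [H5 H6]]]]].
  set (Phi := fun x => Y 1%nat x * Y 2%nat x - Y 0%nat x * Y 3%nat x).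
  set (dPhi := fun x => (Y 2%nat x + Y 0%nat x) ^ 2 + (al - 1) * pos_part (Y 0%nat x) ^ 2
                      + (be - 1) * neg_part (Y 0%nat x) ^ 2).
  assert (HD : forall x, - r < x < r -> is_derive Phi x (dPhi x)).
  { intros x Hx. unfold Phi.
    pose proof (H1 0%nat x ltac:(lia) Hx) as D0. pose proof (H1 1%nat x ltac:(lia) Hx) as D1.
    pose proof (H1 2%nat x ltac:(lia) Hx) as D2. pose proof (H1 3%nat x ltac:(lia) Hx) as D3.
    eapply is_derive_eq.
    - derive_tac.
    - specialize (H2 x Hx). unfold dPhi.
      replace (Y 4%nat x) with (- 2 * Y 2%nat x - al * pos_part (Y 0%nat x)
         + be * neg_part (Y 0%nat x)) by lra.
      case_parts (Y 0%nat x); ring. }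
  assert (Hpos : forall x, - r < x < r -> 0 <= dPhi x).
  { intros x _. unfold dPhi. pose proof (pow2_ge_0 (Y 2%nat x + Y 0%nat x)).
    nra. }
  assert (Hends : filterlim Phi (at_right (- r)) (locally 0) /\ filterlim Phi (at_left r) (locally 0)).
  { destruct (clamped_ends_near (fun x => Rabs (Y 2%nat x) <= M) r Hr) as [A2 B2].
    { intros x Hx. apply HM; [lia|easy]. }
    destruct (clamped_ends_near (fun x => Rabs (- Y 3%nat x) <= M) r Hr) as [A3 B3].
    { intros x Hx. rewrite Rabs_Ropp. apply HM; [lia|easy]. }
    assert (Hsum : forall F (FF : Filter F), filterlim (Y 0%nat) F (locally 0) ->
       filterlim (Y 1%nat) F (locally 0) -> F (fun x => Rabs (Y 2%nat x) <= M) ->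
       F (fun x => Rabs (- Y 3%nat x) <= M) -> filterlim Phi F (locally 0)).
    { intros F FF F0 F1 F2 F3.
      apply filterlim_ext with (fun x => plus (Y 1%nat x * Y 2%nat x) (Y 0%nat x * - Y 3%nat x)).
      { intros x. unfold Phi, plus; simpl. ring. }
      replace 0 with (plus 0 0) by (unfold plus; simpl; ring).
      eapply filterlim_comp_2; [| |apply (filterlim_plus 0 0)].
      - now apply filterlim_mult_bounded with M.
      - now apply filterlim_mult_bounded with M. }
    split; apply Hsum; try easy; apply within_filter, locally_filter. }
  assert (Hzero : forall x, - r < x < r -> Phi x = 0).
  { intros x Hx.
    pose proof (nondecreasing_end_limits Phi dPhi (- r) r 0 0 x HD Hpos (proj1 Hends)
      (proj2 Hends) Hx). lra. }
  intros x Hx.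
  assert (Hd0 : dPhi x = 0).
  { assert (E : is_derive Phi x 0).
    { apply (is_derive_ext_loc (fun _ => 0)).
      - destruct (open_interval (- r) r x Hx) as [d Hd]. exists d. intros y Hy.
        symmetry. apply Hzero. now apply Hd.
      - apply (is_derive_const (V := R_NormedModule) 0). }
    apply is_derive_unique in E. rewrite <- E. symmetry. now apply is_derive_unique, HD. }
  destruct (Req_dec (Y 0%nat x) 0) as [H0|H0]; [easy|exfalso].
  apply pow2_gt_0 in H0.
  unfold dPhi in Hd0. pose proof (pow2_ge_0 (Y 2%nat x + Y 0%nat x)).
  revert H0 Hd0. case_parts (Y 0%nat x); intros H0 Hd0; nra.
Qed.

Lemma fucik_clamped r al be :
  0 < r ->
  fucik_spectrum r (al, be) <->
  exists Y, clamped r al be Y /\ exists x, - r < x < r /\ Y 0%nat x <> 0.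
Proof.
  intros Hr. split.
  - intros [v [Hv Hx]]. exists (Derive_n v). split; [now apply dirichlet_clamped|easy].
  - intros [Y [HY Hx]]. exists (Y 0%nat). split; [now apply clamped_dirichlet|easy].
Qed.

Lemma part_scal c x : 0 <= c ->
  pos_part (c * x) = c * pos_part x /\ neg_part (c * x) = c * neg_part x.
Proof.
  intros Hc. unfold pos_part, neg_part. split.
  - rewrite <- (Rmult_0_r c) at 1. now rewrite RmaxRmult.
  - rewrite <- (Rmult_0_r c) at 1. replace (- (c * x)) with (c * - x) by ring.
    now rewrite RmaxRmult.
Qed.

Lemma clamped_scal r al be Y c :
  0 <= c -> clamped r al be Y -> clamped r al be (fun k x => c * Y k x).
Proof.
  intros Hc [H1 [H2 [H3 [H4 [H5 H6]]]]].
  assert (HF : forall F (FF : Filter F) f, filterlim f F (locally 0) ->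
     filterlim (fun x : R => c * f x) F (locally 0)).
  { intros F FF f Hf. apply filterlim_ext with (fun x => f x * c); [intros; apply Rmult_comm|].
    apply filterlim_mult_bounded with (Rabs c); [easy|]. now apply filter_forall. }
  split; [|split; [|split; [|split; [|split]]]];
    try (apply HF; [apply within_filter, locally_filter|easy]).
  - intros k x Hk Hx. apply is_derive_scal. now apply H1.
  - intros x Hx. specialize (H2 x Hx). destruct (part_scal c (Y 0%nat x) Hc) as [-> ->].
    replace 0 with (c * 0) by ring. rewrite <- H2. ring.
Qed.

Lemma clamped_normalise r al be Y :
  0 < r -> clamped r al be Y -> (exists x, - r < x < r /\ Y 0%nat x <> 0) ->
  exists Z, clamped r al be Z
    /\ (forall k x, (k <= 3)%nat -> - r < x < r -> Rabs (Z k x) <= 1)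
    /\ (exists k x, (k <= 3)%nat /\ - r < x < r /\ / 2 <= Rabs (Z k x)).
Proof.
  intros Hr HY [x0 [Hx0 Hnz]].
  destruct (clamped_bounded r al be Y Hr HY) as [M [HM0 HM]].
  set (E := fun v => exists k x, (k <= 3)%nat /\ - r < x < r /\ v = Rabs (Y k x)).
  destruct (completeness E) as [s [Hs1 Hs2]].
  { exists M. intros v [k [x [Hk [Hx ->]]]]. now apply HM. }
  { exists (Rabs (Y 0%nat x0)), 0%nat, x0. split; [lia|easy]. }
  assert (Hs : 0 < s).
  { apply Rlt_le_trans with (Rabs (Y 0%nat x0)); [now apply Rabs_pos_lt|].
    apply Hs1. exists 0%nat, x0. split; [lia|easy]. }
  assert (Hsi : 0 <= / s) by now apply Rlt_le, Rinv_0_lt_compat.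
  exists (fun k x => / s * Y k x). split; [now apply clamped_scal|]. split.
  - intros k x Hk Hx. rewrite Rabs_mult, (Rabs_pos_eq (/ s)) by easy.
    rewrite <- (Rinv_l s) by lra. apply Rmult_le_compat_l; [easy|].
    apply Hs1. now exists k, x.
  - apply NNPP. intros Hno.
    assert (Hle : s <= s / 2); [|lra].
    apply Hs2. intros v [k [x [Hk [Hx ->]]]]. apply Rnot_lt_le. intros Hlt.
    apply Hno. exists k, x. split; [easy|]. split; [easy|].
    rewrite Rabs_mult, (Rabs_pos_eq (/ s)) by easy.
    apply Rmult_le_reg_l with s; [easy|].
    rewrite <- Rmult_assoc, Rinv_r, Rmult_1_l by lra. lra.
Qed.

Lemma lipschitz_end_bound (f : R -> R) L r :
  0 < r -> 0 <= L ->
  (forall x y, - r < x < r -> - r < y < r -> Rabs (f x - f y) <= L * Rabs (x - y)) ->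
  filterlim f (at_right (- r)) (locally 0) -> filterlim f (at_left r) (locally 0) ->
  forall x, - r < x < r -> Rabs (f x) <= L * (x + r) /\ Rabs (f x) <= L * (r - x).
Proof.
  intros Hr HL0 HL Ha Hb x Hx.
  split; apply Rnot_lt_le; intros Hlt.
  - destruct (near_right_end f (- r) 0 x (Rabs (f x) - L * (x + r)) Ha ltac:(lra) ltac:(lra))
      as [y [Hy [_ Hf]]].
    rewrite Rminus_0_r in Hf. specialize (HL x y Hx ltac:(lra)).
    rewrite (Rabs_pos_eq (x - y)) in HL by lra.
    pose proof (Rabs_triang_inv (f x) (f y)). nra.
  - destruct (near_left_end f r 0 x (Rabs (f x) - L * (r - x)) Hb ltac:(lra) ltac:(lra))
      as [y [Hy [_ Hf]]].
    rewrite Rminus_0_r in Hf. specialize (HL x y Hx ltac:(lra)).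
    rewrite (Rabs_left1 (x - y)) in HL by lra.
    pose proof (Rabs_triang_inv (f x) (f y)). nra.
Qed.

Lemma filterlim_end_zero (f : R -> R) L r :
  0 < r -> 0 <= L ->
  (forall x, - r < x < r -> Rabs (f x) <= L * (x + r) /\ Rabs (f x) <= L * (r - x)) ->
  filterlim f (at_right (- r)) (locally 0) /\ filterlim f (at_left r) (locally 0).
Proof.
  intros Hr HL H. split; apply filterlim_eps; intros e He.
  - apply at_right_spec. exists (Rmin r (e / (L + 1))).
    assert (Hd : 0 < e / (L + 1)) by (apply Rdiv_lt_0_compat; lra).
    split; [now apply Rmin_pos|]. intros x Hx.
    pose proof (Rmin_l r (e / (L + 1))). pose proof (Rmin_r r (e / (L + 1))).
    destruct (H x ltac:(lra)) as [Hfx _]. rewrite Rminus_0_r.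
    eapply Rle_lt_trans; [apply Hfx|].
    apply Rle_lt_trans with ((L + 1) * (x + r)); [nra|].
    apply Rlt_le_trans with ((L + 1) * (e / (L + 1))); [apply Rmult_lt_compat_l; lra|].
    right; field; lra.
  - apply at_left_spec. exists (Rmin r (e / (L + 1))).
    assert (Hd : 0 < e / (L + 1)) by (apply Rdiv_lt_0_compat; lra).
    split; [now apply Rmin_pos|]. intros x Hx.
    pose proof (Rmin_l r (e / (L + 1))). pose proof (Rmin_r r (e / (L + 1))).
    destruct (H x ltac:(lra)) as [_ Hfx]. rewrite Rminus_0_r.
    eapply Rle_lt_trans; [apply Hfx|].
    apply Rle_lt_trans with ((L + 1) * (r - x)); [nra|].
    apply Rlt_le_trans with ((L + 1) * (e / (L + 1))); [apply Rmult_lt_compat_l; lra|].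
    right; field; lra.
Qed.

(** The limit is taken in [v, ..., v''']; differentiability of the limit comes
    from the uniform quadratic Taylor remainder, and the normalisation keeps it
    nontrivial because the convergence is uniform. *)
Lemma fucik_closed r q (be : nat -> R) (b : R) :
  0 < r -> 0 < q -> (forall n, 0 < be n <= 1) -> is_lim_seq be b ->
  (forall n, fucik_spectrum r (q * be n, be n)) -> fucik_spectrum r (q * b, b).
Proof.
  intros Hr Hq Hbe Hlim Hsp.
  assert (HZ : forall n, exists Z, clamped r (q * be n) (be n) Z
    /\ (forall k x, (k <= 3)%nat -> - r < x < r -> Rabs (Z k x) <= 1)
    /\ (exists k x, (k <= 3)%nat /\ - r < x < r /\ / 2 <= Rabs (Z k x))).
  { intros n. specialize (Hsp n). apply fucik_clamped in Hsp; [|easy].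
    destruct Hsp as [Y [HY Hx]]. now apply clamped_normalise with Y. }
  apply choice in HZ. destruct HZ as [Z HZ].
  set (L := 3 + q).
  assert (H4 : forall n x, - r < x < r -> Rabs (Z n 4%nat x) <= L).
  { intros n x Hx. destruct (HZ n) as [[_ [He _]] [Hb _]].
    specialize (He x Hx). pose proof (Hb 2%nat x ltac:(lia) Hx) as B2.
    pose proof (Hb 0%nat x ltac:(lia) Hx) as B0. specialize (Hbe n).
    apply Rabs_le_between in B2. apply Rabs_le_between in B0. apply Rabs_le.
    assert (Ht : 0 <= q * be n <= q) by nra. set (t := q * be n) in *. clearbody t.
    revert He. unfold L. case_parts (Z n 0%nat x); intros He; split; nra. }
  assert (HB : forall n k x, (k <= 4)%nat -> - r < x < r -> Rabs (Z n k x) <= L).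
  { intros n k x Hk Hx. destruct (Nat.eq_dec k 4) as [->|Hk4]; [now apply H4|].
    apply Rle_trans with 1; [|unfold L; lra]. apply HZ; [lia|easy]. }
  assert (HD : forall n k x, (k <= 3)%nat -> - r < x < r -> is_derive (Z n k) x (Z n (S k) x)).
  { intros n k x Hk Hx. apply (proj1 (proj1 (HZ n))); [lia|easy]. }
  assert (HLip : forall n k x y, (k <= 3)%nat -> - r < x < r -> - r < y < r ->
     Rabs (Z n k x - Z n k y) <= L * Rabs (x - y)).
  { intros n k x y Hk Hx Hy.
    apply (lipschitz_of_derive (Z n k) (Z n (S k)) L (- r) r); try easy.
    - intros z Hz. now apply HD.
    - intros z Hz. apply HB; [lia|easy]. }
  assert (HLip4 : forall n k x y, (k <= 4)%nat -> - r < x < r -> - r < y < r ->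
     Rabs (Z n k x - Z n k y) <= L * L * Rabs (x - y)).
  { intros n k x y Hk Hx Hy.
    assert (HL1 : 1 <= L) by (unfold L; lra). pose proof (Rabs_pos (x - y)) as Hxy.
    destruct (Nat.eq_dec k 4) as [->|Hk4].
    - destruct (HZ n) as [[_ [He _]] _].
      pose proof (He x Hx) as Ex. pose proof (He y Hy) as Ey.
      pose proof (HLip n 2%nat x y ltac:(lia) Hx Hy) as L2.
      pose proof (HLip n 0%nat x y ltac:(lia) Hx Hy) as L0.
      pose proof (pos_part_lipschitz (Z n 0%nat x) (Z n 0%nat y)) as Lp.
      pose proof (neg_part_lipschitz (Z n 0%nat x) (Z n 0%nat y)) as Ln.
      specialize (Hbe n).
      set (B := L * Rabs (x - y)) in *.
      assert (Lp' := Rle_trans _ _ _ Lp L0). assert (Ln' := Rle_trans _ _ _ Ln L0).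
      apply Rabs_le_between in L2. apply Rabs_le_between in Lp'. apply Rabs_le_between in Ln'.
      replace (Z n 4%nat x - Z n 4%nat y)
        with (- 2 * (Z n 2%nat x - Z n 2%nat y)
              - (q * be n) * (pos_part (Z n 0%nat x) - pos_part (Z n 0%nat y))
              + be n * (neg_part (Z n 0%nat x) - neg_part (Z n 0%nat y))) by lra.
      replace (L * L * Rabs (x - y)) with (L * B) by (unfold B; ring).
      assert (HB0 : 0 <= B) by (unfold B; nra).
      assert (Hqb : 0 <= q * be n <= q) by nra.
      set (t := q * be n) in *. set (dp := pos_part (Z n 0%nat x) - pos_part (Z n 0%nat y)) in *.
      set (dn := neg_part (Z n 0%nat x) - neg_part (Z n 0%nat y)) in *.
      clearbody t dp dn B. assert (Hab : forall s w c : R, 0 <= s <= c -> - B <= w <= B -> - (c * B) <= s * w <= c * B).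
      { clear - HB0. intros s w c Hs Hw.
        assert (0 <= (c - s) * B) by (apply Rmult_le_pos; lra).
        assert (0 <= s * (w + B)) by (apply Rmult_le_pos; lra).
        assert (0 <= s * (B - w)) by (apply Rmult_le_pos; lra).
        lra. }
      assert (A1 : - (q * B) <= t * dp <= q * B) by (now apply Hab).
      assert (A2 : - (1 * B) <= be n * dn <= 1 * B) by (apply Hab; [lra|easy]).
      replace (L * B) with (3 * B + q * B) by (unfold L; ring).
      apply Rabs_le. lra.
    - eapply Rle_trans; [apply HLip; try easy; lia|].
      apply Rmult_le_compat_r; [easy|]. clearbody L. nra. }
  destruct (equicontinuous_subseq (fun x => - r < x < r) (fun n j => Z n (Nat.min j 3)) 1 L (fun _ => 0))
    as [phi [Hphi Hcv]].
  { apply open_interval. }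
  { intros n j x Hx. apply HZ; [lia|easy]. }
  { intros n j x y Hx Hy. rewrite Rplus_0_r. apply HLip; try easy. lia. }
  { apply is_lim_seq_const. }
  set (V := fun j x => real (Lim_seq (fun n => Z (phi n) (Nat.min j 3) x))).
  set (W := fun k x => if Nat.eq_dec k 4
      then - 2 * V 2%nat x - q * b * pos_part (V 0%nat x) + b * neg_part (V 0%nat x)
      else V k x).
  assert (HV : forall j x, - r < x < r -> is_lim_seq (fun n => Z (phi n) (Nat.min j 3) x) (V j x)).
  { intros j x Hx. apply Lim_seq_correct'. now apply Hcv. }
  assert (Hbe' : is_lim_seq (fun n => be (phi n)) b).
  { apply is_lim_seq_subseq; [now apply eventually_subseq|easy]. }
  assert (HW : forall k x, (k <= 4)%nat -> - r < x < r -> is_lim_seq (fun n => Z (phi n) k x) (W k x)).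
  { intros k x Hk Hx. unfold W. destruct (Nat.eq_dec k 4) as [->|Hk4].
    - apply is_lim_seq_ext with (fun n => - 2 * Z (phi n) 2%nat x
         - q * be (phi n) * pos_part (Z (phi n) 0%nat x) + be (phi n) * neg_part (Z (phi n) 0%nat x)).
      { intros n. destruct (HZ (phi n)) as [[_ [He _]] _]. specialize (He x Hx). lra. }
      pose proof (HV 2%nat x Hx) as V2. pose proof (HV 0%nat x Hx) as V0. simpl in V2, V0.
      apply is_lim_seq_plus'; [apply is_lim_seq_minus'|].
      + apply is_lim_seq_mult'; [apply is_lim_seq_const|easy].
      + apply is_lim_seq_mult'; [apply is_lim_seq_mult'; [apply is_lim_seq_const|easy]|].
        now apply is_lim_seq_pos_part.
      + apply is_lim_seq_mult'; [easy|]. now apply is_lim_seq_neg_part.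
    - pose proof (HV k x Hx) as Vk. now rewrite Nat.min_l in Vk by lia. }
  assert (HWlip : forall k, (k <= 3)%nat -> forall x y, - r < x < r -> - r < y < r ->
     Rabs (W k x - W k y) <= L * Rabs (x - y)).
  { intros k Hk x y Hx Hy.
    change (Rbar_le (Rabs (W k x - W k y)) (L * Rabs (x - y))).
    apply is_lim_seq_le with (fun n => Rabs (Z (phi n) k x - Z (phi n) k y)) (fun n => L * Rabs (x - y)).
    - intros n. now apply HLip.
    - apply (is_lim_seq_abs _ (W k x - W k y)). apply is_lim_seq_minus'; apply HW; try easy; lia.
    - apply is_lim_seq_const. }
  assert (HL0 : 0 <= L) by (unfold L; lra).
  assert (Hend : forall k, (k <= 1)%nat -> forall x, - r < x < r ->
     Rabs (W k x) <= L * (x + r) /\ Rabs (W k x) <= L * (r - x)).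
  { intros k Hk x Hx.
    assert (Hn : forall n, Rabs (Z (phi n) k x) <= L * (x + r) /\ Rabs (Z (phi n) k x) <= L * (r - x)).
    { intros n. destruct (HZ (phi n)) as [[_ [_ [E1 [E2 [E3 E4]]]]] _].
      assert (Hk' : k = 0%nat \/ k = 1%nat) by lia.
      destruct Hk' as [-> | ->]; apply lipschitz_end_bound; try easy;
        intros; apply HLip; try easy; lia. }
    pose proof (is_lim_seq_abs _ _ (HW k x ltac:(lia) Hx)) as HA.
    split.
    - change (Rbar_le (Rabs (W k x)) (L * (x + r))).
      eapply is_lim_seq_le; [|apply HA|apply is_lim_seq_const]. intros n. apply Hn.
    - change (Rbar_le (Rabs (W k x)) (L * (r - x))).
      eapply is_lim_seq_le; [|apply HA|apply is_lim_seq_const]. intros n. apply Hn. }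
  assert (HWd : forall k x, (k <= 3)%nat -> - r < x < r -> is_derive (W k) x (W (S k) x)).
  { intros k x Hk Hx. apply is_derive_of_quadratic with (- r) r (L * L); [easy|].
    intros y Hy.
    change (Rbar_le (Rabs (W k y - W k x - W (S k) x * (y - x))) (L * L * (y - x) ^ 2)).
    apply is_lim_seq_le with
      (fun n => Rabs (Z (phi n) k y - Z (phi n) k x - Z (phi n) (S k) x * (y - x)))
      (fun n => L * L * (y - x) ^ 2).
    - intros n.
      destruct (mean_value (Z (phi n) k) (Z (phi n) (S k)) x y) as [z [Hz E]].
      { intros z Hz. apply HD; [easy|]. unfold Rmin, Rmax in Hz. destruct (Rle_dec x y); lra. }
      rewrite E. rewrite <- Rmult_minus_distr_r, Rabs_mult.
      assert (Hzr : - r < z < r) by (unfold Rmin, Rmax in Hz; destruct (Rle_dec x y); lra).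
      assert (Hzx : Rabs (z - x) <= Rabs (y - x)).
      { unfold Rmin, Rmax in Hz; destruct (Rle_dec x y).
        - rewrite !Rabs_pos_eq; lra.
        - rewrite !Rabs_left1; lra. }
      rewrite <- (pow2_abs (y - x)). simpl. rewrite Rmult_1_r, <- Rmult_assoc.
      apply Rmult_le_compat_r; [apply Rabs_pos|].
      eapply Rle_trans; [apply HLip4; try easy; lia|].
      apply Rmult_le_compat_l; [nra|easy].
    - apply (is_lim_seq_abs _ (W k y - W k x - W (S k) x * (y - x))).
      apply is_lim_seq_minus'.
      + apply is_lim_seq_minus'; apply HW; try easy; lia.
      + apply is_lim_seq_mult'; [apply HW; [lia|easy]|apply is_lim_seq_const].
    - apply is_lim_seq_const. }
  apply fucik_clamped; [easy|]. exists W. split.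
  { split; [|split].
    - intros k x Hk Hx. apply HWd; [lia|easy].
    - intros x Hx. unfold W at 1. simpl. change (W 2%nat x) with (V 2%nat x).
      change (W 0%nat x) with (V 0%nat x). ring.
    - destruct (filterlim_end_zero (W 0%nat) L r Hr HL0 (Hend 0%nat ltac:(lia))).
      destruct (filterlim_end_zero (W 1%nat) L r Hr HL0 (Hend 1%nat ltac:(lia))).
      easy. }
  apply NNPP. intros Hno.
  assert (Hz : forall k, (k <= 3)%nat -> forall x, - r < x < r -> W k x = 0).
  { assert (H0 : forall x, - r < x < r -> W 0%nat x = 0).
    { intros x Hx. apply NNPP. intros Hne. apply Hno. now exists x. }
    assert (Hs : forall k, (k <= 3)%nat -> (forall x, - r < x < r -> W k x = 0) ->
        forall x, - r < x < r -> W (S k) x = 0).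
    { intros k Hk HWk x Hx. rewrite <- (is_derive_unique _ _ _ (HWd k x Hk Hx)).
      apply is_derive_unique. apply (is_derive_ext_loc (fun _ => 0)).
      - destruct (open_interval (- r) r x Hx) as [d Hd]. exists d. intros y Hy.
        symmetry. apply HWk. now apply Hd.
      - apply is_derive_Rconst. }
    intros k. induction k as [|k IH]; intros Hk; [easy|].
    apply Hs; [lia|]. apply IH; lia. }
  assert (Hunif : forall k, (k <= 3)%nat -> exists N, forall n, (N <= n)%nat ->
     forall x, - r < x < r -> Rabs (Z (phi n) k x - W k x) <= / 4).
  { intros k Hk.
    apply (uniform_of_pointwise (fun x => - r < x < r) (fun n => Z (phi n) k) (W k)
      L (fun _ => 0) r); try lra.
    - unfold L; lra.
    - intros n x y Hx Hy. rewrite Rplus_0_r. now apply HLip.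
    - apply is_lim_seq_const.
    - intros x Hx. apply HW; [lia|easy].
    - intros x Hx. apply Rabs_le; lra. }
  destruct (Hunif 0%nat ltac:(lia)) as [N0 HN0]. destruct (Hunif 1%nat ltac:(lia)) as [N1 HN1].
  destruct (Hunif 2%nat ltac:(lia)) as [N2 HN2]. destruct (Hunif 3%nat ltac:(lia)) as [N3 HN3].
  set (n := (N0 + N1 + N2 + N3)%nat).
  destruct (HZ (phi n)) as [_ [_ [k [x [Hk [Hx Hhalf]]]]]].
  assert (Hc : Rabs (Z (phi n) k x - W k x) <= / 4).
  { assert (Hk' : k = 0%nat \/ k = 1%nat \/ k = 2%nat \/ k = 3%nat) by lia.
    destruct Hk' as [-> | [-> | [-> | ->]]].
    - apply HN0; [unfold n; lia|easy].
    - apply HN1; [unfold n; lia|easy].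
    - apply HN2; [unfold n; lia|easy].
    - apply HN3; [unfold n; lia|easy]. }
  rewrite (Hz k Hk x Hx), Rminus_0_r in Hc. lra.
Qed.

Lemma fucik_le_1 r q be :
  0 < r -> 1 < q -> fucik_spectrum r (q * be, be) -> be <= 1.
Proof.
  intros Hr Hq H. apply Rnot_lt_le. intros Hbe.
  apply fucik_clamped in H; [|easy]. destruct H as [Y [HY [x [Hx Hnz]]]].
  apply Hnz. apply (clamped_trivial r (q * be) be Y); try easy. nra.
Qed.

(** Closedness and the bound [1] turn a single positive element into a maximum. *)
Lemma fucik_max_exists r q be :
  0 < r -> 1 < q -> 0 < be -> fucik_spectrum r (q * be, be) ->
  exists m, 0 < m /\ is_max (fun be => be > 0 /\ fucik_spectrum r (q * be, be)) m.
Proof.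
  intros Hr Hq Hbe Hsp.
  set (E := fun be => be > 0 /\ fucik_spectrum r (q * be, be)).
  destruct (completeness E) as [m [Hm1 Hm2]].
  { exists 1. intros x [_ Hx]. now apply fucik_le_1 with r q. }
  { now exists be. }
  assert (Hmbe : be <= m) by now apply Hm1.
  exists m. split; [lra|]. split; [|exact Hm1].
  split; [lra|].
  destruct (sup_sequence E m (conj Hm1 Hm2)) as [u Hu].
  apply (fucik_closed r q u m); try easy; [lra| | |].
  - intros n. destruct (Hu n) as [[H1 H2] _]. split; [easy|]. now apply fucik_le_1 with r q.
  - apply is_lim_seq_le_le with (fun n => m - / (INR n + 1)) (fun _ => m).
    + intros n. destruct (Hu n) as [H1 H2]. split; [lra|]. now apply Hm1.
    + apply is_lim_seq_minus_inv.
    + apply is_lim_seq_const.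
  - intros n. apply (Hu n).
Qed.

Lemma clamped_angle_exists :
  exists tau, 0 < tau < PI / 4 /\ (PI + tau) * sin tau = PI / 4 * cos tau.
Proof.
  pose proof PI_RGT_0 as Hpi.
  set (f := fun t => (PI + t) * sin t - PI / 4 * cos t).
  assert (Hs : sin (PI / 4) = cos (PI / 4)) by now rewrite sin_PI4, cos_PI4.
  assert (Hc : 0 < cos (PI / 4)) by (apply cos_gt_0; lra).
  assert (Hf0 : f 0 < 0) by (unfold f; rewrite sin_0, cos_0; lra).
  assert (Hf1 : 0 < f (PI / 4)) by (unfold f; rewrite Hs; nra).
  destruct (IVT f 0 (PI / 4)) as [t [Ht1 Ht2]]; try easy; try lra.
  { intros t. unfold f. reg. }
  exists t. split.
  - split; apply Rnot_le_lt; intros Hle.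
    + replace t with 0 in Ht2 by lra. lra.
    + replace t with (PI / 4) in Ht2 by lra. lra.
  - unfold f in Ht2. lra.
Qed.

(** A nonpositive clamped mode of the linear problem does not see [al].  With
    [k1 r = PI/4] and [k2 r = PI + tau] the even mode
    [cos (k1 x) / cos (k1 r) - cos (k2 x) / cos (k2 r)] is clamped as soon as
    [k1 r tan (k1 r) = k2 r tan (k2 r)]; it decreases from [0] to [r], hence it is
    positive, and its opposite is the required solution. *)
Lemma fucik_one_signed :
  exists r be, r > sqrt 2 * PI / 2 /\ 0 < be /\ forall al, fucik_spectrum r (al, be).
Proof.
  destruct clamped_angle_exists as [tau [Htau Heq]].
  set (s := PI / 4). set (m := PI + tau).
  set (cs := cos s). set (ct := cos tau).
  assert (Hss : sin s = cs) by (unfold s, cs, s; now rewrite sin_PI4, cos_PI4).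
  assert (Hcs0 : 0 < cs) by (unfold cs, s; apply cos_gt_0; lra).
  assert (Hcs : / 2 < cs).
  { pose proof (sin2_cos2 s) as H2. rewrite Hss in H2. fold cs in H2. unfold Rsqr in H2. nra. }
  assert (Hct : 0 < ct) by (unfold ct; apply cos_gt_0; lra).
  set (r := sqrt ((s * s + m * m) / 2)).
  assert (Hrr : r * r = (s * s + m * m) / 2).
  { unfold r. apply sqrt_sqrt. unfold s, m. nra. }
  assert (Hr : 0 < r).
  { unfold r. apply sqrt_lt_R0. unfold s, m. nra. }
  set (k1 := s / r). set (k2 := m / r).
  assert (Hk1r : k1 * r = s) by (unfold k1; field; lra).
  assert (Hk2r : k2 * r = m) by (unfold k2; field; lra).
  assert (Hk1 : 0 < k1) by (unfold k1, s; apply Rdiv_lt_0_compat; lra).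
  assert (Hk2 : 0 < k2) by (unfold k2, m; apply Rdiv_lt_0_compat; lra).
  assert (Hk : k1 * k1 + k2 * k2 = 2).
  { apply Rmult_eq_reg_r with (r * r); [|nra].
    replace ((k1 * k1 + k2 * k2) * (r * r)) with ((k1 * r) * (k1 * r) + (k2 * r) * (k2 * r)) by ring.
    rewrite Hk1r, Hk2r, Hrr. field. }
  assert (Hk12 : 2 * (k1 * k1) <= k2 * k2).
  { apply Rmult_le_reg_r with (r * r); [nra|].
    replace (2 * (k1 * k1) * (r * r)) with (2 * ((k1 * r) * (k1 * r))) by ring.
    replace (k2 * k2 * (r * r)) with ((k2 * r) * (k2 * r)) by ring.
    rewrite Hk1r, Hk2r. unfold s, m. nra. }
  set (Y := fun k x => match k with
    | 0%nat => - (cos (k1 * x) / cs + cos (k2 * x) / ct)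
    | 1%nat => k1 * sin (k1 * x) / cs + k2 * sin (k2 * x) / ct
    | 2%nat => k1 ^ 2 * cos (k1 * x) / cs + k2 ^ 2 * cos (k2 * x) / ct
    | 3%nat => - (k1 ^ 3 * sin (k1 * x) / cs + k2 ^ 3 * sin (k2 * x) / ct)
    | _ => - (k1 ^ 4 * cos (k1 * x) / cs + k2 ^ 4 * cos (k2 * x) / ct)
    end).
  assert (HD : forall k x, (k < 4)%nat -> is_derive (Y k) x (Y (S k) x)).
  { intros k x Hlt.
    do 4 (destruct k as [|k]; [unfold Y; auto_derive; [easy|field; lra]|]). lia. }
  assert (Hev : forall x, Y 0%nat (- x) = Y 0%nat x).
  { intros x. unfold Y. rewrite !Ropp_mult_distr_r_reverse, !cos_neg. easy. }
  assert (Hod : forall x, Y 1%nat (- x) = - Y 1%nat x).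
  { intros x. unfold Y. rewrite !Ropp_mult_distr_r_reverse, !sin_neg. field; lra. }
  assert (H0r : Y 0%nat r = 0).
  { unfold Y. rewrite Hk1r, Hk2r. fold cs. unfold m.
    rewrite (Rplus_comm PI tau), neg_cos. fold ct. field; lra. }
  assert (H1r : Y 1%nat r = 0).
  { unfold Y. rewrite Hk1r, Hk2r, Hss. unfold m.
    rewrite (Rplus_comm PI tau), neg_sin.
    replace (k1 * cs / cs) with (s / r) by (unfold k1; field; lra).
    replace (k2 * - sin tau / ct) with (- (m * sin tau) / (r * ct)) by (unfold k2; field; lra).
    unfold m. rewrite Heq. fold ct s. field; lra. }
  (* Y 1 is nonnegative on [0, r]: both terms are while k2 x <= PI, and afterwards
     Y 1 decreases to its value 0 at r *)
  assert (Hinc : forall x, 0 <= x <= r -> 0 <= Y 1%nat x).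
  { intros x Hx.
    assert (Hk1x : 0 <= k1 * x <= s) by (rewrite <- Hk1r; nra).
    destruct (Rle_dec (k2 * x) PI) as [Hle|Hgt].
    - unfold Y. assert (0 <= sin (k1 * x)) by (apply sin_ge_0; unfold s in *; lra).
      assert (0 <= sin (k2 * x)) by (apply sin_ge_0; nra).
      apply Rplus_le_le_0_compat; (apply Rmult_le_pos; [nra|]);
        apply Rlt_le, Rinv_0_lt_compat; lra.
    - destruct (mean_value (Y 1%nat) (Y 2%nat) x r) as [z [Hz E]].
      { intros z _. apply HD. lia. }
      rewrite Rmin_left, Rmax_right in Hz by lra.
      assert (Hz2 : Y 2%nat z <= 0).
      { unfold Y.
        assert (C1 : cos (k1 * z) / cs <= 2).
        { apply Rle_trans with (1 / cs).
          - apply Rmult_le_compat_r; [apply Rlt_le, Rinv_0_lt_compat; lra|]. apply COS_bound.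
          - apply Rmult_le_reg_r with cs; [lra|].
            replace (1 / cs * cs) with 1 by (field; lra). lra. }
        assert (C2 : cos (k2 * z) / ct <= - 1).
        { apply Rmult_le_reg_r with ct; [lra|].
          replace (cos (k2 * z) / ct * ct) with (cos (k2 * z)) by (field; lra).
          replace (k2 * z) with ((k2 * z - PI) + PI) by ring. rewrite neg_cos.
          assert (Hzz : 0 <= k2 * z - PI <= tau).
          { split; [nra|]. apply Rplus_le_reg_l with PI. fold m. rewrite <- Hk2r. nra. }
          assert (ct <= cos (k2 * z - PI)); [|lra].
          unfold ct. destruct (Req_dec (k2 * z - PI) tau) as [->|Hne]; [lra|].
          apply Rlt_le, cos_decreasing_1; lra. }
        replace (k1 ^ 2 * cos (k1 * z) / cs) with (k1 * k1 * (cos (k1 * z) / cs)) by (field; lra).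
        replace (k2 ^ 2 * cos (k2 * z) / ct) with (k2 * k2 * (cos (k2 * z) / ct)) by (field; lra).
        assert (0 <= k1 * k1) by nra. assert (0 <= k2 * k2) by nra. nra. }
      rewrite H1r in E. nra. }
  assert (Hneg : forall x, - r < x < r -> Y 0%nat x <= 0).
  { assert (Hp : forall x, 0 <= x < r -> Y 0%nat x <= 0).
    { intros x Hx. destruct (mean_value (Y 0%nat) (Y 1%nat) x r) as [z [Hz E]].
      { intros z _. apply HD. lia. }
      rewrite Rmin_left, Rmax_right in Hz by lra.
      specialize (Hinc z ltac:(lra)). rewrite H0r in E. nra. }
    intros x Hx. destruct (Rle_dec 0 x); [apply Hp; lra|].
    rewrite <- Hev. apply Hp; lra. }
  exists r, (k1 * k1 * (k2 * k2)). split; [|split].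
  - apply Rsqr_incrst_0; [|pose proof (sqrt_pos 2); nra|lra].
    unfold Rsqr. rewrite Hrr.
    replace (sqrt 2 * PI / 2 * (sqrt 2 * PI / 2)) with ((sqrt 2 * sqrt 2) * (PI * PI) / 4) by field.
    rewrite sqrt_sqrt by lra. unfold s, m. nra.
  - assert (0 < k1 * k1) by nra. assert (0 < k2 * k2) by nra. nra.
  - intros al. apply fucik_clamped; [easy|]. exists Y. split; [|exists 0; split; [lra|]].
    + assert (HL : forall k, (k <= 1)%nat -> Y k r = 0 -> Y k (- r) = 0 ->
         filterlim (Y k) (at_right (- r)) (locally 0) /\ filterlim (Y k) (at_left r) (locally 0)).
      { intros k Hk' E1 E2. split.
        - rewrite <- E2. eapply filterlim_of_derive; [|apply HD; lia]. apply filter_le_within.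
        - rewrite <- E1. eapply filterlim_of_derive; [|apply HD; lia]. apply filter_le_within. }
      destruct (HL 0%nat ltac:(lia) H0r ltac:(now rewrite Hev)) as [A1 A2].
      destruct (HL 1%nat ltac:(lia) H1r ltac:(rewrite Hod, H1r; ring)) as [A3 A4].
      split; [|split; [|easy]].
      * intros k x Hlt _. now apply HD.
      * intros x Hx. specialize (Hneg x Hx).
        replace (pos_part (Y 0%nat x)) with 0 by (symmetry; apply Rmax_right; lra).
        replace (neg_part (Y 0%nat x)) with (- Y 0%nat x) by (symmetry; apply Rmax_left; lra).
        unfold Y.
        replace (- (k1 ^ 4 * cos (k1 * x) / cs + k2 ^ 4 * cos (k2 * x) / ct) +
          2 * (k1 ^ 2 * cos (k1 * x) / cs + k2 ^ 2 * cos (k2 * x) / ct) + al * 0 -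
          k1 * k1 * (k2 * k2) * - - (cos (k1 * x) / cs + cos (k2 * x) / ct))
          with ((2 - (k1 * k1 + k2 * k2)) * (k1 ^ 2 * cos (k1 * x) / cs + k2 ^ 2 * cos (k2 * x) / ct))
          by (field; lra).
        rewrite Hk. ring.
    + unfold Y. rewrite !Rmult_0_r, cos_0.
      assert (0 < 1 / cs) by (apply Rdiv_lt_0_compat; lra).
      assert (0 < 1 / ct) by (apply Rdiv_lt_0_compat; lra). lra.
Qed.

(** If no spectral value exceeded [L], all the maxima would be at most [L], and so
    would be their supremum; it is finite and positive because [fucik_one_signed]
    makes the set of maxima nonempty.  An infinite supremum, for which [beta_star q]
    is zero, is no obstacle: it yields maxima beyond [L] at once.
    So [beta_star q <= L], against the hypothesis. *)
Lemma fucik_above_of_beta_star q L :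
  1 < q -> (0 < beta_star q -> L < beta_star q) ->
  exists r be, 0 < r /\ L < be /\ fucik_spectrum r (q * be, be).
Proof.
  intros Hq HL.
  set (E := fun m => exists r, r > sqrt 2 * PI / 2
      /\ is_max (fun beta => beta > 0 /\ fucik_spectrum r (q * beta, beta)) m).
  assert (Hr0 : forall r, r > sqrt 2 * PI / 2 -> 0 < r).
  { intros r Hr. pose proof PI_RGT_0. pose proof (sqrt_pos 2). nra. }
  apply NNPP. intros Hno.
  assert (Hub : forall m, E m -> m <= L).
  { intros m [r [Hr [[_ Hm] _]]]. apply Rnot_lt_le. intros Hlt. apply Hno.
    exists r, m. split; [now apply Hr0|easy]. }
  destruct fucik_one_signed as [r [be [Hr [Hbe Hsp]]]].
  destruct (fucik_max_exists r q be (Hr0 r Hr) Hq Hbe (Hsp _)) as [m [Hm0 Hm]].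
  assert (HE : E m) by now exists r.
  unfold beta_star in HL. change (fun m => _) with E in HL.
  destruct (Lub_Rbar_correct E) as [H1 H2].
  assert (H3 : Rbar_le (Lub_Rbar E) L) by (apply H2; intros x Hx; now apply Hub).
  specialize (H1 m HE).
  destruct (Lub_Rbar E) as [l| |]; simpl in *; try easy. specialize (HL ltac:(lra)). lra.
Qed.

Ltac eqR := match goal with |- @eq _ ?a ?b => change (@eq R a b) end.

(** * The Green function *)

(** The decaying solution on the half-line of
    [u'''' + 2 (om^2 - ka^2) u'' + (ka^2 + om^2)^2 u = 0], whose characteristic roots
    are [+- ka +- i om], with [u' = 0] and [u''' = 1/2] at [0]. *)
Definition green_half (ka om t : R) : R :=
  exp (- ka * t) * (cos (om * t) + ka / om * sin (om * t)) / (4 * ka * (ka ^ 2 + om ^ 2)).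

Definition green (ka om x : R) : R := green_half ka om (Rabs x).

Definition green_bound (ka om : R) : R := (1 + ka / om) / (4 * ka * (ka ^ 2 + om ^ 2)).

Lemma exp_le_1 x : x <= 0 -> exp x <= 1.
Proof.
  intros Hx. rewrite <- exp_0. destruct (Req_dec x 0) as [->|H]; [lra|].
  apply Rlt_le, exp_increasing; lra.
Qed.

Lemma green_bound_pos ka om : 0 < ka -> 0 < om -> 0 < green_bound ka om.
Proof.
  intros Hk Ho. unfold green_bound. assert (0 < ka / om) by now apply Rdiv_lt_0_compat.
  apply Rdiv_lt_0_compat; [lra|]. apply Rmult_lt_0_compat; [lra|nra].
Qed.

Lemma green_decay ka om x :
  0 < ka -> 0 < om -> Rabs (green ka om x) <= green_bound ka om * exp (- ka * Rabs x).
Proof.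
  intros Hk Ho. unfold green, green_half, green_bound.
  set (t := Rabs x). set (B := 4 * ka * (ka ^ 2 + om ^ 2)).
  assert (HB : 0 < B) by (unfold B; apply Rmult_lt_0_compat; [lra|nra]).
  assert (Hq : 0 < ka / om) by now apply Rdiv_lt_0_compat.
  assert (HE := exp_pos (- ka * t)).
  unfold Rdiv at 1. rewrite !Rabs_mult, (Rabs_pos_eq (exp _)), Rabs_inv, (Rabs_pos_eq B) by lra.
  replace ((1 + ka / om) / B * exp (- ka * t)) with (exp (- ka * t) * (1 + ka / om) * / B)
    by (field; lra).
  apply Rmult_le_compat_r; [apply Rlt_le, Rinv_0_lt_compat; lra|].
  apply Rmult_le_compat_l; [lra|].
  pose proof (COS_bound (om * t)). pose proof (SIN_bound (om * t)).
  apply Rabs_le. split; nra.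
Qed.

Lemma green_le ka om x : 0 < ka -> 0 < om -> Rabs (green ka om x) <= green_bound ka om.
Proof.
  intros Hk Ho. eapply Rle_trans; [now apply green_decay|].
  rewrite <- (Rmult_1_r (green_bound ka om)) at 2.
  apply Rmult_le_compat_l; [now apply Rlt_le, green_bound_pos|].
  apply exp_le_1. pose proof (Rabs_pos x). nra.
Qed.

Lemma green_even ka om x : green ka om (- x) = green ka om x.
Proof. unfold green. now rewrite Rabs_Ropp. Qed.

Lemma green_half_derive ka om t :
  0 < ka -> 0 < om ->
  is_derive (green_half ka om) t (- (exp (- ka * t) * sin (om * t)) / (4 * ka * om)).
Proof.
  intros Hk Ho. unfold green_half. assert (0 < ka ^ 2 + om ^ 2) by nra.
  auto_derive.
  - repeat split; nra.
  - field. repeat split; nra.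
Qed.

Lemma green_lipschitz ka om x y :
  0 < ka -> 0 < om -> Rabs (green ka om x - green ka om y) <= / (4 * ka * om) * Rabs (x - y).
Proof.
  intros Hk Ho. unfold green.
  destruct (mean_value (green_half ka om) (fun t => - (exp (- ka * t) * sin (om * t)) / (4 * ka * om))
     (Rabs y) (Rabs x)) as [z [Hz E]].
  { intros z _. now apply green_half_derive. }
  rewrite E, Rabs_mult.
  assert (Hz0 : 0 <= z).
  { pose proof (Rabs_pos x). pose proof (Rabs_pos y).
    apply Rle_trans with (Rmin (Rabs y) (Rabs x)); [|apply Hz]. now apply Rmin_glb. }
  assert (Hko : 0 < 4 * ka * om) by (apply Rmult_lt_0_compat; lra).
  apply Rmult_le_compat; try apply Rabs_pos.
  - unfold Rdiv. rewrite Rabs_mult, Rabs_Ropp, Rabs_inv, (Rabs_pos_eq (4 * ka * om)) by lra.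
    rewrite <- (Rmult_1_l (/ (4 * ka * om))) at 2.
    apply Rmult_le_compat_r; [apply Rlt_le, Rinv_0_lt_compat; lra|].
    rewrite Rabs_mult, Rabs_pos_eq by apply Rlt_le, exp_pos.
    assert (exp (- ka * z) <= 1) by (apply exp_le_1; nra).
    assert (Rabs (sin (om * z)) <= 1) by (apply Rabs_le, SIN_bound).
    pose proof (exp_pos (- ka * z)). pose proof (Rabs_pos (sin (om * z))). nra.
  - apply Rabs_triang_inv2.
Qed.

Lemma continuous_lipschitz (f : R -> R) L :
  (forall x y, Rabs (f x - f y) <= L * Rabs (x - y)) -> forall x, continuous f x.
Proof.
  intros H x. apply filterlim_eps. intros e He.
  assert (HL : 0 < Rabs L + 1) by (pose proof (Rabs_pos L); lra).
  assert (Hd : 0 < e / (Rabs L + 1)) by now apply Rdiv_lt_0_compat.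
  exists (mkposreal _ Hd). intros y Hy. change (Rabs (y - x) < e / (Rabs L + 1)) in Hy.
  eapply Rle_lt_trans; [apply H|].
  apply Rle_lt_trans with ((Rabs L + 1) * Rabs (y - x)).
  - apply Rmult_le_compat_r; [apply Rabs_pos|]. pose proof (Rle_abs L); lra.
  - apply Rlt_le_trans with ((Rabs L + 1) * (e / (Rabs L + 1))).
    + now apply Rmult_lt_compat_l.
    + right; field; lra.
Qed.

Lemma green_continuous ka om x : 0 < ka -> 0 < om -> continuous (green ka om) x.
Proof.
  intros Hk Ho. apply continuous_lipschitz with (/ (4 * ka * om)).
  intros; now apply green_lipschitz.
Qed.

Lemma continuous_Rmult (f g : R -> R) x :
  continuous f x -> continuous g x -> continuous (fun y => f y * g y) x.
Proof. apply (continuous_mult (K := R_AbsRing)). Qed.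

Lemma continuous_derivable (f : R -> R) x : ex_derive f x -> continuous f x.
Proof. apply (ex_derive_continuous f). Qed.

Lemma ex_RInt_cont (f : R -> R) a b : (forall x, continuous f x) -> ex_RInt f a b.
Proof. intros H. apply (ex_RInt_continuous f). intros; apply H. Qed.

(** ** Convolution with a compactly supported density *)

Definition moment_cos (ka om R0 : R) (H : R -> R) (x : R) : R :=
  RInt (fun y => exp (ka * y) * cos (om * y) * H y) (- R0) x.
Definition moment_sin (ka om R0 : R) (H : R -> R) (x : R) : R :=
  RInt (fun y => exp (ka * y) * sin (om * y) * H y) (- R0) x.

(** The real and imaginary parts of the causal convolution of [H] with the
    damped oscillation [exp (- ka t + i om t)]. *)
Definition causal_cos (ka om R0 : R) (H : R -> R) (x : R) : R :=
  exp (- ka * x) * (cos (om * x) * moment_cos ka om R0 H x + sin (om * x) * moment_sin ka om R0 H x).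
Definition causal_sin (ka om R0 : R) (H : R -> R) (x : R) : R :=
  exp (- ka * x) * (sin (om * x) * moment_cos ka om R0 H x - cos (om * x) * moment_sin ka om R0 H x).

Lemma is_derive_primitive (f : R -> R) a x :
  (forall y, continuous f y) -> is_derive (fun z => RInt f a z) x (f x).
Proof.
  intros Hf. apply (is_derive_RInt f (fun z => RInt f a z) a x); [|apply Hf].
  apply filter_forall. intros z. apply (RInt_correct f). now apply ex_RInt_cont.
Qed.

Lemma moment_continuous (ka om : R) (H : R -> R) y :
  (forall x, continuous H x) ->
  continuous (fun y => exp (ka * y) * cos (om * y) * H y) y /\
  continuous (fun y => exp (ka * y) * sin (om * y) * H y) y.
Proof.
  intros HH. split; (apply continuous_Rmult; [|apply HH]);
    apply continuous_derivable; auto_derive; easy.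
Qed.

(** With [z] the causal convolution, [z' = H + (- ka + i om) z]. *)
Lemma causal_derive (ka om R0 : R) (H : R -> R) (x : R) :
  (forall x, continuous H x) ->
  is_derive (causal_cos ka om R0 H) x
    (H x - ka * causal_cos ka om R0 H x - om * causal_sin ka om R0 H x) /\
  is_derive (causal_sin ka om R0 H) x
    (om * causal_cos ka om R0 H x - ka * causal_sin ka om R0 H x).
Proof.
  intros HH.
  assert (Dc : is_derive (moment_cos ka om R0 H) x (exp (ka * x) * cos (om * x) * H x)).
  { apply (is_derive_primitive (fun y => exp (ka * y) * cos (om * y) * H y)).
    intros y; exact (proj1 (moment_continuous ka om H y HH)). }
  assert (Ds : is_derive (moment_sin ka om R0 H) x (exp (ka * x) * sin (om * x) * H x)).
  { apply (is_derive_primitive (fun y => exp (ka * y) * sin (om * y) * H y)).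
    intros y; exact (proj2 (moment_continuous ka om H y HH)). }
  assert (De : is_derive (fun x => exp (- ka * x)) x (- ka * exp (- ka * x)))
    by (auto_derive; [easy|ring]).
  assert (Dcos : is_derive (fun x => cos (om * x)) x (- om * sin (om * x)))
    by (auto_derive; [easy|ring]).
  assert (Dsin : is_derive (fun x => sin (om * x)) x (om * cos (om * x)))
    by (auto_derive; [easy|ring]).
  assert (Hexp : exp (ka * x) = / exp (- ka * x)).
  { rewrite <- exp_Ropp. f_equal. ring. }
  assert (Hsc : cos (om * x) * cos (om * x) = 1 - sin (om * x) * sin (om * x)).
  { pose proof (sin2_cos2 (om * x)) as E. unfold Rsqr in E. lra. }
  pose proof (exp_pos (- ka * x)) as Hp.
  split.
  - unfold causal_cos at 1. eapply is_derive_eq; [derive_tac|].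
    unfold causal_cos, causal_sin. rewrite Hexp.
    set (E := exp (- ka * x)) in *. set (M1 := moment_cos ka om R0 H x).
    set (M2 := moment_sin ka om R0 H x). set (c := cos (om * x)) in *. set (sn := sin (om * x)) in *.
    apply Rminus_diag_uniq.
    replace (_ - _) with (H x * (c * c - (1 - sn * sn))) by (field; lra). rewrite Hsc. ring.
  - unfold causal_sin at 1. eapply is_derive_eq; [derive_tac|].
    unfold causal_cos, causal_sin. rewrite Hexp.
    field. lra.
Qed.

Lemma RInt_zero (f : R -> R) a b :
  (forall x, Rmin a b < x < Rmax a b -> f x = 0) -> RInt f a b = 0.
Proof.
  intros H. rewrite (RInt_ext f (fun _ => 0)) by easy.
  rewrite RInt_const. unfold scal; simpl; unfold mult; simpl. ring.
Qed.

Lemma RInt_tail (f : R -> R) R0 x :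
  0 < R0 -> (forall y, continuous f y) -> (forall y, R0 <= Rabs y -> f y = 0) ->
  (x <= - R0 -> RInt f (- R0) x = 0) /\ (R0 <= x -> RInt f (- R0) x = RInt f (- R0) R0).
Proof.
  intros HR Hc Hz. split; intros Hx.
  - apply RInt_zero. intros y Hy. rewrite Rmin_right, Rmax_left in Hy by lra.
    apply Hz. rewrite Rabs_left1 by lra. lra.
  - rewrite <- (RInt_Chasles f (- R0) R0 x) by now apply ex_RInt_cont.
    rewrite (RInt_zero f R0 x); [unfold plus; simpl; ring|].
    intros y Hy. rewrite Rmin_left, Rmax_right in Hy by lra.
    apply Hz. rewrite Rabs_pos_eq; lra.
Qed.

Lemma is_lim_exp_decay ka c :
  0 < ka -> is_lim (fun x => exp (- ka * x) * c) p_infty 0.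
Proof.
  intros Hk. replace (Finite 0) with (Rbar_mult 0 c) by (simpl; f_equal; ring).
  apply is_lim_scal_r. apply is_lim_comp with m_infty.
  - apply is_lim_exp_m.
  - apply is_lim_ext with (fun x => - (ka * x)); [intros; ring|].
    replace m_infty with (Rbar_opp p_infty) by easy. apply is_lim_opp.
    apply is_lim_ext with (fun x => ka * x); [easy|].
    replace p_infty with (Rbar_mult ka p_infty) at 2.
    + apply is_lim_scal_l. apply is_lim_id.
    + simpl. destruct (Rle_dec 0 ka) as [Hle|]; [|lra].
      destruct (Rle_lt_or_eq_dec 0 ka Hle); [easy|lra].
  - exists 0. easy.
Qed.

Lemma causal_limits (ka om R0 : R) (H : R -> R) :
  0 < ka -> 0 < R0 -> (forall x, continuous H x) -> (forall y, R0 <= Rabs y -> H y = 0) ->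
  is_lim (causal_cos ka om R0 H) p_infty 0 /\ is_lim (causal_sin ka om R0 H) p_infty 0 /\
  (forall x, x <= - R0 -> causal_cos ka om R0 H x = 0 /\ causal_sin ka om R0 H x = 0).
Proof.
  intros Hk HR HH Hz.
  assert (Tc := fun x => RInt_tail (fun y => exp (ka * y) * cos (om * y) * H y) R0 x HR
    (fun y => proj1 (moment_continuous ka om H y HH)) (fun y Hy => eq_trans
      (f_equal (Rmult (exp (ka * y) * cos (om * y))) (Hz y Hy)) (Rmult_0_r _))).
  assert (Ts := fun x => RInt_tail (fun y => exp (ka * y) * sin (om * y) * H y) R0 x HR
    (fun y => proj2 (moment_continuous ka om H y HH)) (fun y Hy => eq_trans
      (f_equal (Rmult (exp (ka * y) * sin (om * y))) (Hz y Hy)) (Rmult_0_r _))).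
  set (M1 := moment_cos ka om R0 H R0). set (M2 := moment_sin ka om R0 H R0).
  assert (Hlim : forall f : R -> R, (forall x, R0 <= x -> Rabs (f x) <= exp (- ka * x) * (Rabs M1 + Rabs M2)) ->
     is_lim f p_infty 0).
  { intros f Hf.
    apply is_lim_le_le_loc with (fun x => - (exp (- ka * x) * (Rabs M1 + Rabs M2)))
      (fun x => exp (- ka * x) * (Rabs M1 + Rabs M2)).
    - exists R0. intros x Hx. apply Rabs_le_between, Hf. lra.
    - replace (Finite 0) with (Rbar_opp 0) by (simpl; f_equal; ring).
      apply is_lim_opp. now apply is_lim_exp_decay.
    - now apply is_lim_exp_decay. }
  assert (Hcomb : forall x c d, Rabs c <= 1 -> Rabs d <= 1 ->
     Rabs (exp (- ka * x) * (c * M1 + d * M2)) <= exp (- ka * x) * (Rabs M1 + Rabs M2)).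
  { intros x c d Hc Hd. rewrite Rabs_mult, (Rabs_pos_eq (exp _)) by apply Rlt_le, exp_pos.
    apply Rmult_le_compat_l; [apply Rlt_le, exp_pos|].
    eapply Rle_trans; [apply Rabs_triang|]. rewrite !Rabs_mult.
    pose proof (Rabs_pos M1). pose proof (Rabs_pos M2). nra. }
  assert (Hcs : forall y, Rabs (cos y) <= 1 /\ Rabs (sin y) <= 1 /\ Rabs (- cos y) <= 1).
  { intros y. rewrite Rabs_Ropp. repeat split; apply Rabs_le; apply COS_bound || apply SIN_bound. }
  split; [|split].
  - apply Hlim. intros x Hx. unfold causal_cos.
    replace (moment_cos ka om R0 H x) with M1 by (symmetry; now apply Tc).
    replace (moment_sin ka om R0 H x) with M2 by (symmetry; now apply Ts).
    apply Hcomb; apply Hcs.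
  - apply Hlim. intros x Hx. unfold causal_sin, Rminus. rewrite Ropp_mult_distr_l.
    replace (moment_cos ka om R0 H x) with M1 by (symmetry; now apply Tc).
    replace (moment_sin ka om R0 H x) with M2 by (symmetry; now apply Ts).
    apply Hcomb; apply Hcs.
  - intros x Hx. unfold causal_cos, causal_sin.
    replace (moment_cos ka om R0 H x) with 0 by (symmetry; now apply Tc).
    replace (moment_sin ka om R0 H x) with 0 by (symmetry; now apply Ts).
    split; ring.
Qed.

Lemma causal_RInt (ka om R0 : R) (H : R -> R) (x T : R) :
  0 < ka -> 0 < om -> 0 < R0 -> (forall x, continuous H x) -> (forall y, R0 <= Rabs y -> H y = 0) ->
  x + R0 <= T ->
  is_RInt (fun s => green_half ka om s * H (x - s)) 0 T
    ((causal_cos ka om R0 H x + ka / om * causal_sin ka om R0 H x) / (4 * ka * (ka ^ 2 + om ^ 2))).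
Proof.
  intros Hk Ho HR HH Hz HT.
  set (B := 4 * ka * (ka ^ 2 + om ^ 2)).
  assert (HB : 0 < B) by (unfold B; apply Rmult_lt_0_compat; [lra|nra]).
  set (f := fun y => green_half ka om (x - y) * H y).
  assert (Hf : forall y, continuous f y).
  { intros y. apply continuous_Rmult; [|apply HH].
    apply continuous_derivable. unfold green_half. auto_derive. repeat split; unfold B in HB; nra. }
  assert (E1 : is_RInt f (- R0) x ((causal_cos ka om R0 H x + ka / om * causal_sin ka om R0 H x) / B)).
  { set (c1 := exp (- ka * x) * (cos (om * x) + ka / om * sin (om * x)) / B).
    set (c2 := exp (- ka * x) * (sin (om * x) - ka / om * cos (om * x)) / B).
    assert (J1 : is_RInt (fun y => exp (ka * y) * cos (om * y) * H y) (- R0) x (moment_cos ka om R0 H x)).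
    { apply (RInt_correct (fun y => exp (ka * y) * cos (om * y) * H y)). apply ex_RInt_cont.
      intros y; exact (proj1 (moment_continuous ka om H y HH)). }
    assert (J2 : is_RInt (fun y => exp (ka * y) * sin (om * y) * H y) (- R0) x (moment_sin ka om R0 H x)).
    { apply (RInt_correct (fun y => exp (ka * y) * sin (om * y) * H y)). apply ex_RInt_cont.
      intros y; exact (proj2 (moment_continuous ka om H y HH)). }
    pose proof (is_RInt_plus _ _ _ _ _ _ (is_RInt_scal _ _ _ c1 _ J1) (is_RInt_scal _ _ _ c2 _ J2)) as J.
    replace ((causal_cos ka om R0 H x + ka / om * causal_sin ka om R0 H x) / B)
      with (plus (scal c1 (moment_cos ka om R0 H x)) (scal c2 (moment_sin ka om R0 H x))).
    2:{ unfold plus, scal; simpl; unfold mult; simpl. unfold c1, c2, causal_cos, causal_sin.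
        field. lra. }
    eapply is_RInt_ext; [|apply J].
    intros y _. unfold plus, scal; simpl; unfold mult; simpl. unfold f, green_half, c1, c2. fold B.
    replace (- ka * (x - y)) with (- ka * x + ka * y) by ring. rewrite exp_plus.
    replace (om * (x - y)) with (om * x - om * y) by ring. rewrite cos_minus, sin_minus.
    field. lra. }
  assert (E0 : is_RInt f (x - T) (- R0) 0).
  { apply is_RInt_ext with (fun _ => 0).
    - intros y Hy. rewrite Rmin_left, Rmax_right in Hy by lra. unfold f.
      rewrite (Hz y); [eqR; ring|]. rewrite Rabs_left1; lra.
    - pose proof (is_RInt_const (x - T) (- R0) (0 : R)) as Ec.
      unfold scal in Ec; simpl in Ec; unfold mult in Ec; simpl in Ec. rewrite Rmult_0_r in Ec. exact Ec. }
  pose proof (is_RInt_Chasles _ _ _ _ _ _ E0 E1) as E.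
  apply is_RInt_swap in E.
  replace x with (-1 * 0 + x) in E at 1 by ring.
  replace (x - T) with (-1 * T + x) in E by ring.
  apply (is_RInt_comp_lin f) in E. apply (is_RInt_scal _ _ _ (-1)) in E.
  eapply is_RInt_ext in E.
  - match type of E with is_RInt _ _ _ ?l => replace (_ / B) with l; [exact E|] end.
    unfold plus, scal, opp; simpl; unfold mult; simpl.
    eqR. ring.
  - intros s _. unfold f, scal; simpl; unfold mult; simpl.
    replace (x - (-1 * s + x)) with s by ring. replace (-1 * s + x) with (x - s) by ring. eqR. ring.
Qed.

(** The convolution of [H] with the Green function, as the sum of the causal part and
    of its mirror image, followed by its derivatives; the fourth one is written with
    the differential equation. *)
Definition convolution (ka om R0 : R) (H : R -> R) (k : nat) (x : R) : R :=
  let C := causal_cos ka om R0 H x in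
  let S := causal_sin ka om R0 H x in
  let C' := causal_cos ka om R0 (fun y => H (- y)) (- x) in
  let S' := causal_sin ka om R0 (fun y => H (- y)) (- x) in
  let B := 4 * ka * (ka ^ 2 + om ^ 2) in
  let W0 := (C + C' + ka / om * (S + S')) / B in
  let W2 := (ka * (S + S') - om * (C + C')) / (4 * ka * om) in
  match k with
  | 0%nat => W0
  | 1%nat => (S' - S) / (4 * ka * om)
  | 2%nat => W2
  | 3%nat => ((om ^ 2 - ka ^ 2) * (S - S') + 2 * ka * om * (C - C')) / (4 * ka * om)
  | _ => H x - 2 * (om ^ 2 - ka ^ 2) * W2 - (ka ^ 2 + om ^ 2) ^ 2 * W0
  end.

Lemma continuous_reflect (H : R -> R) :
  (forall x, continuous H x) -> forall x, continuous (fun y => H (- y)) x.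
Proof.
  intros HH y. apply (continuous_comp (fun y => - y) H); [|apply HH].
  apply continuous_derivable. auto_derive. easy.
Qed.

Lemma convolution_tower (ka om R0 : R) (H : R -> R) :
  0 < ka -> 0 < om -> (forall x, continuous H x) ->
  tower (fun _ => True) 4 (convolution ka om R0 H).
Proof.
  intros Hk Ho HH k x Hlt _.
  pose proof (continuous_reflect H HH) as HH'.
  destruct (causal_derive ka om R0 H x HH) as [D1 D2].
  destruct (causal_derive ka om R0 (fun y => H (- y)) (- x) HH') as [D3 D4].
  rewrite Ropp_involutive in D3.
  assert (Dn : is_derive (fun y => - y) x (- 1)) by (auto_derive; [easy|ring]).
  pose proof (is_derive_comp _ _ _ _ _ D3 Dn) as D3'.
  pose proof (is_derive_comp _ _ _ _ _ D4 Dn) as D4'.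
  unfold scal in D3', D4'; simpl in D3', D4'; unfold mult in D3', D4'; simpl in D3', D4'.
  clear D3 D4 Dn.
  assert (0 < ka ^ 2 + om ^ 2) by nra.
  do 4 (destruct k as [|k];
    [unfold convolution, Rdiv; eapply is_derive_eq; [derive_tac|field; repeat split; lra]|]).
  lia.
Qed.

Lemma is_lim_comb (f g h l : R -> R) (x : Rbar) (a b c d : R) :
  is_lim f x 0 -> is_lim g x 0 -> is_lim h x 0 -> is_lim l x 0 ->
  is_lim (fun y => a * f y + b * g y + (c * h y + d * l y)) x 0.
Proof.
  intros Hf Hg Hh Hl.
  assert (HS : forall (u : R -> R) e, is_lim u x 0 -> is_lim (fun y => e * u y) x 0).
  { intros u e Hu. replace (Finite 0) with (Rbar_mult e 0) by (simpl; f_equal; ring).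
    now apply is_lim_scal_l. }
  replace (Finite 0) with (Finite (0 + 0 + (0 + 0))) by (f_equal; ring).
  apply is_lim_plus'; apply is_lim_plus'; now apply HS.
Qed.

Lemma convolution_limits (ka om R0 : R) (H : R -> R) k :
  0 < ka -> 0 < om -> 0 < R0 -> (forall x, continuous H x) -> (forall y, R0 <= Rabs y -> H y = 0) ->
  (k <= 3)%nat ->
  is_lim (convolution ka om R0 H k) p_infty 0 /\ is_lim (convolution ka om R0 H k) m_infty 0.
Proof.
  intros Hk Ho HR HH Hz Hlt.
  pose proof (continuous_reflect H HH) as HH'.
  assert (Hz' : forall y, R0 <= Rabs y -> H (- y) = 0).
  { intros y Hy. apply Hz. now rewrite Rabs_Ropp. }
  destruct (causal_limits ka om R0 H Hk HR HH Hz) as [L1 [L2 L3]].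
  destruct (causal_limits ka om R0 (fun y => H (- y)) Hk HR HH' Hz') as [L4 [L5 L6]].
  assert (Z : forall f : R -> R, (forall x, R0 <= x -> f x = 0) -> is_lim f p_infty 0).
  { intros f Hf. apply is_lim_ext_loc with (fun _ => 0); [|apply is_lim_const].
    exists R0. intros x Hx. symmetry. apply Hf. lra. }
  assert (Op : forall f : R -> R, is_lim f p_infty 0 -> is_lim (fun x => f (- x)) m_infty 0).
  { intros f Hf. apply is_lim_comp with p_infty; [easy| |now exists 0].
    replace p_infty with (Rbar_opp m_infty) by easy. apply is_lim_opp, is_lim_id. }
  assert (Q1 : is_lim (fun x => causal_cos ka om R0 (fun y => H (- y)) (- x)) p_infty 0).
  { apply Z. intros x Hx. apply L6. lra. }
  assert (Q2 : is_lim (fun x => causal_sin ka om R0 (fun y => H (- y)) (- x)) p_infty 0).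
  { apply Z. intros x Hx. apply L6. lra. }
  assert (Q3 : is_lim (causal_cos ka om R0 H) m_infty 0).
  { apply is_lim_ext with (fun x => causal_cos ka om R0 H (- - x)).
    - intros x. now rewrite Ropp_involutive.
    - apply (Op (fun x => causal_cos ka om R0 H (- x))). apply Z. intros x Hx. apply L3. lra. }
  assert (Q4 : is_lim (causal_sin ka om R0 H) m_infty 0).
  { apply is_lim_ext with (fun x => causal_sin ka om R0 H (- - x)).
    - intros x. now rewrite Ropp_involutive.
    - apply (Op (fun x => causal_sin ka om R0 H (- x))). apply Z. intros x Hx. apply L3. lra. }
  apply Op in L4. apply Op in L5.
  assert (0 < ka ^ 2 + om ^ 2) by nra.
  assert (Hcomb : exists a b c d, forall x, a * causal_cos ka om R0 H x + b * causal_sin ka om R0 H x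
    + (c * causal_cos ka om R0 (fun y => H (- y)) (- x)
       + d * causal_sin ka om R0 (fun y => H (- y)) (- x)) = convolution ka om R0 H k x).
  { set (B := 4 * ka * (ka ^ 2 + om ^ 2)).
    assert (HB : 0 < B) by (unfold B; apply Rmult_lt_0_compat; lra).
    destruct k as [|[|[|[|k]]]]; [| | | |lia]; unfold convolution.
    - exists (/ B), (ka / om / B), (/ B), (ka / om / B). intros x. fold B. field. lra.
    - exists 0, (- / (4 * ka * om)), 0, (/ (4 * ka * om)). intros x. field. lra.
    - exists (- / (4 * ka)), (/ (4 * om)), (- / (4 * ka)), (/ (4 * om)). intros x. field. lra.
    - exists (/ 2), ((om ^ 2 - ka ^ 2) / (4 * ka * om)), (- / 2), (- (om ^ 2 - ka ^ 2) / (4 * ka * om)).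
      intros x. field. lra. }
  destruct Hcomb as [a [b [c [d Hc]]]].
  split; (eapply is_lim_ext; [apply Hc|]); now apply is_lim_comb.
Qed.

Lemma convolution_RInt (ka om R0 : R) (H : R -> R) (x T : R) :
  0 < ka -> 0 < om -> 0 < R0 -> (forall x, continuous H x) -> (forall y, R0 <= Rabs y -> H y = 0) ->
  Rabs x + R0 <= T ->
  is_RInt (fun s => green ka om s * H (x + s)) (- T) T (convolution ka om R0 H 0 x).
Proof.
  intros Hk Ho HR HH Hz HT.
  pose proof (continuous_reflect H HH) as HH'.
  assert (Hz' : forall y, R0 <= Rabs y -> H (- y) = 0).
  { intros y Hy. apply Hz. now rewrite Rabs_Ropp. }
  pose proof (Rle_abs x) as Hx1. pose proof (Rle_abs (- x)) as Hx2. rewrite Rabs_Ropp in Hx2.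
  pose proof (causal_RInt ka om R0 H x T Hk Ho HR HH Hz ltac:(lra)) as E1.
  pose proof (causal_RInt ka om R0 (fun y => H (- y)) (- x) T Hk Ho HR HH' Hz' ltac:(lra)) as E2.
  assert (0 < ka ^ 2 + om ^ 2) by nra.
  set (B := 4 * ka * (ka ^ 2 + om ^ 2)) in *.
  (* [s < 0] gives the causal part, [s > 0] its mirror image *)
  assert (F1 : is_RInt (fun s => green ka om s * H (x + s)) (- T) 0
     ((causal_cos ka om R0 H x + ka / om * causal_sin ka om R0 H x) / B)).
  { rewrite <- (Ropp_involutive T) in E1. rewrite <- Ropp_0 in E1 at 1.
    apply is_RInt_comp_opp, is_RInt_swap, is_RInt_opp in E1. rewrite opp_opp in E1.
    eapply is_RInt_ext; [|exact E1].
    intros s Hs. rewrite Rmin_left, Rmax_right in Hs by lra. cbv beta. rewrite opp_opp.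
    unfold green. rewrite Rabs_left1 by lra. f_equal. f_equal. ring. }
  assert (F2 : is_RInt (fun s => green ka om s * H (x + s)) 0 T
     ((causal_cos ka om R0 (fun y => H (- y)) (- x)
       + ka / om * causal_sin ka om R0 (fun y => H (- y)) (- x)) / B)).
  { eapply is_RInt_ext; [|apply E2]. intros s Hs. rewrite Rmin_left, Rmax_right in Hs by lra.
    simpl. unfold green. rewrite Rabs_pos_eq by lra. f_equal. f_equal. ring. }
  pose proof (is_RInt_Chasles _ _ _ _ _ _ F1 F2) as F.
  match type of F with is_RInt _ _ _ ?l => replace (convolution ka om R0 H 0 x) with l; [exact F|] end.
  unfold convolution, plus; simpl. unfold B. field. split; [|split]; lra.
Qed.

(** * A density with positive energy *)

Definition extend_zero (R0 : R) (f : R -> R) (x : R) : R :=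
  if Rlt_dec (Rabs x) R0 then f x else 0.

Lemma extend_zero_lipschitz (f : R -> R) L R0 :
  0 < R0 -> 0 <= L ->
  (forall x y, - R0 < x < R0 -> - R0 < y < R0 -> Rabs (f x - f y) <= L * Rabs (x - y)) ->
  filterlim f (at_right (- R0)) (locally 0) -> filterlim f (at_left R0) (locally 0) ->
  forall x y, Rabs (extend_zero R0 f x - extend_zero R0 f y) <= L * Rabs (x - y).
Proof.
  intros HR HL Hf Ha Hb.
  pose proof (lipschitz_end_bound f L R0 HR HL Hf Ha Hb) as He.
  assert (Hin : forall x, Rabs x < R0 -> - R0 < x < R0) by (intros x Hx; apply Rabs_def2 in Hx; lra).
  assert (Hmix : forall x y, Rabs x < R0 -> ~ Rabs y < R0 -> Rabs (f x) <= L * Rabs (x - y)).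
  { intros x y Hx Hy. destruct (He x (Hin x Hx)) as [E1 E2]. apply Hin in Hx.
    destruct (Rle_dec 0 y) as [Hy0|Hy0].
    - rewrite Rabs_pos_eq in Hy by lra. rewrite (Rabs_left1 (x - y)) by lra.
      eapply Rle_trans; [apply E2|]. apply Rmult_le_compat_l; lra.
    - rewrite Rabs_left1 in Hy by lra. rewrite (Rabs_pos_eq (x - y)) by lra.
      eapply Rle_trans; [apply E1|]. apply Rmult_le_compat_l; lra. }
  intros x y. unfold extend_zero.
  destruct (Rlt_dec (Rabs x) R0) as [Hx|Hx]; destruct (Rlt_dec (Rabs y) R0) as [Hy|Hy].
  - apply Hf; now apply Hin.
  - rewrite Rminus_0_r. now apply Hmix.
  - rewrite Rminus_0_l, Rabs_Ropp, Rabs_minus_sym. now apply Hmix.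
  - rewrite Rminus_0_r, Rabs_R0. pose proof (Rabs_pos (x - y)). nra.
Qed.

(** The boundary form of the self-adjoint operator [u'''' + 2 k u''+ a u]. *)
Definition boundary_form (k : R) (p W : nat -> R -> R) (x : R) : R :=
  p 0%nat x * W 3%nat x - p 1%nat x * W 2%nat x
  + k * (p 0%nat x * W 1%nat x - p 1%nat x * W 0%nat x).

Lemma boundary_form_derive k p W D x :
  tower D 4 p -> tower D 4 W -> D x ->
  is_derive (boundary_form k p W) x
    (p 0%nat x * W 4%nat x - p 2%nat x * W 2%nat x
     + k * (p 0%nat x * W 2%nat x - p 2%nat x * W 0%nat x)).
Proof.
  intros Hp HW HD. unfold boundary_form.
  pose proof (Hp 0%nat x ltac:(lia) HD). pose proof (Hp 1%nat x ltac:(lia) HD).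
  pose proof (HW 0%nat x ltac:(lia) HD). pose proof (HW 1%nat x ltac:(lia) HD).
  pose proof (HW 2%nat x ltac:(lia) HD). pose proof (HW 3%nat x ltac:(lia) HD).
  eapply is_derive_eq; [derive_tac|ring].
Qed.

(** Outside the support of [H] the form [boundary_form k W W] is nonincreasing, and
    it vanishes at both infinities. *)
Lemma convolution_boundary_sign ka om R0 (H : R -> R) :
  0 < ka -> 0 < om -> 0 < R0 -> (forall x, continuous H x) -> (forall y, R0 <= Rabs y -> H y = 0) ->
  let W := convolution ka om R0 H in
  let k := om ^ 2 - ka ^ 2 in
  boundary_form k W W (- R0) <= 0 <= boundary_form k W W R0.
Proof.
  intros Hk Ho HR HH Hz W k.
  pose proof (convolution_tower ka om R0 H Hk Ho HH) as HT. fold W in HT.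
  assert (HD : forall x, is_derive (boundary_form k W W) x
     (W 0%nat x * W 4%nat x - W 2%nat x * W 2%nat x + k * (W 0%nat x * W 2%nat x - W 2%nat x * W 0%nat x))).
  { intros x. now apply (boundary_form_derive k W W (fun _ => True)). }
  assert (Hneg : forall x, R0 <= Rabs x -> W 0%nat x * W 4%nat x - W 2%nat x * W 2%nat x
     + k * (W 0%nat x * W 2%nat x - W 2%nat x * W 0%nat x) <= 0).
  { intros x Hx.
    assert (E : W 4%nat x = H x - 2 * k * W 2%nat x - (ka ^ 2 + om ^ 2) ^ 2 * W 0%nat x) by reflexivity.
    rewrite E, (Hz x Hx).
    replace (_ + k * _) with (- ((W 2%nat x + k * W 0%nat x) ^ 2 + (2 * ka * om * W 0%nat x) ^ 2))
      by (unfold k; ring).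
    pose proof (pow2_ge_0 (W 2%nat x + k * W 0%nat x)). pose proof (pow2_ge_0 (2 * ka * om * W 0%nat x)).
    lra. }
  assert (HL : is_lim (boundary_form k W W) p_infty 0 /\ is_lim (boundary_form k W W) m_infty 0).
  { assert (L : forall x, (x = p_infty \/ x = m_infty) -> is_lim (boundary_form k W W) x 0).
    { intros x Hx.
      assert (L : forall j, (j <= 3)%nat -> is_lim (W j) x 0).
      { intros j Hj. destruct (convolution_limits ka om R0 H j Hk Ho HR HH Hz Hj).
        now destruct Hx as [-> | ->]. }
      assert (M : forall i j, (i <= 3)%nat -> (j <= 3)%nat -> is_lim (fun x => W i x * W j x) x 0).
      { intros i j Hi Hj. replace (Finite 0) with (Rbar_mult 0 0) by (simpl; f_equal; ring).
        apply is_lim_mult; [now apply L|now apply L|easy]. }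
      apply is_lim_ext with (fun x => 1 * (W 0%nat x * W 3%nat x) + (- 1) * (W 1%nat x * W 2%nat x)
         + (k * (W 0%nat x * W 1%nat x) + (- k) * (W 1%nat x * W 0%nat x))).
      - intros y. unfold boundary_form. ring.
      - apply is_lim_comb; apply M; lia. }
    split; apply L; tauto. }
  destruct HL as [L1 L2].
  split.
  - change (Rbar_le (boundary_form k W W (- R0)) 0).
    apply (is_lim_le_loc (fun _ => boundary_form k W W (- R0)) (boundary_form k W W) m_infty).
    + exists (- R0). intros x Hx.
      destruct (mean_value (boundary_form k W W) _ x (- R0) (fun z _ => HD z)) as [z [Hz' E]].
      rewrite Rmin_left, Rmax_right in Hz' by lra.
      specialize (Hneg z ltac:(rewrite Rabs_left1; lra)). nra.
    + apply is_lim_const.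
    + exact L2.
  - change (Rbar_le 0 (boundary_form k W W R0)).
    apply (is_lim_le_loc (boundary_form k W W) (fun _ => boundary_form k W W R0) p_infty).
    + exists R0. intros x Hx.
      destruct (mean_value (boundary_form k W W) _ R0 x (fun z _ => HD z)) as [z [Hz' E]].
      rewrite Rmin_left, Rmax_right in Hz' by lra.
      specialize (Hneg z ltac:(rewrite Rabs_pos_eq; lra)). nra.
    + exact L1.
    + apply is_lim_const.
Qed.

Lemma filterlim_Rplus {F : (R -> Prop) -> Prop} {FF : Filter F} (f g : R -> R) (l m : R) :
  filterlim f F (locally l) -> filterlim g F (locally m) ->
  filterlim (fun x => f x + g x) F (locally (l + m)).
Proof.
  intros Hf Hg. eapply filterlim_comp_2; [exact Hf|exact Hg|].
  apply (filterlim_plus (V := R_NormedModule) l m).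
Qed.

Lemma boundary_form_zero_limit {F : (R -> Prop) -> Prop} {FF : Filter F} k (p W : nat -> R -> R) M :
  filterlim (p 0%nat) F (locally 0) -> filterlim (p 1%nat) F (locally 0) ->
  F (fun x => forall j, (j <= 3)%nat -> Rabs (W j x) <= M) ->
  filterlim (boundary_form k p W) F (locally 0).
Proof.
  intros H0 H1 HM.
  assert (HM' : forall j c, (j <= 3)%nat -> F (fun x => Rabs (c * W j x) <= Rabs c * M)).
  { intros j c Hj. eapply filter_imp; [|exact HM]. intros x Hx. rewrite Rabs_mult.
    apply Rmult_le_compat_l; [apply Rabs_pos|now apply Hx]. }
  apply filterlim_ext with (fun x => (p 0%nat x * (1 * W 3%nat x) + p 1%nat x * (- 1 * W 2%nat x))
    + (p 0%nat x * (k * W 1%nat x) + p 1%nat x * (- k * W 0%nat x))).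
  { intros x. unfold boundary_form. ring. }
  replace 0 with ((0 + 0) + (0 + 0)) by ring.
  apply filterlim_Rplus; apply filterlim_Rplus;
    (eapply filterlim_mult_bounded; [eassumption|apply HM'; lia]).
Qed.

(** Let [Q] be the quadratic form of the operator and [W = G * H].  The energy of
    [H = (a - b) w^+] exceeds [(a - b) int (w^+)^2 - Q(w)] by [Q (W - w)], which is
    nonnegative, and the equation of [w] makes that lower bound equal to
    [(b' - b) int ((w^+)^2 + a / b (w^-)^2)], which is positive.  Both facts are read
    off from the derivative of a single function, [Xi] below; the boundary terms of
    [w] vanish at the ends of the interval and those of [W] have a favourable sign. *)
Lemma energy_positive ka om a b b' R0 (w : nat -> R -> R) (H : R -> R) M :
  0 < ka -> 0 < om -> 0 < b < a -> a = (ka ^ 2 + om ^ 2) ^ 2 -> b < b' -> 0 < R0 ->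
  tower (fun x => - R0 < x < R0) 4 w ->
  (forall x, - R0 < x < R0 -> w 4%nat x + 2 * (om ^ 2 - ka ^ 2) * w 2%nat x
      = a / b * b' * neg_part (w 0%nat x) - b' * pos_part (w 0%nat x)) ->
  filterlim (w 0%nat) (at_right (- R0)) (locally 0) ->
  filterlim (w 0%nat) (at_left R0) (locally 0) ->
  filterlim (w 1%nat) (at_right (- R0)) (locally 0) ->
  filterlim (w 1%nat) (at_left R0) (locally 0) ->
  (forall j x, (j <= 3)%nat -> - R0 < x < R0 -> Rabs (w j x) <= M) ->
  (exists x, - R0 < x < R0 /\ w 0%nat x <> 0) ->
  (forall x, continuous H x) ->
  (forall x, R0 <= Rabs x -> H x = 0) ->
  (forall x, - R0 < x < R0 -> H x = (a - b) * pos_part (w 0%nat x)) ->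
  0 < RInt (fun x => H x * convolution ka om R0 H 0 x - H x ^ 2 / (a - b)) (- R0) R0.
Proof.
  intros Hk Ho Hab Ha Hb' HR Tw Ew A1 A2 A3 A4 HM [x0 [Hx0 Hnz]] HH Hz HHw.
  set (W := convolution ka om R0 H). set (k := om ^ 2 - ka ^ 2).
  pose proof (convolution_tower ka om R0 H Hk Ho HH) as TW. fold W in TW.
  assert (TW' : tower (fun x => - R0 < x < R0) 4 W) by (intros j x Hj _; now apply TW).
  set (g := fun x => H x * W 0%nat x - H x ^ 2 / (a - b)).
  change (0 < RInt g (- R0) R0).
  assert (CW : forall j x, (j <= 3)%nat -> continuous (W j) x).
  { intros j x Hj. apply continuous_derivable. exists (W (S j) x). apply TW; [lia|easy]. }
  assert (Cg : forall x, continuous g x).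
  { intros x. unfold g, Rdiv. apply (continuous_minus (V := R_NormedModule)).
    - apply continuous_Rmult; [apply HH|apply CW; lia].
    - apply continuous_Rmult; [|apply continuous_const].
      apply continuous_ext with (fun x => H x * H x); [intros; simpl; ring|].
      apply continuous_Rmult; apply HH. }
  set (I := fun x => RInt g (- R0) x).
  set (Xi := fun x => I x - boundary_form k W W x + (2 * boundary_form k w W x - boundary_form k w w x)).
  set (dXi := fun x => (W 2%nat x - w 2%nat x + k * (W 0%nat x - w 0%nat x)) ^ 2
     + (2 * ka * om * (W 0%nat x - w 0%nat x)) ^ 2
     + (b' - b) * (pos_part (w 0%nat x) ^ 2 + a / b * neg_part (w 0%nat x) ^ 2)).
  assert (DX : forall x, - R0 < x < R0 -> is_derive Xi x (dXi x)).
  { intros x Hx. unfold Xi.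
    pose proof (is_derive_primitive g (- R0) x Cg) as D1.
    pose proof (boundary_form_derive k W W _ x TW' TW' Hx) as D2.
    pose proof (boundary_form_derive k w W _ x Tw TW' Hx) as D3.
    pose proof (boundary_form_derive k w w _ x Tw Tw Hx) as D4.
    eapply is_derive_eq; [derive_tac|].
    assert (E : W 4%nat x = H x - 2 * k * W 2%nat x - (ka ^ 2 + om ^ 2) ^ 2 * W 0%nat x) by reflexivity.
    specialize (Ew x Hx). fold k in Ew.
    replace (w 4%nat x) with (a / b * b' * neg_part (w 0%nat x) - b' * pos_part (w 0%nat x)
       - 2 * k * w 2%nat x) by lra.
    rewrite E. unfold dXi, g. rewrite (HHw x Hx), <- Ha.
    assert (Hk4 : (2 * ka * om * (W 0%nat x - w 0%nat x)) ^ 2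
       = (a - k ^ 2) * (W 0%nat x - w 0%nat x) ^ 2) by (rewrite Ha; unfold k; ring).
    rewrite Hk4.
    case_parts (w 0%nat x); field; lra. }
  assert (PX : forall x, - R0 < x < R0 -> 0 <= dXi x).
  { intros x _. unfold dXi. assert (0 < a / b) by (apply Rdiv_lt_0_compat; lra).
    pose proof (pow2_ge_0 (W 2%nat x - w 2%nat x + k * (W 0%nat x - w 0%nat x))).
    pose proof (pow2_ge_0 (2 * ka * om * (W 0%nat x - w 0%nat x))).
    pose proof (pow2_ge_0 (pos_part (w 0%nat x))). pose proof (pow2_ge_0 (neg_part (w 0%nat x))).
    assert (0 <= a / b * neg_part (w 0%nat x) ^ 2) by (apply Rmult_le_pos; lra).
    assert (0 <= (b' - b) * (pos_part (w 0%nat x) ^ 2 + a / b * neg_part (w 0%nat x) ^ 2))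
      by (apply Rmult_le_pos; lra).
    lra. }
  assert (P0 : 0 < dXi x0).
  { unfold dXi. assert (0 < a / b) by (apply Rdiv_lt_0_compat; lra).
    pose proof (pow2_ge_0 (W 2%nat x0 - w 2%nat x0 + k * (W 0%nat x0 - w 0%nat x0))).
    pose proof (pow2_ge_0 (2 * ka * om * (W 0%nat x0 - w 0%nat x0))).
    assert (0 < (b' - b) * (pos_part (w 0%nat x0) ^ 2 + a / b * neg_part (w 0%nat x0) ^ 2)); [|lra].
    apply Rmult_lt_0_compat; [lra|].
    pose proof (pow2_gt_0 _ Hnz).
    case_parts (w 0%nat x0); nra. }
  assert (Bd : forall (F : (R -> Prop) -> Prop) (FF : Filter F) y,
     filter_le F (locally y) -> F (fun x => - R0 < x < R0) ->
     filterlim (w 0%nat) F (locally 0) -> filterlim (w 1%nat) F (locally 0) ->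
     filterlim Xi F (locally (I y - boundary_form k W W y))).
  { intros F FF y HF Hin F0 F1.
    replace (I y - boundary_form k W W y) with ((I y - boundary_form k W W y) + (0 + 0)) by ring.
    unfold Xi. apply filterlim_Rplus; [|apply filterlim_Rplus].
    - eapply (filterlim_of_derive (fun x => I x - boundary_form k W W x)); [exact HF|].
      apply is_derive_Rminus; [apply (is_derive_primitive g (- R0) y Cg)|].
      apply (boundary_form_derive k W W (fun _ => True) y TW TW). exact Logic.I.
    - apply filterlim_ext with (fun x => boundary_form k w W x * 2); [intros; ring|].
      apply filterlim_mult_bounded with 2.
      + assert (HWb : forall j, (j <= 3)%nat -> F (fun x => Rabs (W j x) <= Rabs (W j y) + 1)).
        { intros j Hj. apply HF.
          pose proof (CW j y Hj) as C. pose proof (proj1 (filterlim_eps (F := locally y) (W j) (W j y)) C 1 Rlt_0_1) as C1.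
          apply (filter_imp (F := locally y) (fun x => Rabs (W j x - W j y) < 1)); [|exact C1]. intros x Hx.
          pose proof (Rabs_triang_inv (W j x) (W j y)). lra. }
        apply boundary_form_zero_limit with (Rabs (W 0%nat y) + Rabs (W 1%nat y)
           + Rabs (W 2%nat y) + Rabs (W 3%nat y) + 1); [easy|easy|].
        pose proof (HWb 0%nat ltac:(lia)) as B0. pose proof (HWb 1%nat ltac:(lia)) as B1.
        pose proof (HWb 2%nat ltac:(lia)) as B2. pose proof (HWb 3%nat ltac:(lia)) as B3.
        generalize (filter_and (F := F) _ _ (filter_and (F := F) _ _ B0 B1) (filter_and (F := F) _ _ B2 B3)).
        clear B0 B1 B2 B3.
        apply filter_imp. intros x [[B0 B1] [B2 B3]] j Hj.
        pose proof (Rabs_pos (W 0%nat y)). pose proof (Rabs_pos (W 1%nat y)).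
        pose proof (Rabs_pos (W 2%nat y)). pose proof (Rabs_pos (W 3%nat y)).
        do 4 (destruct j as [|j]; [lra|]). lia.
      + apply filter_forall. intros _. rewrite Rabs_pos_eq; lra.
    - apply filterlim_ext with (fun x => boundary_form k w w x * (- 1)); [intros; ring|].
      apply filterlim_mult_bounded with 1.
      + apply boundary_form_zero_limit with M; [easy|easy|].
        eapply filter_imp; [|exact Hin]. intros x Hx j Hj. now apply HM.
      + apply filter_forall. intros _. rewrite Rabs_left1; lra. }
  destruct (clamped_ends_near (fun x => - R0 < x < R0) R0 HR (fun x Hx => Hx)) as [N1 N2].
  assert (La : filterlim Xi (at_right (- R0)) (locally (I (- R0) - boundary_form k W W (- R0)))).
  { apply Bd; try easy; [apply within_filter, locally_filter|apply filter_le_within]. }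
  assert (Lb : filterlim Xi (at_left R0) (locally (I R0 - boundary_form k W W R0))).
  { apply Bd; try easy; [apply within_filter, locally_filter|apply filter_le_within]. }
  assert (I0 : I (- R0) = 0) by apply (RInt_point (V := R_CompleteNormedModule)).
  assert (Hmono := fun x Hx => nondecreasing_end_limits Xi dXi (- R0) R0 _ _ x DX PX La Lb Hx).
  destruct (convolution_boundary_sign ka om R0 H Hk Ho HR HH Hz) as [S1 S2].
  fold W k in S1, S2. change (0 < I R0).
  apply Rnot_le_lt. intros Hle.
  assert (Hconst : forall x, - R0 < x < R0 -> Xi x = Xi x0).
  { intros x Hx. pose proof (Hmono x Hx). pose proof (Hmono x0 Hx0). rewrite I0 in *. lra. }
  assert (D0 : is_derive Xi x0 0).
  { apply (is_derive_ext_loc (fun _ => Xi x0)).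
    - destruct (open_interval (- R0) R0 x0 Hx0) as [d Hd]. exists d. intros y Hy.
      symmetry. apply Hconst. now apply Hd.
    - apply is_derive_Rconst. }
  apply is_derive_unique in D0. pose proof (is_derive_unique _ _ _ (DX x0 Hx0)) as D1. lra.
Qed.

Lemma filterlim_scaled_ends (f : R -> R) lam r c :
  0 < lam ->
  filterlim f (at_right (- r)) (locally 0) -> filterlim f (at_left r) (locally 0) ->
  filterlim (fun x => c * f (lam * x)) (at_right (- (r / lam))) (locally 0) /\
  filterlim (fun x => c * f (lam * x)) (at_left (r / lam)) (locally 0).
Proof.
  intros Hl Ha Hb.
  pose proof (proj1 (filterlim_eps _ _) Ha) as Ha'. pose proof (proj1 (filterlim_eps _ _) Hb) as Hb'.
  assert (Hc : 0 < Rabs c + 1) by (pose proof (Rabs_pos c); lra).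
  assert (Hfin : forall y e, Rabs (f y - 0) < e / (Rabs c + 1) -> 0 < e -> Rabs (c * f y - 0) < e).
  { intros y e Hy He. rewrite Rminus_0_r in *. rewrite Rabs_mult.
    apply Rle_lt_trans with ((Rabs c + 1) * Rabs (f y)).
    - apply Rmult_le_compat_r; [apply Rabs_pos|lra].
    - apply Rlt_le_trans with ((Rabs c + 1) * (e / (Rabs c + 1))); [now apply Rmult_lt_compat_l|].
      right; field; lra. }
  assert (Hr : lam * (r / lam) = r) by (field; lra).
  split; apply filterlim_eps; intros e He.
  - specialize (Ha' (e / (Rabs c + 1)) ltac:(now apply Rdiv_lt_0_compat)).
    apply at_right_spec in Ha'. destruct Ha' as [d [Hd Hf]].
    apply at_right_spec. exists (d / lam). split; [now apply Rdiv_lt_0_compat|].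
    intros x Hx. apply Hfin; [|easy]. apply Hf.
    assert (Hdl : lam * (d / lam) = d) by (field; lra). nra.
  - specialize (Hb' (e / (Rabs c + 1)) ltac:(now apply Rdiv_lt_0_compat)).
    apply at_left_spec in Hb'. destruct Hb' as [d [Hd Hf]].
    apply at_left_spec. exists (d / lam). split; [now apply Rdiv_lt_0_compat|].
    intros x Hx. apply Hfin; [|easy]. apply Hf.
    assert (Hdl : lam * (d / lam) = d) by (field; lra). nra.
Qed.

(** Rescaling by [lam = sqrt (om^2 - ka^2)] changes the coefficient [2] of the Fucik
    problem into [2 (om^2 - ka^2)] and [be] into [lam^4 be > b]. *)
Lemma fucik_test_density ka om a b r be :
  0 < ka < om -> 0 < b < a -> a = (ka ^ 2 + om ^ 2) ^ 2 -> 0 < r ->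
  fucik_spectrum r (a / b * be, be) -> b < (om ^ 2 - ka ^ 2) ^ 2 * be ->
  exists R0 H L, 0 < R0 /\ 0 <= L /\ (forall x, 0 <= H x) /\
    (forall x y, Rabs (H x - H y) <= L * Rabs (x - y)) /\
    (forall x, R0 <= Rabs x -> H x = 0) /\
    0 < RInt (fun x => H x * convolution ka om R0 H 0 x - H x ^ 2 / (a - b)) (- R0) R0.
Proof.
  intros Hko Hab Ha Hr Hsp Hbe.
  apply fucik_clamped in Hsp; [|easy]. destruct Hsp as [Y [HY Hnt]].
  destruct (clamped_bounded _ _ _ _ Hr HY) as [M [HM0 HM]].
  assert (Hk : 0 < om ^ 2 - ka ^ 2) by nra.
  set (lam := sqrt (om ^ 2 - ka ^ 2)).
  assert (Hlam : 0 < lam) by now apply sqrt_lt_R0.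
  assert (Hlam2 : lam ^ 2 = om ^ 2 - ka ^ 2) by (unfold lam; apply pow2_sqrt; lra).
  set (R0 := r / lam). assert (HR : 0 < R0) by now apply Rdiv_lt_0_compat.
  assert (Hlr : lam * R0 = r) by (unfold R0; field; lra).
  assert (Hin : forall x, - R0 < x < R0 -> - r < lam * x < r) by (intros x Hx; nra).
  (* the sign is reversed because the weaker coefficient [be] acts on the negative part
     of the Fucik solution and has to act on the positive part of [w] *)
  set (w := fun j x => - lam ^ j * Y j (lam * x)).
  destruct HY as [H1 [H2 [H3 [H4 [H5 H6]]]]].
  assert (Tw : tower (fun x => - R0 < x < R0) 4 w).
  { intros j x Hj Hx. unfold w.
    assert (Dl : is_derive (fun x => lam * x) x lam) by (auto_derive; [easy|ring]).
    pose proof (is_derive_comp _ _ _ _ _ (H1 j (lam * x) Hj (Hin x Hx)) Dl) as D.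
    unfold scal in D; simpl in D; unfold mult in D; simpl in D.
    eapply is_derive_eq; [derive_tac|]. simpl. ring. }
  set (Mw := (Rabs lam + 1) ^ 3 * M).
  assert (HMw : forall j x, (j <= 3)%nat -> - R0 < x < R0 -> Rabs (w j x) <= Mw).
  { intros j x Hj Hx. unfold w, Mw. rewrite Rabs_mult, Rabs_Ropp, <- RPow_abs.
    apply Rmult_le_compat; try apply Rabs_pos.
    - apply pow_le, Rabs_pos.
    - pose proof (Rabs_pos lam). apply Rle_trans with ((Rabs lam + 1) ^ j).
      + apply pow_incr. lra.
      + apply Rle_pow; [lra|easy].
    - apply HM; [easy|now apply Hin]. }
  destruct (filterlim_scaled_ends (Y 0%nat) lam r (- lam ^ 0) Hlam H3 H4) as [A1 A2].
  destruct (filterlim_scaled_ends (Y 1%nat) lam r (- lam ^ 1) Hlam H5 H6) as [A3 A4].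
  assert (HMw0 : 0 <= Mw).
  { apply Rle_trans with (Rabs (w 0%nat 0)); [apply Rabs_pos|apply HMw; [lia|lra]]. }
  assert (Hext := extend_zero_lipschitz (w 0%nat) Mw R0 HR HMw0).
  specialize (Hext (fun x y Hx Hy => lipschitz_of_derive (w 0%nat) (w 1%nat) Mw (- R0) R0 y x
    (fun z Hz => Tw 0%nat z ltac:(lia) Hz) (fun z Hz => HMw 1%nat z ltac:(lia) Hz) Hy Hx) A1 A2).
  set (H := fun x => (a - b) * pos_part (extend_zero R0 (w 0%nat) x)).
  assert (HLip : forall x y, Rabs (H x - H y) <= (a - b) * Mw * Rabs (x - y)).
  { intros x y. unfold H. rewrite <- Rmult_minus_distr_l, Rabs_mult, Rabs_pos_eq, Rmult_assoc by lra.
    apply Rmult_le_compat_l; [lra|].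
    eapply Rle_trans; [apply pos_part_lipschitz|apply Hext]. }
  assert (HZ : forall x, R0 <= Rabs x -> H x = 0).
  { intros x Hx. unfold H, extend_zero. destruct (Rlt_dec (Rabs x) R0); [lra|].
    unfold pos_part. rewrite Rmax_left by lra. ring. }
  exists R0, H, ((a - b) * Mw).
  split; [easy|]. split; [apply Rmult_le_pos; lra|]. split.
  { intros x. unfold H. apply Rmult_le_pos; [lra|]. apply Rmax_r. }
  split; [easy|]. split; [easy|].
  apply (energy_positive ka om a b ((om ^ 2 - ka ^ 2) ^ 2 * be) R0 w H Mw); try easy; try lra.
  - intros x Hx. specialize (H2 (lam * x) (Hin x Hx)). rewrite <- Hlam2. unfold w.
    assert (Hn : pos_part (- lam ^ 0 * Y 0%nat (lam * x)) = neg_part (Y 0%nat (lam * x)) /\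
                 neg_part (- lam ^ 0 * Y 0%nat (lam * x)) = pos_part (Y 0%nat (lam * x))).
    { unfold pos_part, neg_part. split; f_equal; simpl; ring. }
    destruct Hn as [-> ->].
    replace (Y 4%nat (lam * x)) with (- 2 * Y 2%nat (lam * x)
      - a / b * be * pos_part (Y 0%nat (lam * x)) + be * neg_part (Y 0%nat (lam * x))) by lra.
    field. lra.
  - destruct Hnt as [x [Hx Hnz]]. exists (x / lam).
    assert (E : lam * (x / lam) = x) by (field; lra). split.
    + split; apply Rmult_lt_reg_l with lam; try easy; rewrite E; nra.
    + unfold w. rewrite E. simpl. lra.
  - intros x. now apply continuous_lipschitz with ((a - b) * Mw).
  - intros x Hx. unfold H, extend_zero. destruct (Rlt_dec (Rabs x) R0) as [_|Hn]; [easy|].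
    exfalso. apply Hn. apply Rabs_def1; lra.
Qed.

(** * The discrete periodic problem *)

Lemma rsum_periodic (N : nat) (f : Z -> R) (z : Z) :
  (forall y, f (y + Z.of_nat N)%Z = f y) ->
  rsum N (fun m => f (z + Z.of_nat m)%Z) = rsum N (fun m => f (Z.of_nat m)).
Proof.
  intros Hf.
  assert (Hs : forall y, rsum N (fun m => f (Z.succ y + Z.of_nat m)%Z) = rsum N (fun m => f (y + Z.of_nat m)%Z)).
  { intros y. apply Rplus_eq_reg_l with (f (y + Z.of_nat 0)%Z).
    pose proof (rsum_succ_l N (fun m => f (y + Z.of_nat m)%Z)) as E.
    rewrite (rsum_ext N (fun m => f (Z.succ y + Z.of_nat m)%Z) (fun m => f (y + Z.of_nat (S m))%Z))
      by (intros m _; f_equal; lia).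
    change (rsum N (fun m => f (y + Z.of_nat m)%Z) + f (y + Z.of_nat N)%Z
      = f (y + Z.of_nat 0)%Z + rsum N (fun m => f (y + Z.of_nat (S m))%Z)) in E.
    rewrite <- E, Hf. simpl Z.of_nat. rewrite Z.add_0_r. ring. }
  assert (H0 : rsum N (fun m => f (0 + Z.of_nat m)%Z) = rsum N (fun m => f (Z.of_nat m))).
  { apply rsum_ext. intros m _. f_equal. }
  revert z. apply Z.peano_ind; [exact H0| |]; intros y IH.
  - now rewrite Hs.
  - rewrite <- IH, <- Hs. apply rsum_ext. intros m _. f_equal. lia.
Qed.

Lemma finite_argmax n (f : nat -> R) :
  (0 < n)%nat -> exists i, (i < n)%nat /\ forall j, (j < n)%nat -> f j <= f i.
Proof.
  induction n as [|n IH]; intros Hn; [lia|].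
  destruct (Nat.eq_dec n 0) as [->|Hn0].
  - exists 0%nat. split; [lia|]. intros j Hj. replace j with 0%nat by lia. lra.
  - destruct (IH ltac:(lia)) as [i [Hi Hmax]].
    destruct (Rle_dec (f n) (f i)) as [Hle|Hgt].
    + exists i. split; [lia|]. intros j Hj. destruct (Nat.eq_dec j n) as [->|]; [easy|apply Hmax; lia].
    + exists n. split; [lia|]. intros j Hj. destruct (Nat.eq_dec j n) as [->|]; [lra|].
      specialize (Hmax j ltac:(lia)). lra.
Qed.

(** The distance of [d] to the multiples of [N]. *)
Definition cyclic_dist (N d : Z) : Z := Z.min (d mod N) (N - d mod N).

Lemma cyclic_dist_periodic N d : (0 < N)%Z -> cyclic_dist N (d + N) = cyclic_dist N d.
Proof.
  intros HN. unfold cyclic_dist. replace (d + N)%Z with (d + 1 * N)%Z by ring.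
  now rewrite Z.mod_add by lia.
Qed.

Lemma cyclic_dist_opp N d : (0 < N)%Z -> cyclic_dist N (- d) = cyclic_dist N d.
Proof.
  intros HN. unfold cyclic_dist.
  destruct (Z.eq_dec (d mod N) 0) as [E|E].
  - pose proof (Z.mod_opp_l_z d N ltac:(lia) E). lia.
  - pose proof (Z.mod_opp_l_nz d N ltac:(lia) E). lia.
Qed.

Lemma cyclic_dist_small P d : (Z.abs d <= P)%Z -> cyclic_dist (2 * P + 1) d = Z.abs d.
Proof.
  intros Hd.
  assert (Hp : forall e, (0 <= e <= P)%Z -> cyclic_dist (2 * P + 1) e = e).
  { intros e He. unfold cyclic_dist. rewrite Z.mod_small by lia. lia. }
  destruct (Z.le_gt_cases 0 d).
  - rewrite Hp; lia.
  - rewrite <- cyclic_dist_opp, Hp; lia.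
Qed.

Lemma cyclic_dist_succ N d : (0 < N)%Z -> (Z.abs (cyclic_dist N (d + 1) - cyclic_dist N d) <= 1)%Z.
Proof.
  intros HN. unfold cyclic_dist.
  pose proof (Z.mod_pos_bound d N HN). pose proof (Z.div_mod d N ltac:(lia)) as E.
  destruct (Z.eq_dec (d mod N) (N - 1)) as [E1|E1].
  - pose proof (Zmod_unique (d + 1) N (d / N + 1) 0 ltac:(lia) ltac:(nia)). lia.
  - pose proof (Zmod_unique (d + 1) N (d / N) (d mod N + 1) ltac:(lia) ltac:(nia)). lia.
Qed.

Definition cyclic_green (ka om eps : R) (P : nat) (d : Z) : R :=
  green ka om (eps * IZR (cyclic_dist (2 * Z.of_nat P + 1) d)).

(** In the variable [p = eps h] the discretised energy
    [int h (G * h) - th int h^2] is the quadratic form of this matrix. *)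
Definition energy_matrix (ka om th eps : R) (P i j : nat) : R :=
  cyclic_green ka om eps P (Z.of_nat i - Z.of_nat j) - (if Nat.eq_dec i j then th / eps else 0).

(** The period is cut out as a window centred at [z], where the cyclic distance is the
    ordinary one. *)
Definition discrete_potential (ka om eps : R) (P : nat) (h : Z -> R) (z : Z) : R :=
  eps * rsum (2 * P + 1) (fun m =>
    green ka om (eps * (INR m - INR P)) * h (z + Z.of_nat m - Z.of_nat P)%Z).

(** The optimality conditions for the energy matrix, read as an equation for the
    periodic density [h = p / eps], translated so that its maximum is at [0]. *)
Lemma discrete_solution ka om th eps P :
  0 < ka -> 0 < om -> 0 < th -> 0 < eps ->
  exists (h : Z -> R) (mu : R),
    let w := discrete_potential ka om eps P h in
    (forall z, 0 <= h z)
    /\ (forall z, h z = pos_part ((w z - mu) / th))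
    /\ (forall z, Rabs (w (z + 1)%Z - w z) <= / (4 * ka * om) * eps)
    /\ (forall z, Rabs (w z) <= green_bound ka om)
    /\ (forall z, h z <= h 0%Z)
    /\ (forall z q, (q <= 2 * P + 1)%nat -> eps * rsum q (fun m => h (z + Z.of_nat m)%Z) <= 1)
    /\ (exists z, mu <= w z)
    /\ (forall p, in_simplex (2 * P + 1) p ->
          qform (2 * P + 1) (energy_matrix ka om th eps P) p <= mu).
Proof.
  intros Hk Ho Hth He. set (N := (2 * P + 1)%nat). set (NZ := (2 * Z.of_nat P + 1)%Z).
  assert (HNZ : NZ = Z.of_nat N) by (unfold N, NZ; lia).
  assert (HN0 : (0 < NZ)%Z) by (unfold NZ; lia).
  set (kd := cyclic_green ka om eps P). set (A := energy_matrix ka om th eps P).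
  destruct (qform_max_kkt N A) as [p [M [Hp [Hmax [HM [Hle Heq]]]]]].
  { unfold N; lia. }
  { intros i j. unfold A, energy_matrix, cyclic_green. f_equal.
    - rewrite <- cyclic_dist_opp by lia. do 4 f_equal. lia.
    - destruct (Nat.eq_dec i j) as [E|E]; destruct (Nat.eq_dec j i) as [E'|E']; try reflexivity; lia. }
  destruct Hp as [Hp0 Hp1].
  set (h0 := fun z => p (Z.to_nat (z mod NZ)) / eps).
  set (w0 := fun z => rsum N (fun j => kd (z - Z.of_nat j)%Z * p j)).
  assert (Hkdper : forall d, kd (d + NZ)%Z = kd d).
  { intros d. unfold kd, cyclic_green. fold NZ. now rewrite cyclic_dist_periodic. }
  assert (Hmodper : forall z, ((z + NZ) mod NZ = z mod NZ)%Z).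
  { intros z. replace (z + NZ)%Z with (z + 1 * NZ)%Z by ring. apply Z.mod_add. lia. }
  assert (Hh0per : forall z, h0 (z + NZ)%Z = h0 z).
  { intros z. unfold h0. now rewrite Hmodper. }
  assert (Hmodlt : forall z, (Z.to_nat (z mod NZ) < N)%nat).
  { intros z. pose proof (Z.mod_pos_bound z NZ HN0). lia. }
  assert (Hmodnat : forall j, (j < N)%nat -> Z.to_nat (Z.of_nat j mod NZ) = j).
  { intros j Hj. rewrite Z.mod_small by lia. lia. }
  assert (Hw0mod : forall z, w0 z = w0 (Z.of_nat (Z.to_nat (z mod NZ)))).
  { intros z. unfold w0. apply rsum_ext. intros j _. f_equal. unfold kd, cyclic_green. do 3 f_equal.
    unfold cyclic_dist. fold NZ.
    rewrite Z2Nat.id by (apply Z.mod_pos_bound; lia). now rewrite Zminus_mod_idemp_l. }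
  assert (Hg : forall i, (i < N)%nat -> rsum N (fun j => A i j * p j) = w0 (Z.of_nat i) - th * (p i / eps)).
  { intros i Hi. unfold w0. replace (th * (p i / eps)) with (th / eps * p i) by (field; lra).
    rewrite <- (rsum_delta N i (fun j => th / eps * p j) Hi), <- rsum_minus. apply rsum_ext.
    intros j _. unfold A, energy_matrix. fold kd.
    destruct (Nat.eq_dec i j) as [E|E]; destruct (Nat.eq_dec j i) as [E'|E'];
      [ring|lia|lia|ring]. }
  assert (Hh0 : forall z, h0 z = Rmax 0 ((w0 z - M) / th)).
  { intros z. rewrite Hw0mod. unfold h0. pose proof (Hmodlt z) as Hi.
    set (i := Z.to_nat (z mod NZ)) in *.
    destruct (Req_dec (p i) 0) as [E|E].
    - specialize (Hle i Hi). rewrite Hg, E in Hle by easy. rewrite E, Rmax_left; [field; lra|].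
      assert (0 <= (M - w0 (Z.of_nat i)) / th).
      { apply Rdiv_le_0_compat; [|easy]. replace (th * (0 / eps)) with 0 in Hle by (field; lra). lra. }
      replace ((w0 (Z.of_nat i) - M) / th) with (- ((M - w0 (Z.of_nat i)) / th)) by (field; lra). lra.
    - assert (Hpi : 0 < p i) by (specialize (Hp0 i); lra).
      specialize (Heq i Hi Hpi). rewrite Hg in Heq by easy.
      replace (w0 (Z.of_nat i) - M) with (th * (p i / eps)) by lra.
      replace (th * (p i / eps) / th) with (p i / eps) by (field; lra).
      rewrite Rmax_right; [easy|]. apply Rdiv_le_0_compat; lra. }
  assert (Hw0lip : forall z, Rabs (w0 (z + 1)%Z - w0 z) <= / (4 * ka * om) * eps).
  { intros z. unfold w0. rewrite <- rsum_minus. eapply Rle_trans; [apply rsum_abs|].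
    rewrite <- (Rmult_1_r (_ * eps)), <- Hp1, <- rsum_scal. apply rsum_le. intros j _.
    rewrite <- Rmult_minus_distr_r, Rabs_mult, (Rabs_pos_eq (p j)) by apply Hp0.
    apply Rmult_le_compat_r; [apply Hp0|].
    unfold kd, cyclic_green. fold NZ. eapply Rle_trans; [now apply green_lipschitz|].
    apply Rmult_le_compat_l.
    { apply Rlt_le, Rinv_0_lt_compat. apply Rmult_lt_0_compat; lra. }
    rewrite <- Rmult_minus_distr_l, Rabs_mult, (Rabs_pos_eq eps), <- minus_IZR, <- abs_IZR by lra.
    rewrite <- (Rmult_1_r eps) at 2. apply Rmult_le_compat_l; [lra|]. apply IZR_le.
    replace (z + 1 - Z.of_nat j)%Z with (z - Z.of_nat j + 1)%Z by ring.
    now apply cyclic_dist_succ. }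
  assert (Hw0b : forall z, Rabs (w0 z) <= green_bound ka om).
  { intros z. unfold w0. eapply Rle_trans; [apply rsum_abs|].
    rewrite <- (Rmult_1_r (green_bound _ _)), <- Hp1, <- rsum_scal. apply rsum_le. intros j _.
    rewrite Rabs_mult, (Rabs_pos_eq (p j)) by apply Hp0.
    apply Rmult_le_compat_r; [apply Hp0|]. now apply green_le. }
  destruct (finite_argmax N (fun i => h0 (Z.of_nat i))) as [i0 [Hi0 Hi0max]]; [unfold N; lia|].
  set (h := fun z => h0 (z + Z.of_nat i0)%Z).
  assert (Hw : forall z, discrete_potential ka om eps P h z = w0 (z + Z.of_nat i0)%Z).
  { intros z. unfold discrete_potential. fold N. rewrite <- rsum_scal.
    set (u := (z + Z.of_nat i0)%Z).
    set (F := fun y => kd (u - y)%Z * p (Z.to_nat (y mod NZ))).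
    rewrite (rsum_ext N _ (fun m => F (u - Z.of_nat P + Z.of_nat m)%Z)).
    - rewrite rsum_periodic.
      + unfold w0. apply rsum_ext. intros j Hj. unfold F. now rewrite Hmodnat.
      + intros y. rewrite <- HNZ. unfold F. rewrite Hmodper. f_equal.
        rewrite <- Hkdper. f_equal. ring.
    - intros m Hm. unfold F, h, h0, kd, cyclic_green.
      replace (u - (u - Z.of_nat P + Z.of_nat m))%Z with (Z.of_nat P - Z.of_nat m)%Z by ring.
      rewrite cyclic_dist_small by (unfold N in Hm; lia).
      rewrite abs_IZR, minus_IZR, <- !INR_IZR_INZ.
      replace (z + Z.of_nat m - Z.of_nat P + Z.of_nat i0)%Z with (u - Z.of_nat P + Z.of_nat m)%Z
        by (unfold u; ring).
      replace (green ka om (eps * Rabs (INR P - INR m))) with (green ka om (eps * (INR m - INR P))).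
      + field. lra.
      + unfold green. f_equal. rewrite !Rabs_mult, Rabs_Rabsolu. f_equal. apply Rabs_minus_sym. }
  assert (Hh00 : forall z, 0 <= h0 z).
  { intros z. unfold h0. apply Rdiv_le_0_compat; [apply Hp0|lra]. }
  exists h, M. cbv zeta.
  split; [intros; apply Hh00|].
  split; [intros z; rewrite Hw; unfold pos_part; rewrite Rmax_comm; apply Hh0|].
  split.
  { intros z. rewrite !Hw. replace (z + 1 + Z.of_nat i0)%Z with (z + Z.of_nat i0 + 1)%Z by ring.
    apply Hw0lip. }
  split; [intros z; rewrite Hw; apply Hw0b|].
  split.
  { intros z. unfold h. rewrite Z.add_0_l.
    replace (h0 (z + Z.of_nat i0)%Z) with (h0 (Z.of_nat (Z.to_nat ((z + Z.of_nat i0) mod NZ)))).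
    - apply Hi0max. apply Hmodlt.
    - unfold h0. rewrite Z2Nat.id by (apply Z.mod_pos_bound; lia). now rewrite Zmod_mod. }
  split.
  { intros z q Hq.
    apply Rle_trans with (eps * rsum N (fun m => h (z + Z.of_nat m)%Z)).
    - apply Rmult_le_compat_l; [lra|]. apply rsum_le_longer; [easy|]. intros; apply Hh00.
    - right. unfold h.
      rewrite (rsum_ext N _ (fun m => h0 (z + Z.of_nat i0 + Z.of_nat m)%Z)) by (intros; f_equal; lia).
      rewrite rsum_periodic by (intros y; rewrite <- HNZ; apply Hh0per).
      rewrite <- rsum_scal, <- Hp1. apply rsum_ext. intros j Hj. unfold h0. rewrite Hmodnat by easy.
      field. lra. }
  split; [|exact Hmax].
  assert (Hex : exists i, (i < N)%nat /\ 0 < p i).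
  { apply NNPP. intros Hno. rewrite (rsum_ext N p (fun _ => 0)), rsum_const in Hp1; [lra|].
    intros i Hi. destruct (Req_dec (p i) 0) as [|E]; [easy|].
    exfalso. apply Hno. exists i. split; [easy|]. specialize (Hp0 i). lra. }
  destruct Hex as [i [Hi Hpi]]. exists (Z.of_nat i - Z.of_nat i0)%Z.
  rewrite Hw. replace (Z.of_nat i - Z.of_nat i0 + Z.of_nat i0)%Z with (Z.of_nat i) by ring.
  rewrite <- (Heq i Hi Hpi), Hg by easy.
  assert (0 <= th * (p i / eps)); [|lra].
  apply Rmult_le_pos; [lra|]. apply Rdiv_le_0_compat; lra.
Qed.

(** * Riemann sums of Lipschitz functions *)

Definition lipschitz (L : R) (f : R -> R) : Prop :=
  forall x y, Rabs (f x - f y) <= L * Rabs (x - y).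

Lemma lipschitz_continuous L f : lipschitz L f -> forall x, continuous f x.
Proof. intros H x. now apply continuous_lipschitz with L. Qed.

Lemma lipschitz_mult L M A B f g :
  lipschitz L f -> lipschitz M g -> (forall x, Rabs (f x) <= A) -> (forall x, Rabs (g x) <= B) ->
  lipschitz (L * B + A * M) (fun x => f x * g x).
Proof.
  intros Hf Hg HA HB x y.
  replace (f x * g x - f y * g y) with ((f x - f y) * g x + f y * (g x - g y)) by ring.
  eapply Rle_trans; [apply Rabs_triang|]. rewrite !Rabs_mult, Rmult_plus_distr_r.
  apply Rplus_le_compat.
  - replace (L * B * Rabs (x - y)) with (L * Rabs (x - y) * B) by ring.
    apply Rmult_le_compat; try apply Rabs_pos; [apply Hf|apply HB].
  - rewrite Rmult_assoc. apply Rmult_le_compat; try apply Rabs_pos; [apply HA|apply Hg].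
Qed.

Lemma riemann_cell f L a e :
  0 <= e -> lipschitz L f -> Rabs (e * f a - RInt f a (a + e)) <= L * e * e.
Proof.
  intros He HL.
  pose proof (lipschitz_continuous L f HL) as Hc.
  assert (HL0 : 0 <= L).
  { pose proof (HL 1 0) as H. rewrite Rminus_0_r, Rabs_R1 in H.
    pose proof (Rabs_pos (f 1 - f 0)). lra. }
  assert (HE : forall c : R, RInt (fun _ => c) a (a + e) = e * c).
  { intros c. rewrite RInt_const. unfold scal; simpl; unfold mult; simpl. ring. }
  assert (Hb : forall x, a < x < a + e -> f a - L * e <= f x <= f a + L * e).
  { intros x Hx. pose proof (HL x a) as H. rewrite (Rabs_pos_eq (x - a)) in H by lra.
    apply Rabs_le_between in H. assert (L * (x - a) <= L * e) by (apply Rmult_le_compat_l; lra). lra. }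
  assert (H1 : RInt (fun _ => f a - L * e) a (a + e) <= RInt f a (a + e)).
  { apply RInt_le; [lra|apply ex_RInt_const|now apply ex_RInt_cont|]. intros x Hx. now apply Hb. }
  assert (H2 : RInt f a (a + e) <= RInt (fun _ => f a + L * e) a (a + e)).
  { apply RInt_le; [lra|now apply ex_RInt_cont|apply ex_RInt_const|]. intros x Hx. now apply Hb. }
  rewrite HE in H1, H2. apply Rabs_le. lra.
Qed.

Lemma riemann_sum f L a e N :
  0 <= e -> lipschitz L f ->
  Rabs (e * rsum N (fun i => f (a + e * INR i)) - RInt f a (a + e * INR N)) <= L * e * e * INR N.
Proof.
  intros He HL. pose proof (lipschitz_continuous L f HL) as Hc.
  induction N as [|N IH].
  - simpl. rewrite !Rmult_0_r, Rplus_0_r, RInt_point. unfold zero; simpl.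
    rewrite Rminus_0_r, Rabs_R0. lra.
  - rewrite S_INR. simpl rsum.
    rewrite <- (RInt_Chasles f a (a + e * INR N)) by now apply ex_RInt_cont.
    pose proof (riemann_cell f L (a + e * INR N) e He HL) as Hcell.
    replace (a + e * (INR N + 1)) with (a + e * INR N + e) by ring.
    apply Rabs_le_between in IH. apply Rabs_le_between in Hcell.
    unfold plus; simpl. apply Rabs_le. lra.
Qed.

Lemma RInt_support (f : R -> R) R0 a b :
  0 < R0 -> (forall y, continuous f y) -> (forall y, R0 <= Rabs y -> f y = 0) ->
  a <= - R0 -> R0 <= b -> RInt f a b = RInt f (- R0) R0.
Proof.
  intros HR Hc Hz Ha Hb.
  rewrite <- (RInt_Chasles f a (- R0) b) by now apply ex_RInt_cont.
  rewrite (proj2 (RInt_tail f R0 b HR Hc Hz) Hb).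
  rewrite (RInt_zero f a (- R0)); [unfold plus; simpl; ring|].
  intros x Hx. rewrite Rmin_left, Rmax_right in Hx by lra.
  apply Hz. rewrite Rabs_left1; lra.
Qed.

Lemma green_lip ka om x : 0 < ka -> 0 < om -> lipschitz (/ (4 * ka * om)) (fun y => green ka om (x - y)).
Proof.
  intros Hk Ho y z. eapply Rle_trans; [now apply green_lipschitz|].
  right. f_equal. rewrite Rabs_minus_sym. f_equal. ring.
Qed.

Lemma convolution_eq_RInt (ka om R0 : R) (H : R -> R) (x : R) :
  0 < ka -> 0 < om -> 0 < R0 -> (forall x, continuous H x) -> (forall y, R0 <= Rabs y -> H y = 0) ->
  convolution ka om R0 H 0 x = RInt (fun y => green ka om (x - y) * H y) (- R0) R0.
Proof.
  intros Hk Ho HR HH Hz.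
  set (f := fun y => green ka om (x - y) * H y).
  assert (Hf : forall y, continuous f y).
  { intros y. apply continuous_Rmult; [|apply HH].
    apply (lipschitz_continuous (/ (4 * ka * om)) (fun y => green ka om (x - y))). now apply green_lip. }
  set (T := Rabs x + R0).
  pose proof (convolution_RInt ka om R0 H x T Hk Ho HR HH Hz ltac:(unfold T; lra)) as E.
  rewrite <- (is_RInt_unique (V := R_CompleteNormedModule) _ _ _ _ E).
  rewrite <- (RInt_support f R0 (1 * (- T) + x) (1 * T + x)); try easy.
  - rewrite <- (RInt_comp_lin f 1 x (- T) T) by now apply ex_RInt_cont.
    apply RInt_ext. intros s _. unfold scal; simpl; unfold mult; simpl. unfold f.
    rewrite <- green_even. rewrite !Rmult_1_l. f_equal; f_equal; ring.
  - intros y Hy. unfold f. now rewrite Hz, Rmult_0_r.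
  - unfold T. pose proof (Rle_abs x). lra.
  - unfold T. pose proof (Rle_abs (- x)). rewrite Rabs_Ropp in *. lra.
Qed.

(** * The mesh *)

(** The period has length about [2 s].  The exponents make
    [period length ^ 2 * mesh] tend to zero, as the error of the double Riemann sum
    over a period requires. *)
Definition mesh (s : nat) : R := / INR s ^ 3.
Definition half_period (s : nat) : nat := (s ^ 4)%nat.

Lemma mesh_pos s : (0 < s)%nat -> 0 < mesh s.
Proof. intros Hs. apply Rinv_0_lt_compat, pow_lt. now apply lt_0_INR. Qed.

Lemma mesh_half_period s : (0 < s)%nat -> mesh s * INR (half_period s) = INR s.
Proof.
  intros Hs. unfold mesh, half_period. rewrite pow_INR. field.
  apply not_0_INR. lia.
Qed.

Lemma mesh_window s T : (0 < s)%nat -> mesh s * INR (T * s ^ 3) = INR T.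
Proof.
  intros Hs. unfold mesh. rewrite mult_INR, pow_INR. field.
  apply not_0_INR. lia.
Qed.

Lemma mesh_le_inv s : (0 < s)%nat -> mesh s <= / INR s.
Proof.
  intros Hs. unfold mesh. assert (1 <= INR s) by (apply (le_INR 1); lia).
  apply Rinv_le_contravar; [lra|]. simpl. rewrite Rmult_1_r.
  assert (1 <= INR s * INR s) by nra. nra.
Qed.

Lemma mesh_le_1 s : (0 < s)%nat -> mesh s <= 1.
Proof.
  intros Hs. eapply Rle_trans; [now apply mesh_le_inv|].
  assert (1 <= INR s) by (apply (le_INR 1); lia).
  rewrite <- Rinv_1. apply Rinv_le_contravar; lra.
Qed.

Lemma mesh_period s :
  (0 < s)%nat -> mesh s * INR (2 * half_period s + 1) <= 3 * INR s /\
  mesh s * mesh s * INR (2 * half_period s + 1) <= 3 * (/ INR s * / INR s).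
Proof.
  intros Hs. pose proof (mesh_half_period s Hs) as E. pose proof (mesh_le_1 s Hs).
  pose proof (mesh_pos s Hs).
  assert (H1 : 1 <= INR s) by (apply (le_INR 1); lia).
  assert (A : mesh s * INR (2 * half_period s + 1) <= 3 * INR s).
  { rewrite plus_INR, mult_INR. simpl (INR 2). simpl (INR 1). nra. }
  split; [easy|]. rewrite Rmult_assoc.
  apply Rle_trans with (mesh s * (3 * INR s)); [apply Rmult_le_compat_l; lra|].
  right. unfold mesh. field. lra.
Qed.

(** The normalised samples of [H] have, up to Riemann sum errors, the energy of [H]
    divided by the square of its mass. *)
Lemma discrete_energy_lower_bound (ka om th R0 L : R) (H : R -> R) :
  0 < ka -> 0 < om -> 0 < th -> 0 < R0 -> 0 <= L ->
  (forall x, 0 <= H x) -> lipschitz L H -> (forall x, R0 <= Rabs x -> H x = 0) ->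
  0 < RInt (fun x => H x * convolution ka om R0 H 0 x - th * H x ^ 2) (- R0) R0 ->
  exists mu0 s0, 0 < mu0 /\ (0 < s0)%nat /\ forall s, (s0 <= s)%nat ->
    exists p, in_simplex (2 * half_period s + 1) p /\
      mu0 <= qform (2 * half_period s + 1) (energy_matrix ka om th (mesh s) (half_period s)) p.
Proof.
  intros Hk Ho Hth HR HL0 Hpos HL Hz HI.
  pose proof (lipschitz_continuous L H HL) as Hc.
  set (W := convolution ka om R0 H 0) in *.
  set (C0 := green_bound ka om). set (LK := / (4 * ka * om)).
  assert (HC0 : 0 < C0) by now apply green_bound_pos.
  assert (HLK : 0 < LK).
  { apply Rinv_0_lt_compat. apply Rmult_lt_0_compat; lra. }
  set (B := L * (2 * R0)).
  assert (HB0 : 0 <= B) by (unfold B; apply Rmult_le_pos; lra).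
  assert (HB : forall x, Rabs (H x) <= B).
  { intros x. destruct (Rle_dec R0 (Rabs x)) as [Hx|Hx].
    - now rewrite Hz, Rabs_R0.
    - pose proof (HL x R0) as Hl. rewrite (Hz R0), Rminus_0_r in Hl by (rewrite Rabs_pos_eq; lra).
      eapply Rle_trans; [apply Hl|]. unfold B. apply Rmult_le_compat_l; [easy|].
      apply Rnot_le_lt, Rabs_def2 in Hx. apply Rabs_le. lra. }
  assert (HB' : forall x, H x <= B) by (intros x; eapply Rle_trans; [apply Rle_abs|apply HB]).
  set (L1 := LK * B + C0 * L).
  assert (HL1 : 0 <= L1).
  { unfold L1. apply Rplus_le_le_0_compat; apply Rmult_le_pos; lra. }
  assert (Hf : forall x, lipschitz L1 (fun y => green ka om (x - y) * H y)).
  { intros x. apply lipschitz_mult; [now apply green_lip|easy| |apply HB].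
    intros y. now apply green_le. }
  assert (HW : forall x, W x = RInt (fun y => green ka om (x - y) * H y) (- R0) R0).
  { intros x. now apply convolution_eq_RInt. }
  assert (HWL : lipschitz (2 * R0 * (LK * B)) W).
  { intros x y. rewrite !HW.
    pose proof (RInt_minus (V := R_CompleteNormedModule) (fun z => green ka om (x - z) * H z)
      (fun z => green ka om (y - z) * H z) (- R0) R0
      (ex_RInt_cont _ _ _ (lipschitz_continuous _ _ (Hf x)))
      (ex_RInt_cont _ _ _ (lipschitz_continuous _ _ (Hf y)))) as E.
    unfold minus, plus, opp in E; simpl in E. unfold Rminus at 1. rewrite <- E.
    replace (2 * R0 * (LK * B) * Rabs (x - y)) with ((R0 - - R0) * (LK * B * Rabs (x - y))) by ring.
    apply abs_RInt_le_const; [lra| |].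
    - apply ex_RInt_cont. intros z. apply (continuous_plus (V := R_NormedModule)).
      + apply (lipschitz_continuous _ _ (Hf x)).
      + apply (continuous_opp (V := R_NormedModule)), (lipschitz_continuous _ _ (Hf y)).
    - intros z _.
      replace (green ka om (x - z) * H z + - (green ka om (y - z) * H z))
        with ((green ka om (x - z) - green ka om (y - z)) * H z) by ring.
      rewrite Rabs_mult. replace (LK * B * Rabs (x - y)) with (LK * Rabs (x - y) * B) by ring.
      apply Rmult_le_compat; try apply Rabs_pos; [|apply HB].
      eapply Rle_trans; [now apply green_lipschitz|]. right. unfold LK. f_equal. f_equal. ring. }
  assert (HWB : forall x, Rabs (W x) <= 2 * R0 * (C0 * B)).
  { intros x. rewrite HW. replace (2 * R0 * (C0 * B)) with ((R0 - - R0) * (C0 * B)) by ring.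
    apply abs_RInt_le_const; [lra| |].
    - apply ex_RInt_cont, (lipschitz_continuous _ _ (Hf x)).
    - intros z _. rewrite Rabs_mult. apply Rmult_le_compat; try apply Rabs_pos; [|apply HB].
      now apply green_le. }
  set (G := fun x => H x * W x - th * H x ^ 2) in *.
  set (LG := (L * (2 * R0 * (C0 * B)) + B * (2 * R0 * (LK * B))) + th * (L * B + B * L)).
  assert (HLG : lipschitz LG G).
  { intros x y. unfold G.
    replace (H x * W x - th * H x ^ 2 - (H y * W y - th * H y ^ 2))
      with ((H x * W x - H y * W y) + - (th * (H x * H x - H y * H y))) by ring.
    eapply Rle_trans; [apply Rabs_triang|]. rewrite Rabs_Ropp, Rabs_mult, (Rabs_pos_eq th) by lra.
    unfold LG. rewrite Rmult_plus_distr_r. apply Rplus_le_compat.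
    - apply (lipschitz_mult L _ B _ H W HL HWL HB HWB).
    - rewrite Rmult_assoc. apply Rmult_le_compat_l; [lra|].
      apply (lipschitz_mult L L B B H H HL HL HB HB). }
  assert (HLG0 : 0 <= LG).
  { pose proof (HLG 1 0) as E. rewrite Rminus_0_r, Rabs_R1 in E.
    pose proof (Rabs_pos (G 1 - G 0)). lra. }
  set (I := RInt G (- R0) R0) in *. set (m1 := RInt H (- R0) R0 + 3 * L + 1).
  assert (HIH : 0 <= RInt H (- R0) R0).
  { apply RInt_ge_0; [lra|now apply ex_RInt_cont|]. intros; apply Hpos. }
  set (Q := 3 * LG + 9 * B * L1).
  assert (HQ : 0 <= Q).
  { unfold Q. assert (0 <= B * L1) by (now apply Rmult_le_pos). lra. }
  destruct (nfloor_ex (2 * R0 + 2 * Q / I)) as [n Hn].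
  { apply Rplus_le_le_0_compat; [lra|]. apply Rdiv_le_0_compat; lra. }
  exists (I / 2 / (m1 * m1)), (S n).
  assert (Hm1 : 0 < m1) by (unfold m1; lra).
  split.
  { apply Rdiv_lt_0_compat; [lra|]. nra. }
  split; [lia|].
  intros s Hs.
  assert (Hs0 : (0 < s)%nat) by lia.
  assert (HsR : 2 * R0 + 2 * Q / I <= INR s).
  { apply le_INR in Hs. rewrite S_INR in Hs. lra. }
  assert (Hs1 : 1 <= INR s) by (apply (le_INR 1); lia).
  assert (HQI : 0 <= 2 * Q / I) by (apply Rdiv_le_0_compat; lra).
  set (e := mesh s). set (P := half_period s). set (N := (2 * P + 1)%nat).
  pose proof (mesh_pos s Hs0) as He. fold e in He.
  pose proof (mesh_half_period s Hs0) as HeP. fold e P in HeP.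
  destruct (mesh_period s Hs0) as [HeN HeeN]. fold e P in HeN, HeeN. fold N in HeN, HeeN.
  set (a := - (e * INR P)).
  set (X := fun i => a + e * INR i).
  assert (HXend : a + e * INR N = e * INR P + e).
  { unfold a, N. rewrite plus_INR, mult_INR. simpl (INR 2). simpl (INR 1). ring. }
  assert (Hsup : forall f : R -> R, (forall y, continuous f y) -> (forall y, R0 <= Rabs y -> f y = 0) ->
     RInt f a (a + e * INR N) = RInt f (- R0) R0).
  { intros f Hfc Hfz. apply RInt_support; try easy; rewrite ?HXend; unfold a; rewrite HeP; lra. }
  set (inner := fun x => e * rsum N (fun j => green ka om (x - X j) * H (X j))).
  assert (Hinner : forall x, Rabs (inner x - W x) <= L1 * e * e * INR N).
  { intros x. rewrite HW.
    rewrite <- (Hsup (fun y => green ka om (x - y) * H y)).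
    - apply (riemann_sum (fun y => green ka om (x - y) * H y) L1 a e N); [lra|apply Hf].
    - apply (lipschitz_continuous _ _ (Hf x)).
    - intros y Hy. now rewrite Hz, Rmult_0_r. }
  assert (HG : Rabs (e * rsum N (fun i => G (X i)) - I) <= LG * e * e * INR N).
  { unfold I. rewrite <- (Hsup G).
    - apply (riemann_sum G LG a e N); [lra|easy].
    - apply (lipschitz_continuous _ _ HLG).
    - intros y Hy. unfold G. rewrite Hz by easy. ring. }
  set (mass := e * rsum N (fun i => H (X i))).
  assert (Hmass : mass <= m1).
  { assert (E : Rabs (mass - RInt H (- R0) R0) <= L * e * e * INR N).
    { rewrite <- (Hsup H); try easy. apply (riemann_sum H L a e N); [lra|easy]. }
    apply Rabs_le_between in E. unfold m1.
    assert (L * e * e * INR N <= 3 * L); [|lra].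
    replace (L * e * e * INR N) with (L * (e * e * INR N)) by ring.
    rewrite (Rmult_comm 3). apply Rmult_le_compat_l; [easy|].
    assert (0 < / INR s <= 1).
    { split; [apply Rinv_0_lt_compat; lra|]. rewrite <- Rinv_1. apply Rinv_le_contravar; lra. }
    assert (/ INR s * / INR s <= 1) by nra. lra. }
  assert (HmassN : mass <= B * (3 * INR s)).
  { unfold mass. apply Rle_trans with (e * (INR N * B)).
    - apply Rmult_le_compat_l; [lra|]. rewrite <- rsum_const. apply rsum_le. intros; apply HB'.
    - replace (e * (INR N * B)) with (B * (e * INR N)) by ring. now apply Rmult_le_compat_l. }
  assert (Hmass0 : 0 <= mass).
  { apply Rmult_le_pos; [lra|]. apply rsum_nonneg. intros; apply Hpos. }
  set (S := e * rsum N (fun i => H (X i) * inner (X i) - th * H (X i) ^ 2)).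
  assert (HS : I / 2 <= S).
  { assert (HS1 : e * rsum N (fun i => G (X i)) - mass * (L1 * e * e * INR N) <= S).
    { unfold mass. rewrite Rmult_assoc, <- Rmult_minus_distr_l. apply Rmult_le_compat_l; [lra|].
      rewrite (Rmult_comm (rsum N (fun i => H (X i)))), <- rsum_scal, <- rsum_minus. apply rsum_le.
      intros i _. unfold G. specialize (Hinner (X i)). apply Rabs_le_between in Hinner.
      specialize (Hpos (X i)). nra. }
    apply Rabs_le_between in HG.
    set (d := / INR s) in *.
    assert (Hds : d * INR s = 1) by (unfold d; field; lra).
    assert (Z1 : LG * e * e * INR N <= 3 * LG * d).
    { replace (LG * e * e * INR N) with (LG * (e * e * INR N)) by ring.
      apply Rle_trans with (LG * (3 * (d * d))); [now apply Rmult_le_compat_l|].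
      assert (d * d <= d) by nra. nra. }
    assert (Z2 : mass * (L1 * e * e * INR N) <= 9 * B * L1 * d).
    { replace (L1 * e * e * INR N) with (L1 * (e * e * INR N)) by ring.
      apply Rle_trans with (B * (3 * INR s) * (L1 * (3 * (d * d)))).
      - apply Rmult_le_compat; try easy.
        + apply Rmult_le_pos; [easy|]. apply Rmult_le_pos; [nra|apply pos_INR].
        + now apply Rmult_le_compat_l.
      - replace (B * (3 * INR s) * (L1 * (3 * (d * d)))) with (9 * B * L1 * d * (d * INR s)) by ring.
        rewrite Hds. lra. }
    assert (Z3 : Q * d <= I / 2).
    { apply Rmult_le_reg_r with (INR s); [lra|]. rewrite Rmult_assoc, Hds, Rmult_1_r.
      apply Rle_trans with (I / 2 * (2 * Q / I)); [right; field; lra|].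
      apply Rmult_le_compat_l; lra. }
    unfold Q in Z3. lra. }
  assert (Hmpos : 0 < mass).
  { destruct Hmass0 as [|E0]; [easy|exfalso].
    assert (HH0 : forall i, (i < N)%nat -> H (X i) = 0).
    { intros i Hi. apply Rle_antisym; [|apply Hpos].
      pose proof (rsum_term_le N (fun i => H (X i)) i (fun i _ => Hpos _) Hi) as T. simpl in T.
      unfold mass in E0. nra. }
    assert (S = 0); [|lra].
    unfold S. rewrite (rsum_ext N _ (fun _ => 0)).
    - rewrite rsum_const. ring.
    - intros i Hi. rewrite HH0 by easy. ring. }
  exists (fun i => e * H (X i) / mass). split.
  { split.
    - intros i. apply Rdiv_le_0_compat; [|easy]. apply Rmult_le_pos; [lra|apply Hpos].
    - rewrite (rsum_ext N _ (fun i => / mass * (e * H (X i)))) by (intros; field; lra).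
      rewrite !rsum_scal. fold mass. field. lra. }
  assert (HE : qform N (energy_matrix ka om th e P) (fun i => e * H (X i) / mass) = S / (mass * mass)).
  { unfold qform, S. replace (e * rsum N (fun i => H (X i) * inner (X i) - th * H (X i) ^ 2) / (mass * mass))
      with (/ (mass * mass) * (e * rsum N (fun i => H (X i) * inner (X i) - th * H (X i) ^ 2)))
      by (field; lra).
    rewrite <- !rsum_scal. apply rsum_ext. intros i Hi.
    destruct (Req_dec (H (X i)) 0) as [E0|E0]; [rewrite E0; field; lra|].
    assert (HXi : forall j, H (X j) <> 0 -> Rabs (X j) < R0).
    { intros j Hj. apply Rnot_le_lt. intros Hle. apply Hj. now apply Hz. }
    assert (Hrow : rsum N (fun j => energy_matrix ka om th e P i j * (e * H (X j) / mass))
       = / mass * (inner (X i) - th * H (X i))).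
    { unfold inner. replace (th * H (X i)) with (th / e * (e * H (X i))) by (field; lra).
      rewrite <- (rsum_delta N i (fun j => th / e * (e * H (X j))) Hi), <- rsum_scal.
      rewrite <- rsum_minus, <- rsum_scal. apply rsum_ext. intros j Hj.
      destruct (Req_dec (H (X j)) 0) as [F0|F0].
      { rewrite F0. destruct (Nat.eq_dec j i); field; lra. }
      pose proof (HXi i E0) as Bi. pose proof (HXi j F0) as Bj.
      assert (Hclose : (Z.abs (Z.of_nat i - Z.of_nat j) <= Z.of_nat P)%Z).
      { apply le_IZR. rewrite abs_IZR, minus_IZR, <- !INR_IZR_INZ.
        apply Rmult_le_reg_l with e; [easy|]. rewrite HeP.
        rewrite <- (Rabs_pos_eq e) at 1 by lra. rewrite <- Rabs_mult.
        replace (e * (INR i - INR j)) with (X i - X j) by (unfold X; ring).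
        apply Rabs_def2 in Bi. apply Rabs_def2 in Bj. apply Rabs_le. lra. }
      unfold energy_matrix, cyclic_green. rewrite cyclic_dist_small by easy.
      rewrite abs_IZR, minus_IZR, <- !INR_IZR_INZ.
      replace (green ka om (e * Rabs (INR i - INR j))) with (green ka om (X i - X j)).
      - destruct (Nat.eq_dec i j) as [E|E]; destruct (Nat.eq_dec j i) as [E'|E'];
          [field; lra|lia|lia|field; lra].
      - unfold green. f_equal. replace (X i - X j) with (e * (INR i - INR j)) by (unfold X; ring).
        rewrite !Rabs_mult, Rabs_Rabsolu. easy. }
    rewrite Hrow. field. lra. }
  rewrite HE. unfold Rdiv. apply Rmult_le_compat; try lra.
  - apply Rlt_le, Rinv_0_lt_compat. nra.
  - apply Rinv_le_contravar; nra.
Qed.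

(** * Passage to the limit *)

Lemma geometric_step ka e :
  0 < ka -> 0 < e <= 1 -> e <= (1 + ka) / ka * (1 - exp (- ka * e)).
Proof.
  intros Hk He.
  assert (H1 : exp (- ka * e) <= / (1 + ka * e)).
  { replace (- ka * e) with (- (ka * e)) by ring. rewrite exp_Ropp.
    apply Rinv_le_contravar; [nra|]. apply Rlt_le, exp_ineq1. nra. }
  apply Rle_trans with ((1 + ka) / ka * (1 - / (1 + ka * e))).
  - replace ((1 + ka) / ka * (1 - / (1 + ka * e))) with (e * ((1 + ka) / (1 + ka * e))) by (field; nra).
    rewrite <- (Rmult_1_r e) at 1. apply Rmult_le_compat_l; [lra|].
    apply Rmult_le_reg_r with (1 + ka * e); [nra|].
    replace ((1 + ka) / (1 + ka * e) * (1 + ka * e)) with (1 + ka) by (field; nra). nra.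
  - apply Rmult_le_compat_l; [|lra]. apply Rdiv_le_0_compat; lra.
Qed.

Lemma geometric_down ka e K q :
  0 < ka -> 0 < e <= 1 ->
  e * rsum q (fun i => exp (- ka * (e * (K + INR i)))) <= (1 + ka) / ka * exp (- ka * (e * K)).
Proof.
  intros Hk He.
  assert (HG : 0 < (1 + ka) / ka) by (apply Rdiv_lt_0_compat; lra).
  assert (Hs : e * rsum q (fun i => exp (- ka * (e * (K + INR i))))
     <= (1 + ka) / ka * (exp (- ka * (e * K)) - exp (- ka * (e * (K + INR q))))).
  { induction q as [|q IH].
    - simpl. rewrite Rplus_0_r. lra.
    - rewrite S_INR. simpl rsum.
      replace (exp (- ka * (e * (K + (INR q + 1))))) with
        (exp (- ka * (e * (K + INR q))) * exp (- ka * e)) by (rewrite <- exp_plus; f_equal; ring).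
      pose proof (exp_pos (- ka * (e * (K + INR q)))) as Hp.
      pose proof (Rmult_le_compat_r _ _ _ (Rlt_le _ _ Hp) (geometric_step ka e Hk He)). lra. }
  pose proof (exp_pos (- ka * (e * (K + INR q)))). nra.
Qed.

Lemma geometric_up ka e K q :
  0 < ka -> 0 < e <= 1 ->
  e * rsum q (fun i => exp (- ka * (e * (K - INR i)))) <= (1 + ka) / ka * exp (- ka * (e * (K - INR q))).
Proof.
  intros Hk He.
  assert (HG : 0 < (1 + ka) / ka) by (apply Rdiv_lt_0_compat; lra).
  induction q as [|q IH].
  - simpl. rewrite Rmult_0_r. apply Rmult_le_pos; [lra|apply Rlt_le, exp_pos].
  - rewrite S_INR. simpl rsum.
    assert (E : exp (- ka * (e * (K - INR q))) = exp (- ka * (e * (K - (INR q + 1)))) * exp (- ka * e))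
      by (rewrite <- exp_plus; f_equal; ring).
    set (A := exp (- ka * (e * (K - (INR q + 1))))) in *.
    assert (HA : 0 < A) by apply exp_pos.
    rewrite E in *.
    pose proof (Rmult_le_compat_r _ _ _ (Rlt_le _ _ HA) (geometric_step ka e Hk He)).
    assert (e * (A * exp (- ka * e)) <= e * A) by nra. lra.
Qed.

(** The Green function decays exponentially, so the two parts of the period outside a
    centred window contribute geometric series.  The empty window [Q = 0] bounds the
    whole potential by the maximum of the density. *)
Lemma potential_tail ka om e P Q (g : nat -> R) B :
  0 < ka -> 0 < om -> 0 < e <= 1 -> (Q <= P)%nat -> (forall m, Rabs (g m) <= B) ->
  Rabs (e * rsum (2 * P + 1) (fun m => green ka om (e * (INR m - INR P)) * g m)
    - e * rsum (2 * Q) (fun i => green ka om (e * (INR i - INR Q)) * g (P - Q + i)%nat))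
  <= 2 * B * (green_bound ka om * ((1 + ka) / ka)) * exp (- ka * (e * INR Q)).
Proof.
  intros Hk Ho He HQ Hg.
  set (C0 := green_bound ka om). set (G := (1 + ka) / ka).
  assert (HC0 : 0 < C0) by now apply green_bound_pos.
  assert (HB : 0 <= B) by (eapply Rle_trans; [apply Rabs_pos|apply (Hg 0%nat)]).
  replace (2 * P + 1)%nat with ((P - Q) + (2 * Q + (P - Q + 1)))%nat by lia.
  rewrite (rsum_add (P - Q)), (rsum_add (2 * Q)). cbv beta.
  assert (HPQ : INR (P - Q) = INR P - INR Q) by now apply minus_INR.
  rewrite (rsum_ext (2 * Q) (fun i => green ka om (e * (INR (P - Q + i) - INR P)) * g (P - Q + i)%nat)
    (fun i => green ka om (e * (INR i - INR Q)) * g (P - Q + i)%nat)).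
  2:{ intros i _. do 2 f_equal. rewrite plus_INR, HPQ. ring. }
  set (S1 := rsum (P - Q) _). set (S2 := rsum (2 * Q) _). set (S3 := rsum (P - Q + 1) _).
  replace (e * (S1 + (S2 + S3)) - e * S2) with (e * S1 + e * S3) by ring.
  assert (Hterm : forall x y, Rabs y <= B -> Rabs (green ka om x * y) <= B * C0 * exp (- ka * Rabs x)).
  { intros x y Hy. rewrite Rabs_mult.
    replace (B * C0 * exp (- ka * Rabs x)) with (C0 * exp (- ka * Rabs x) * B) by ring.
    apply Rmult_le_compat; try apply Rabs_pos; [|easy]. now apply green_decay. }
  assert (H1 : Rabs (e * S1) <= B * (C0 * G) * exp (- ka * (e * INR Q))).
  { rewrite Rabs_mult, (Rabs_pos_eq e) by lra.
    apply Rle_trans with (e * rsum (P - Q) (fun i => B * C0 * exp (- ka * (e * (INR P - INR i))))).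
    - apply Rmult_le_compat_l; [lra|]. eapply Rle_trans; [apply rsum_abs|]. apply rsum_le.
      intros i Hi. eapply Rle_trans; [apply Hterm, Hg|].
      apply lt_INR in Hi. pose proof (pos_INR Q).
      rewrite Rabs_left1 by (rewrite HPQ in Hi; nra). right. do 2 f_equal. ring.
    - rewrite rsum_scal.
      replace (e * (B * C0 * rsum (P - Q) (fun i => exp (- ka * (e * (INR P - INR i))))))
        with (B * C0 * (e * rsum (P - Q) (fun i => exp (- ka * (e * (INR P - INR i)))))) by ring.
      replace (B * (C0 * G) * exp (- ka * (e * INR Q))) with (B * C0 * (G * exp (- ka * (e * INR Q)))) by ring.
      apply Rmult_le_compat_l; [apply Rmult_le_pos; lra|].
      eapply Rle_trans; [now apply geometric_up|]. right. unfold G. do 4 f_equal. rewrite HPQ. ring. }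
  assert (H3 : Rabs (e * S3) <= B * (C0 * G) * exp (- ka * (e * INR Q))).
  { rewrite Rabs_mult, (Rabs_pos_eq e) by lra.
    apply Rle_trans with (e * rsum (P - Q + 1) (fun i => B * C0 * exp (- ka * (e * (INR Q + INR i))))).
    - apply Rmult_le_compat_l; [lra|]. eapply Rle_trans; [apply rsum_abs|]. apply rsum_le.
      intros i Hi. eapply Rle_trans; [apply Hterm, Hg|].
      right. do 3 f_equal. rewrite !plus_INR, mult_INR, HPQ. simpl (INR 2).
      pose proof (pos_INR Q). pose proof (pos_INR i).
      rewrite Rabs_pos_eq; [ring|]. apply Rmult_le_pos; lra.
    - rewrite rsum_scal.
      replace (e * (B * C0 * rsum (P - Q + 1) (fun i => exp (- ka * (e * (INR Q + INR i))))))
        with (B * C0 * (e * rsum (P - Q + 1) (fun i => exp (- ka * (e * (INR Q + INR i)))))) by ring.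
      replace (B * (C0 * G) * exp (- ka * (e * INR Q))) with (B * C0 * (G * exp (- ka * (e * INR Q)))) by ring.
      apply Rmult_le_compat_l; [apply Rmult_le_pos; lra|]. now apply geometric_down. }
  eapply Rle_trans; [apply Rabs_triang|]. lra.
Qed.

Lemma weighted_sum_limit (k H : R -> R) (F : nat -> R -> R) (e ed : nat -> R) (q : nat -> nat)
    (Lk K L C T a x : R) :
  lipschitz Lk k -> (forall s, Rabs (k s) <= K) ->
  lipschitz L H -> (forall s, Rabs (H s) <= C) -> 0 < L ->
  (forall n y z, Rabs (F n y - F n z) <= L * Rabs (y - z) + ed n) ->
  is_lim_seq ed 0 ->
  (forall y, is_lim_seq (fun n => F n y) (H y)) ->
  (forall n, 0 < e n) -> is_lim_seq e 0 -> (forall n, e n * INR (q n) = T) ->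
  is_lim_seq (fun n => e n * rsum (q n) (fun i => k (a + e n * INR i) * F n (x + (a + e n * INR i))))
    (RInt (fun s => k s * H (x + s)) a (a + T)).
Proof.
  intros Hk HK HL HC HL0 HF Hed Hlim He He0 HT.
  assert (HT0 : 0 <= T).
  { rewrite <- (HT 0%nat). apply Rmult_le_pos; [apply Rlt_le, He|apply pos_INR]. }
  assert (HK0 : 0 <= K) by (eapply Rle_trans; [apply Rabs_pos|apply (HK 0)]).
  set (f := fun s => k s * H (x + s)). set (L' := Lk * C + K * L).
  assert (Hf : lipschitz L' f).
  { apply lipschitz_mult; try easy.
    intros y z. eapply Rle_trans; [apply HL|]. right. do 2 f_equal. ring. }
  apply is_lim_seq_spec. intros [ep Hep]. simpl.
  assert (HKT : 0 < T * K + 1) by nra.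
  set (eta := ep / 2 / (T * K + 1)).
  assert (Heta : 0 < eta) by (apply Rdiv_lt_0_compat; lra).
  destruct (uniform_of_pointwise (fun y => Rabs y <= Rabs x + Rabs a + T) F H L ed
    (Rabs x + Rabs a + T) HL0 (fun n y z _ _ => HF n y z) Hed (fun y _ => Hlim y)
    (fun y Hy => Hy) eta Heta) as [N1 HN1].
  apply is_lim_seq_spec in He0.
  assert (HL'0 : 0 <= L').
  { pose proof (Hf 1 0) as E. rewrite Rminus_0_r, Rabs_R1 in E.
    pose proof (Rabs_pos (f 1 - f 0)). lra. }
  assert (HLT : 0 < L' * T + 1) by nra.
  assert (Hd : 0 < ep / 2 / (L' * T + 1)) by (apply Rdiv_lt_0_compat; lra).
  destruct (He0 (mkposreal _ Hd)) as [N2 HN2]. simpl in HN2.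
  exists (N1 + N2)%nat. intros n Hn.
  specialize (HN1 n ltac:(lia)). specialize (HN2 n ltac:(lia)).
  rewrite Rminus_0_r, Rabs_pos_eq in HN2 by apply Rlt_le, He.
  pose proof (He n) as Hen. specialize (HT n).
  pose proof (riemann_sum f L' a (e n) (q n) (Rlt_le _ _ Hen) Hf) as Hr. rewrite HT in Hr.
  assert (Hr2 : L' * e n * e n * INR (q n) <= L' * T * (ep / 2 / (L' * T + 1))).
  { replace (L' * e n * e n * INR (q n)) with (L' * (e n * INR (q n)) * e n) by ring. rewrite HT.
    apply Rmult_le_compat_l; [nra|lra]. }
  assert (Hr3 : L' * T * (ep / 2 / (L' * T + 1)) < ep / 2).
  { apply Rmult_lt_reg_r with (L' * T + 1); [easy|].
    replace (L' * T * (ep / 2 / (L' * T + 1)) * (L' * T + 1)) with (L' * T * (ep / 2)) by (field; lra). nra. }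
  assert (Hs : Rabs (e n * rsum (q n) (fun i => k (a + e n * INR i) * F n (x + (a + e n * INR i)))
     - e n * rsum (q n) (fun i => f (a + e n * INR i))) <= T * (K * eta)).
  { rewrite <- Rmult_minus_distr_l, <- rsum_minus, Rabs_mult, (Rabs_pos_eq (e n)) by lra.
    rewrite <- HT, Rmult_assoc. apply Rmult_le_compat_l; [lra|]. apply rsum_abs_le.
    intros i Hi. unfold f. rewrite <- Rmult_minus_distr_l, Rabs_mult.
    apply Rmult_le_compat; try apply Rabs_pos; [apply HK|]. apply HN1.
    assert (Hi2 : 0 <= e n * INR i <= T).
    { split; [apply Rmult_le_pos; [lra|apply pos_INR]|]. rewrite <- HT.
      apply Rmult_le_compat_l; [lra|]. apply le_INR. lia. }
    eapply Rle_trans; [apply Rabs_triang|]. rewrite Rplus_assoc. apply Rplus_le_compat_l.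
    eapply Rle_trans; [apply Rabs_triang|]. rewrite (Rabs_pos_eq (e n * INR i)) by lra. lra. }
  assert (Hs2 : T * (K * eta) <= ep / 2).
  { unfold eta. apply Rmult_le_reg_r with (T * K + 1); [easy|].
    replace (T * (K * (ep / 2 / (T * K + 1))) * (T * K + 1)) with (T * K * (ep / 2)) by (field; lra). nra. }
  apply Rabs_le_between in Hs. apply Rabs_le_between in Hr. apply Rabs_def1; lra.
Qed.

(** A value above [eta] at [x] forces the mass [eta^2 / (4 L)] just to the right of [x],
    more than what is left far away. *)
Lemma lipschitz_integrable_decay (H : R -> R) L :
  0 < L -> lipschitz L H -> (forall x, 0 <= H x) ->
  (forall x (T : nat), RInt H x (x + INR T) <= 1) ->
  forall eta, 0 < eta -> exists X, forall x, X <= x -> H x <= eta.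
Proof.
  intros HL HLip Hpos Hint eta Heta.
  pose proof (lipschitz_continuous L H HLip) as Hc.
  assert (HRc : forall u v, ex_RInt H u v) by (intros; now apply ex_RInt_cont).
  set (G := fun x => RInt H 0 x).
  assert (Hmono : forall x y, x <= y -> RInt H x y = G y - G x /\ 0 <= RInt H x y).
  { intros x y Hxy. split.
    - pose proof (RInt_Chasles H 0 x y (HRc _ _) (HRc _ _)) as E. unfold plus in E; simpl in E.
      unfold G. lra.
    - apply RInt_ge_0; try easy. }
  assert (HG : forall x, G x <= 1).
  { intros x. destruct (nfloor_ex (Rabs x)) as [T HT]; [apply Rabs_pos|].
    specialize (Hint 0 (S T)). rewrite Rplus_0_l, S_INR in Hint.
    pose proof (Rle_abs x). destruct (Hmono x (INR T + 1) ltac:(lra)) as [E1 E2].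
    change (RInt H 0 (INR T + 1)) with (G (INR T + 1)) in Hint. lra. }
  destruct (completeness (fun v => exists x, v = G x)) as [S0 [HS1 HS2]].
  { exists 1. now intros v [x ->]. }
  { exists (G 0). now exists 0. }
  set (d := eta / (2 * L)). assert (Hd : 0 < d) by (apply Rdiv_lt_0_compat; lra).
  assert (HLd : L * d = eta / 2) by (unfold d; field; lra).
  assert (Hex : exists X, S0 - eta * d / 4 < G X).
  { apply NNPP. intros Hno. assert (S0 <= S0 - eta * d / 4); [|nra].
    apply HS2. intros v [x ->]. apply Rnot_lt_le. intros Hlt. apply Hno. now exists x. }
  destruct Hex as [X HX]. exists X. intros x Hx. apply Rnot_lt_le. intros Hlt.
  destruct (Hmono X x Hx) as [E1 E2]. destruct (Hmono x (x + d) ltac:(lra)) as [E3 E4].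
  assert (E5 : G (x + d) <= S0) by (apply HS1; now exists (x + d)).
  assert (E6 : RInt (fun _ => eta / 2) x (x + d) <= RInt H x (x + d)).
  { apply RInt_le; [lra|apply ex_RInt_const|apply HRc|].
    intros y Hy. pose proof (HLip x y) as Hl. rewrite Rabs_left1 with (x - y) in Hl by lra.
    apply Rabs_le_between in Hl. assert (L * - (x - y) <= L * d) by (apply Rmult_le_compat_l; lra). lra. }
  rewrite RInt_const in E6. unfold scal in E6; simpl in E6; unfold mult in E6; simpl in E6. nra.
Qed.

Lemma Int_part_shift r z : Int_part (r + IZR z) = (Int_part r + z)%Z.
Proof.
  symmetry. apply Int_part_spec. rewrite plus_IZR. pose proof (base_Int_part r). lra.
Qed.

Lemma step_lipschitz (f : Z -> R) c :
  (forall z, Rabs (f (z + 1)%Z - f z) <= c) ->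
  forall y z, Rabs (f y - f z) <= c * Rabs (IZR y - IZR z).
Proof.
  intros Hf.
  assert (H : forall n z, Rabs (f (z + Z.of_nat n)%Z - f z) <= c * INR n).
  { induction n as [|n IH]; intros z.
    - rewrite Z.add_0_r, Rminus_diag, Rabs_R0. simpl. lra.
    - rewrite S_INR. specialize (IH z). specialize (Hf (z + Z.of_nat n)%Z).
      replace (z + Z.of_nat (S n))%Z with (z + Z.of_nat n + 1)%Z by lia.
      apply Rabs_le_between in IH. apply Rabs_le_between in Hf. apply Rabs_le. lra. }
  intros y z. destruct (Z.le_gt_cases z y) as [Hyz|Hyz].
  - specialize (H (Z.to_nat (y - z)) z). rewrite Z2Nat.id in H by lia.
    replace (z + (y - z))%Z with y in H by ring.
    rewrite INR_IZR_INZ, Z2Nat.id, minus_IZR in H by lia.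
    rewrite (Rabs_pos_eq (IZR y - IZR z)); [easy|]. apply IZR_le in Hyz. lra.
  - specialize (H (Z.to_nat (z - y)) y). rewrite Z2Nat.id in H by lia.
    replace (y + (z - y))%Z with z in H by ring.
    rewrite INR_IZR_INZ, Z2Nat.id, minus_IZR in H by lia.
    rewrite Rabs_minus_sym, (Rabs_minus_sym (IZR y)), (Rabs_pos_eq (IZR z - IZR y)); [easy|].
    apply IZR_lt in Hyz. lra.
Qed.

Lemma step_function_lipschitz (f : Z -> R) c e :
  0 < e -> (forall z, Rabs (f (z + 1)%Z - f z) <= c * e) ->
  forall x y, Rabs (f (Int_part (x / e)) - f (Int_part (y / e))) <= c * Rabs (x - y) + c * e.
Proof.
  intros He Hf x y.
  assert (Hc : 0 <= c).
  { specialize (Hf 0%Z). pose proof (Rabs_pos (f (0 + 1)%Z - f 0%Z)). nra. }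
  eapply Rle_trans; [apply (step_lipschitz f (c * e) Hf)|].
  rewrite Rmult_assoc, <- Rmult_plus_distr_l. apply Rmult_le_compat_l; [easy|].
  pose proof (base_Int_part (x / e)). pose proof (base_Int_part (y / e)).
  assert (Hd : Rabs (IZR (Int_part (x / e)) - IZR (Int_part (y / e))) <= Rabs (x / e - y / e) + 1).
  { pose proof (Rle_abs (x / e - y / e)). pose proof (Rle_abs (- (x / e - y / e))) as Hn.
    rewrite Rabs_Ropp in Hn. apply Rabs_le. lra. }
  apply Rle_trans with (e * (Rabs (x / e - y / e) + 1)); [apply Rmult_le_compat_l; lra|].
  replace (x / e - y / e) with ((x - y) / e) by (field; lra).
  unfold Rdiv. rewrite Rabs_mult, Rabs_inv, (Rabs_pos_eq e) by lra.
  right. field. lra.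
Qed.

Lemma is_lim_seq_mesh s0 : (0 < s0)%nat -> is_lim_seq (fun n => mesh (s0 + n)) 0.
Proof.
  intros Hs. apply is_lim_seq_le_le with (fun _ => 0) (fun n => / INR (n + s0)).
  - intros n. split.
    + apply Rlt_le, mesh_pos. lia.
    + rewrite Nat.add_comm. apply mesh_le_inv. lia.
  - apply is_lim_seq_const.
  - apply (is_lim_seq_incr_n (fun n => / INR n)).
    replace (Finite 0) with (Rbar_inv p_infty) by easy.
    apply is_lim_seq_inv; [apply is_lim_seq_INR|easy].
Qed.

Lemma is_lim_seq_Rle (u v : nat -> R) (l m : R) :
  (forall n, u n <= v n) -> is_lim_seq u l -> is_lim_seq v m -> l <= m.
Proof. intros H Hu Hv. exact (is_lim_seq_le u v l m H Hu Hv). Qed.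

(** The step functions built on the discrete densities and potentials are bounded and
    nearly equi-Lipschitz, so a subsequence converges.  The mass may leak to infinity,
    but the limit is nontrivial because the maximum of each density sits at [0] and is
    bounded below.  The limit potential [Wb] is known through its truncations to
    [-T, T], with an exponentially small error. *)
Lemma limit_density ka om th mu0 s0 :
  0 < ka -> 0 < om -> 0 < th -> 0 < mu0 -> (0 < s0)%nat ->
  (forall s, (s0 <= s)%nat -> exists p, in_simplex (2 * half_period s + 1) p /\
      mu0 <= qform (2 * half_period s + 1) (energy_matrix ka om th (mesh s) (half_period s)) p) ->
  exists (H Wb : R -> R) (mu L C K : R),
    0 < mu /\ 0 < L /\ lipschitz L H /\ (forall x, 0 <= H x <= C) /\ 0 < H 0 /\
    (forall x, H x = pos_part ((Wb x - mu) / th)) /\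
    (forall x (T : nat), RInt H x (x + INR T) <= 1) /\
    (forall x (T : nat),
      Rabs (Wb x - RInt (fun s => green ka om s * H (x + s)) (- INR T) (INR T))
        <= K * exp (- ka * INR T)).
Proof.
  intros Hk Ho Hth Hmu0 Hs0 Hen.
  set (e := fun n => mesh (s0 + n)). set (P := fun n => half_period (s0 + n)).
  assert (He : forall n, 0 < e n) by (intros n; apply mesh_pos; lia).
  assert (He1 : forall n, e n <= 1) by (intros n; apply mesh_le_1; lia).
  set (C0 := green_bound ka om). set (LK := / (4 * ka * om)). set (G := (1 + ka) / ka).
  assert (HC0 : 0 < C0) by now apply green_bound_pos.
  assert (HLK : 0 < LK) by (apply Rinv_0_lt_compat, Rmult_lt_0_compat; lra).
  assert (HG : 0 < G) by (apply Rdiv_lt_0_compat; lra).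
  assert (Hdisc : forall n, exists hm : (Z -> R) * R,
    let h := fst hm in let mu := snd hm in
    let w := discrete_potential ka om (e n) (P n) h in
    (forall z, 0 <= h z) /\ (forall z, h z = pos_part ((w z - mu) / th))
    /\ (forall z, Rabs (w (z + 1)%Z - w z) <= LK * e n)
    /\ (forall z, Rabs (w z) <= C0) /\ (forall z, h z <= h 0%Z)
    /\ (forall z q, (q <= 2 * P n + 1)%nat -> e n * rsum q (fun m => h (z + Z.of_nat m)%Z) <= 1)
    /\ mu0 <= mu <= C0 /\ mu0 <= 2 * h 0%Z * (C0 * G)).
  { intros n. destruct (discrete_solution ka om th (e n) (P n) Hk Ho Hth (He n)) as
      [h [mu [D1 [D2 [D3 [D4 [D5 [D6 [[z D7] D8]]]]]]]]].
    destruct (Hen (s0 + n)%nat ltac:(lia)) as [p [Hp1 Hp2]].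
    assert (Hmu : mu0 <= mu) by (eapply Rle_trans; [exact Hp2|now apply D8]).
    exists (h, mu). cbv zeta. simpl fst. simpl snd.
    do 6 (split; [easy|]). split.
    - split; [easy|]. eapply Rle_trans; [apply D7|]. eapply Rle_trans; [apply Rle_abs|apply D4].
    - apply Rle_trans with mu; [easy|]. eapply Rle_trans; [apply D7|].
      assert (Hb : forall m : nat, Rabs (h (z + Z.of_nat m - Z.of_nat (P n))%Z) <= h 0%Z).
      { intros m. rewrite Rabs_pos_eq; [apply D5|apply D1]. }
      pose proof (potential_tail ka om (e n) (P n) 0 _ _ Hk Ho (conj (He n) (He1 n)) (Nat.le_0_l _) Hb) as Ht.
      simpl (2 * 0)%nat in Ht. simpl (rsum 0 _) in Ht. simpl (INR 0) in Ht.
      rewrite !Rmult_0_r, Rminus_0_r, exp_0, Rmult_1_r in Ht.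
      eapply Rle_trans; [apply Rle_abs|exact Ht]. }
  apply choice in Hdisc. destruct Hdisc as [hm Hdisc].
  set (h := fun n => fst (hm n)). set (m := fun n => snd (hm n)).
  set (w := fun n => discrete_potential ka om (e n) (P n) (h n)).
  assert (D1 : forall n z, 0 <= h n z) by (intros n; apply (Hdisc n)).
  assert (D2 : forall n z, h n z = pos_part ((w n z - m n) / th)) by (intros n; apply (Hdisc n)).
  assert (D3 : forall n z, Rabs (w n (z + 1)%Z - w n z) <= LK * e n) by (intros n; apply (Hdisc n)).
  assert (D4 : forall n z, Rabs (w n z) <= C0) by (intros n; apply (Hdisc n)).
  assert (D6 : forall n z q, (q <= 2 * P n + 1)%nat -> e n * rsum q (fun i => h n (z + Z.of_nat i)%Z) <= 1)
    by (intros n; apply (Hdisc n)).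
  assert (D7 : forall n, mu0 <= m n <= C0) by (intros n; apply (Hdisc n)).
  assert (D8 : forall n, mu0 <= 2 * h n 0%Z * (C0 * G)) by (intros n; apply (Hdisc n)).
  clearbody h m. clear Hdisc hm.
  assert (Hith : 0 < / th) by now apply Rinv_0_lt_compat.
  assert (Hhb : forall n z, h n z <= C0 / th).
  { intros n z. rewrite D2. unfold pos_part. apply Rmax_lub.
    - apply Rmult_le_compat_r; [lra|]. specialize (D4 n z). apply Rabs_le_between in D4.
      specialize (D7 n). lra.
    - apply Rdiv_le_0_compat; lra. }
  assert (Hhl : forall n z, Rabs (h n (z + 1)%Z - h n z) <= LK / th * e n).
  { intros n z. rewrite !D2. eapply Rle_trans; [apply pos_part_lipschitz|].
    replace ((w n (z + 1)%Z - m n) / th - (w n z - m n) / th) with ((w n (z + 1)%Z - w n z) * / th)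
      by (field; lra).
    rewrite Rabs_mult, (Rabs_pos_eq (/ th)) by lra.
    replace (LK / th * e n) with (LK * e n * / th) by (field; lra).
    apply Rmult_le_compat_r; [lra|apply D3]. }
  set (L := LK + LK / th). set (C := C0 + C0 / th).
  assert (HLth : 0 < LK / th) by now apply Rdiv_lt_0_compat.
  assert (HCth : 0 < C0 / th) by now apply Rdiv_lt_0_compat.
  set (F := fun n (j : nat) x => match j with
     | 0%nat => h n (Int_part (x / e n)) | 1%nat => w n (Int_part (x / e n)) | _ => m n end).
  assert (HFl : forall n j x y, Rabs (F n j x - F n j y) <= L * Rabs (x - y) + L * e n).
  { intros n j x y. pose proof (Rabs_pos (x - y)). specialize (He n).
    destruct j as [|[|j]]; simpl.
    - eapply Rle_trans; [apply (step_function_lipschitz (h n) (LK / th) (e n) He (Hhl n))|].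
      unfold L. nra.
    - eapply Rle_trans; [apply (step_function_lipschitz (w n) LK (e n) He (D3 n))|].
      unfold L. nra.
    - rewrite Rminus_diag, Rabs_R0. unfold L. nra. }
  assert (Helim : is_lim_seq e 0) by now apply is_lim_seq_mesh.
  assert (HLe : is_lim_seq (fun n => L * e n) 0).
  { replace (Finite 0) with (Finite (L * 0)) by (f_equal; ring).
    apply is_lim_seq_mult'; [apply is_lim_seq_const|easy]. }
  destruct (equicontinuous_subseq (fun _ => True) F C L (fun n => L * e n)) as [phi [Hphi Hcv]].
  { apply open_true. }
  { intros n j x _. unfold C. destruct j as [|[|j]]; simpl.
    - rewrite Rabs_pos_eq by apply D1. specialize (Hhb n (Int_part (x / e n))). lra.
    - specialize (D4 n (Int_part (x / e n))). lra.
    - specialize (D7 n). rewrite Rabs_pos_eq by lra. lra. }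
  { intros n j x y _ _. apply HFl. }
  { exact HLe. }
  assert (Hsub : filterlim phi eventually eventually) by now apply eventually_subseq.
  set (V := fun j x => real (Lim_seq (fun n => F (phi n) j x))).
  assert (HV : forall j x, is_lim_seq (fun n => F (phi n) j x) (V j x)).
  { intros j x. apply Lim_seq_correct'. now apply Hcv. }
  set (H := V 0%nat). set (Wb := V 1%nat). set (mu := V 2%nat 0).
  assert (HL0 : 0 < L) by (unfold L; lra).
  assert (Helim' : is_lim_seq (fun n => e (phi n)) 0) by now apply (is_lim_seq_subseq e).
  assert (HLe' : is_lim_seq (fun n => L * e (phi n)) 0) by now apply (is_lim_seq_subseq (fun n => L * e n)).
  assert (HHl : lipschitz L H).
  { intros x y. apply is_lim_seq_Rle with (fun n => Rabs (F (phi n) 0%nat x - F (phi n) 0%nat y))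
      (fun n => L * Rabs (x - y) + L * e (phi n)).
    - intros n. apply HFl.
    - apply (is_lim_seq_abs _ (H x - H y)). apply is_lim_seq_minus'; apply HV.
    - replace (Finite (L * Rabs (x - y))) with (Finite (L * Rabs (x - y) + 0)) by (f_equal; ring).
      apply is_lim_seq_plus'; [apply is_lim_seq_const|easy]. }
  assert (HHb : forall x, 0 <= H x <= C0 / th).
  { intros x. split.
    - apply is_lim_seq_Rle with (fun _ => 0) (fun n => F (phi n) 0%nat x);
        [intros; apply D1|apply is_lim_seq_const|apply HV].
    - apply is_lim_seq_Rle with (fun n => F (phi n) 0%nat x) (fun _ => C0 / th);
        [intros; apply Hhb|apply HV|apply is_lim_seq_const]. }
  assert (HHa : forall x, Rabs (H x) <= C0 / th).
  { intros x. rewrite Rabs_pos_eq; apply HHb. }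
  (* [T] is a whole number of mesh steps *)
  assert (Hwin : forall T n x, Int_part ((x - INR T) / e n) = (Int_part (x / e n) - Z.of_nat (T * (s0 + n) ^ 3))%Z).
  { intros T n x. rewrite <- Z.add_opp_r, <- Int_part_shift. f_equal.
    rewrite opp_IZR, <- INR_IZR_INZ. pose proof (mesh_window (s0 + n) T ltac:(lia)) as E.
    fold (e n) in E. rewrite <- E. specialize (He n). field. lra. }
  assert (Hstep : forall n x i, Int_part ((x + e n * INR i) / e n) = (Int_part (x / e n) + Z.of_nat i)%Z).
  { intros n x i. rewrite <- Int_part_shift. f_equal. rewrite <- INR_IZR_INZ.
    specialize (He n). field. lra. }
  exists H, Wb, mu, L, (C0 / th), (2 * (C0 / th) * (C0 * G)).
  assert (HW2 : forall T n, (T * (s0 + n) ^ 3 <= (s0 + n) ^ 4 \/ s0 + n < T)%nat).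
  { intros T n. destruct (Nat.le_gt_cases T (s0 + n)) as [Hle|Hgt]; [left|now right].
    change ((s0 + n) ^ 4)%nat with ((s0 + n) * (s0 + n) ^ 3)%nat. now apply Nat.mul_le_mono_r. }
  split.
  { apply Rlt_le_trans with mu0; [easy|].
    apply is_lim_seq_Rle with (fun _ => mu0) (fun n => F (phi n) 2%nat 0);
      [intros; apply D7|apply is_lim_seq_const|apply HV]. }
  split; [easy|]. split; [easy|]. split; [easy|]. split.
  { apply Rlt_le_trans with (mu0 / (2 * (C0 * G))).
    - apply Rdiv_lt_0_compat; [easy|]. assert (0 < C0 * G) by now apply Rmult_lt_0_compat. lra.
    - apply is_lim_seq_Rle with (fun _ => mu0 / (2 * (C0 * G))) (fun n => F (phi n) 0%nat 0);
        [|apply is_lim_seq_const|apply HV].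
      intros n. simpl.
      replace (Int_part (0 / e (phi n))) with 0%Z.
      + specialize (D8 (phi n)). assert (0 < C0 * G) by now apply Rmult_lt_0_compat.
        apply Rmult_le_reg_r with (2 * (C0 * G)); [lra|].
        replace (mu0 / (2 * (C0 * G)) * (2 * (C0 * G))) with mu0 by (field; lra). lra.
      + apply Int_part_spec. unfold Rdiv. rewrite Rmult_0_l. simpl. lra. }
  split.
  { intros x.
    assert (E1 : is_lim_seq (fun n => F (phi n) 0%nat x) (pos_part ((Wb x - mu) / th))).
    { apply is_lim_seq_ext with (fun n => pos_part ((F (phi n) 1%nat x - F (phi n) 2%nat 0) / th)).
      - intros n. simpl. symmetry. apply D2.
      - apply is_lim_seq_pos_part. apply is_lim_seq_mult'; [|apply is_lim_seq_const].
        apply is_lim_seq_minus'; apply HV. }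
    pose proof (HV 0%nat x) as E2. apply is_lim_seq_unique in E1. apply is_lim_seq_unique in E2.
    rewrite E1 in E2. injection E2. intros E. symmetry. exact E. }
  split.
  { intros x T.
    pose proof (weighted_sum_limit (fun _ => 1) H (fun n => F (phi n) 0%nat) (fun n => e (phi n))
      (fun n => L * e (phi n)) (fun n => (T * (s0 + phi n) ^ 3)%nat) 0 1 L (C0 / th) (INR T) 0 x) as Hlim.
    assert (E : RInt (fun s => 1 * H (x + s)) 0 (0 + INR T) = RInt H x (x + INR T)).
    { pose proof (RInt_comp_lin H 1 x 0 (INR T)) as Ec.
      rewrite !Rmult_1_l, Rplus_0_l, (Rplus_comm (INR T)) in Ec.
      rewrite <- Ec by now apply ex_RInt_cont, (lipschitz_continuous L).
      rewrite Rplus_0_l. apply RInt_ext. intros s _. unfold scal; simpl; unfold mult; simpl.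
      f_equal. f_equal. ring. }
    cbv beta in Hlim. rewrite E in Hlim.
    refine (is_lim_seq_le_loc _ (fun _ => 1) (RInt H x (x + INR T)) 1 _ (Hlim _ _ _ _ _ _ _ _ _ _ _) (is_lim_seq_const 1)).
    - exists T. intros n Hn. pose proof (subseq_ge phi Hphi n) as Hge.
      destruct (HW2 T (phi n)) as [Hle|Hgt]; [|lia].
      specialize (D6 (phi n) (Int_part (x / e (phi n))) (T * (s0 + phi n) ^ 3)%nat).
      eapply Rle_trans; [|apply D6].
      + right. f_equal. apply rsum_ext. intros i _. simpl. rewrite Rplus_0_l, Rmult_1_l.
        now rewrite Hstep.
      + unfold P, half_period. lia.
    - intros y z. rewrite Rminus_diag, Rabs_R0. lra.
    - intros s. rewrite Rabs_R1. lra.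
    - easy.
    - easy.
    - easy.
    - intros n y z. apply HFl.
    - easy.
    - intros y. apply HV.
    - intros n. apply He.
    - easy.
    - intros n. apply mesh_window. lia. }
  intros x T.
  set (mid := fun n => e n * rsum (2 * T * (s0 + n) ^ 3)
     (fun i => green ka om (- INR T + e n * INR i) * F n 0%nat (x + (- INR T + e n * INR i)))).
  assert (Hmid : is_lim_seq (fun n => mid (phi n))
     (RInt (fun s => green ka om s * H (x + s)) (- INR T) (INR T))).
  { replace (INR T) with (- INR T + INR (2 * T)) at 2.
    2:{ rewrite mult_INR. simpl (INR 2). ring. }
    apply (weighted_sum_limit (green ka om) H (fun n => F (phi n) 0%nat) (fun n => e (phi n))
      (fun n => L * e (phi n)) (fun n => (2 * T * (s0 + phi n) ^ 3)%nat) LK C0 L (C0 / th)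
      (INR (2 * T)) (- INR T) x).
    - intros y z. now apply green_lipschitz.
    - intros s. now apply green_le.
    - exact HHl.
    - exact HHa.
    - exact HL0.
    - intros n y z. apply HFl.
    - exact HLe'.
    - intros y. apply HV.
    - intros n. apply He.
    - exact Helim'.
    - intros n. apply mesh_window. lia. }
  assert (Hdiff : forall n, (T <= s0 + n)%nat ->
     Rabs (F n 1%nat x - mid n) <= 2 * (C0 / th) * (C0 * G) * exp (- ka * INR T)).
  { intros n HT. set (Q := (T * (s0 + n) ^ 3)%nat).
    assert (HQ : (Q <= P n)%nat).
    { destruct (HW2 T n) as [Hle|Hgt]; [|lia]. exact Hle. }
    assert (HQe : e n * INR Q = INR T) by (apply mesh_window; lia).
    set (z := Int_part (x / e n)).
    assert (Hb : forall i : nat, Rabs (h n (z + Z.of_nat i - Z.of_nat (P n))%Z) <= C0 / th).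
    { intros i. rewrite Rabs_pos_eq; [apply Hhb|apply D1]. }
    pose proof (potential_tail ka om (e n) (P n) Q _ _ Hk Ho (conj (He n) (He1 n)) HQ Hb) as Ht.
    rewrite HQe in Ht.
    assert (Em : mid n = e n * rsum (2 * Q) (fun i => green ka om (e n * (INR i - INR Q))
        * h n (z + Z.of_nat (P n - Q + i) - Z.of_nat (P n))%Z)).
    { unfold mid. f_equal.
      replace (2 * T * (s0 + n) ^ 3)%nat with (2 * Q)%nat by (unfold Q; ring).
      apply rsum_ext. intros i _. f_equal.
      - f_equal. rewrite <- HQe. ring.
      - simpl. replace (x + (- INR T + e n * INR i)) with (x - INR T + e n * INR i) by ring.
        rewrite Hstep, Hwin. fold z Q. f_equal. lia. }
    rewrite Em. exact Ht. }
  refine (is_lim_seq_le_loc (fun n => Rabs (F (phi n) 1%nat x - mid (phi n))) (fun _ => _)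
    (Rabs (Wb x - RInt (fun s => green ka om s * H (x + s)) (- INR T) (INR T))) _ _ _ (is_lim_seq_const _)).
  - exists T. intros n Hn. apply Hdiff. pose proof (subseq_ge phi Hphi n). lia.
  - apply (is_lim_seq_abs _ (Wb x - RInt (fun s => green ka om s * H (x + s)) (- INR T) (INR T))).
    apply is_lim_seq_minus'; [apply HV|exact Hmid].
Qed.

Lemma exp_decay_small ka K eta :
  0 < ka -> 0 < eta -> exists T0 : nat, forall T, (T0 <= T)%nat -> K * exp (- ka * INR T) <= eta.
Proof.
  intros Hk Heta.
  pose proof (is_lim_exp_decay ka K Hk) as Hl.
  apply is_lim_spec in Hl. destruct (Hl (mkposreal _ Heta)) as [M HM]. simpl in HM.
  destruct (nfloor_ex (Rabs M)) as [T0 HT0]; [apply Rabs_pos|].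
  exists (S T0). intros T HT. apply le_INR in HT. rewrite S_INR in HT.
  pose proof (Rle_abs M).
  specialize (HM (INR T) ltac:(lra)). rewrite Rminus_0_r in HM. apply Rabs_def2 in HM. lra.
Qed.

(** The limit density is integrable and Lipschitz, hence it tends to zero, and so does
    its potential, which therefore falls below [mu] outside a compact set: the density
    has compact support.  Then the truncated potentials are the full convolution. *)
Lemma ground_state_exists (ka om th R0 L : R) (H0 : R -> R) :
  0 < ka -> 0 < om -> 0 < th -> 0 < R0 -> 0 <= L ->
  (forall x, 0 <= H0 x) -> lipschitz L H0 -> (forall x, R0 <= Rabs x -> H0 x = 0) ->
  0 < RInt (fun x => H0 x * convolution ka om R0 H0 0 x - th * H0 x ^ 2) (- R0) R0 ->
  exists (R1 mu : R) (H : R -> R),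
    0 < R1 /\ 0 < mu /\ (forall x, continuous H x) /\ (forall x, R1 <= Rabs x -> H x = 0) /\
    0 < H 0 /\ (forall x, H x = pos_part ((convolution ka om R1 H 0 x - mu) / th)).
Proof.
  intros Hk Ho Hth HR HL Hpos HLip Hz HI.
  destruct (discrete_energy_lower_bound ka om th R0 L H0 Hk Ho Hth HR HL Hpos HLip Hz HI)
    as [mu0 [s0 [Hmu0 [Hs0 Hen]]]].
  destruct (limit_density ka om th mu0 s0 Hk Ho Hth Hmu0 Hs0 Hen)
    as [H [Wb [mu [L1 [C [K [A1 [A2 [A3 [A4 [A5 [A6 [A7 A8]]]]]]]]]]]]].
  pose proof (lipschitz_continuous L1 H A3) as Hc.
  set (C0 := green_bound ka om).
  assert (HC0 : 0 < C0) by now apply green_bound_pos.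
  destruct (exp_decay_small ka K (mu / 4) Hk ltac:(lra)) as [T HT].
  specialize (HT T (Nat.le_refl T)).
  assert (HT0 := pos_INR T).
  set (eta := mu / 4 / (2 * INR T * C0 + 1)).
  assert (HTC : 0 <= 2 * INR T * C0) by (apply Rmult_le_pos; lra).
  assert (Heta : 0 < eta) by (apply Rdiv_lt_0_compat; lra).
  destruct (lipschitz_integrable_decay H L1 A2 A3 (fun x => proj1 (A4 x)) A7 eta Heta) as [X1 HX1].
  assert (Hrefl : exists X, forall x, X <= x -> H (- x) <= eta).
  { apply (lipschitz_integrable_decay (fun x => H (- x)) L1); try easy.
    - intros x y. eapply Rle_trans; [apply A3|]. right. rewrite Rabs_minus_sym. do 2 f_equal. ring.
    - intros x. apply A4.
    - intros x N. pose proof (RInt_comp_lin H (-1) 0 x (x + INR N)) as E.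
      specialize (A7 (- (x + INR N)) N).
      replace (- (x + INR N) + INR N) with (- x) in A7 by ring.
      rewrite <- (opp_RInt_swap (V := R_CompleteNormedModule)) in A7 by now apply ex_RInt_cont.
      replace (-1 * x + 0) with (- x) in E by ring.
      replace (-1 * (x + INR N) + 0) with (- (x + INR N)) in E by ring.
      rewrite <- E in A7 by now apply ex_RInt_cont.
      rewrite RInt_scal in A7.
      + unfold opp, scal in A7; simpl in A7; unfold mult in A7; simpl in A7.
        assert (E2 : RInt (fun y => H (-1 * y + 0)) x (x + INR N) = RInt (fun y => H (- y)) x (x + INR N)).
        { apply RInt_ext. intros y _. f_equal. ring. }
        rewrite E2 in A7. lra.
      + apply ex_RInt_cont. intros y. apply (continuous_comp (fun y => -1 * y + 0) H); [|apply Hc].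
        apply continuous_derivable. auto_derive. easy. }
  destruct Hrefl as [X2 HX2].
  set (R1 := Rabs X1 + Rabs X2 + INR T + 1).
  assert (HR1 : 0 < R1) by (unfold R1; pose proof (Rabs_pos X1); pose proof (Rabs_pos X2); lra).
  assert (Hsmall : forall y, Rabs X1 + Rabs X2 <= Rabs y -> H y <= eta).
  { intros y Hy. pose proof (Rle_abs X1). pose proof (Rle_abs X2).
    pose proof (Rabs_pos X1). pose proof (Rabs_pos X2).
    destruct (Rle_dec 0 y) as [Hy0|Hy0].
    - rewrite (Rabs_pos_eq y) in Hy by lra. apply HX1. lra.
    - rewrite (Rabs_left1 y) in Hy by lra. rewrite <- (Ropp_involutive y). apply HX2. lra. }
  assert (Hcg : forall x s, continuous (fun s => green ka om s * H (x + s)) s).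
  { intros x s. apply continuous_Rmult; [now apply green_continuous|].
    apply (continuous_comp (fun s => x + s) H); [|apply Hc].
    apply continuous_derivable. auto_derive. easy. }
  assert (Hzero : forall x, R1 <= Rabs x -> H x = 0).
  { intros x Hx. rewrite A6. unfold pos_part. apply Rmax_right.
    assert (HW : Wb x <= mu / 2).
    { specialize (A8 x T). apply Rabs_le_between in A8.
      assert (HI2 : Rabs (RInt (fun s => green ka om s * H (x + s)) (- INR T) (INR T))
         <= (INR T - - INR T) * (C0 * eta)).
      { apply abs_RInt_le_const; [lra|apply ex_RInt_cont; intros; apply Hcg|].
        intros s Hs. rewrite Rabs_mult. apply Rmult_le_compat; try apply Rabs_pos.
        - now apply green_le.
        - rewrite Rabs_pos_eq by apply A4. apply Hsmall.
          unfold R1 in Hx. pose proof (Rabs_triang_inv x (- s)) as Ht. rewrite Rabs_Ropp in Ht.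
          replace (x - - s) with (x + s) in Ht by ring.
          assert (Rabs s <= INR T) by (apply Rabs_le; lra). lra. }
      assert (HI3 : (INR T - - INR T) * (C0 * eta) <= mu / 4).
      { unfold eta. apply Rmult_le_reg_r with (2 * INR T * C0 + 1); [lra|].
        replace ((INR T - - INR T) * (C0 * (mu / 4 / (2 * INR T * C0 + 1))) * (2 * INR T * C0 + 1))
          with (2 * INR T * C0 * (mu / 4)) by (field; lra). nra. }
      apply Rabs_le_between in HI2. lra. }
    assert (0 < / th) by now apply Rinv_0_lt_compat. unfold Rdiv. nra. }
  exists R1, mu, H. split; [easy|]. split; [easy|]. split; [easy|]. split; [easy|]. split; [easy|].
  intros x. rewrite A6. do 3 f_equal.
  apply cond_eq. intros ep Hep.
  destruct (exp_decay_small ka K (ep / 2) Hk ltac:(lra)) as [T1 HT1].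
  destruct (nfloor_ex (Rabs x + R1)) as [T2 HT2]; [pose proof (Rabs_pos x); lra|].
  set (T3 := (T1 + S T2)%nat).
  specialize (HT1 T3 ltac:(unfold T3; lia)). specialize (A8 x T3).
  assert (HT3 : Rabs x + R1 <= INR T3).
  { unfold T3. rewrite plus_INR, S_INR. pose proof (pos_INR T1). lra. }
  pose proof (convolution_RInt ka om R1 H x (INR T3) Hk Ho HR1 Hc Hzero HT3) as E.
  apply (is_RInt_unique (V := R_CompleteNormedModule)) in E. rewrite E in A8. lra.
Qed.

(** * Travelling waves *)

Lemma Rpower_fourth_root x : 0 < x -> Rpower x (1 / 4) ^ 4 = x.
Proof.
  intros Hx. rewrite <- Rpower_pow by apply exp_pos. rewrite Rpower_mult.
  replace (1 / 4 * INR 4) with 1 by (simpl; field). now apply Rpower_1.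
Qed.

Lemma pow4_abs c : Rabs c ^ 4 = (c ^ 2) ^ 2.
Proof. rewrite <- (pow2_abs c). ring. Qed.

Lemma pow4_lt x y : 0 <= x < y -> x ^ 4 < y ^ 4.
Proof.
  intros H. assert (0 <= x * x < y * y) by nra.
  replace (x ^ 4) with (x * x * (x * x)) by ring. replace (y ^ 4) with (y * y * (y * y)) by ring. nra.
Qed.

(** The characteristic roots of [u'''' + 2 d u'' + a u] are [+- ka +- i om]; they are
    off the imaginary axis exactly when [d^2 < a], that is for subcritical speed. *)
Lemma root_parameters a d :
  0 < a -> 0 < d -> d ^ 2 < a ->
  exists ka om, 0 < ka < om /\ om ^ 2 - ka ^ 2 = d /\ (ka ^ 2 + om ^ 2) ^ 2 = a.
Proof.
  intros Ha Hd Hda. set (q := sqrt a).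
  assert (Hq : q ^ 2 = a) by (apply pow2_sqrt; lra).
  assert (Hq0 : 0 < q) by now apply sqrt_lt_R0.
  assert (Hdq : d < q) by nra.
  exists (sqrt ((q - d) / 2)), (sqrt ((q + d) / 2)).
  rewrite !pow2_sqrt by lra.
  split; [|split; [field|rewrite <- Hq; field]].
  split; [apply sqrt_lt_R0; lra|]. apply sqrt_lt_1_alt; lra.
Qed.

Lemma is_lim_translate (f : R -> R) (l v : R) :
  (is_lim f p_infty l -> is_lim (fun x => f (x - v)) p_infty l) /\
  (is_lim f m_infty l -> is_lim (fun x => f (x - v)) m_infty l).
Proof.
  split; intros H.
  - apply is_lim_spec in H. apply is_lim_spec. intros e. destruct (H e) as [M HM].
    exists (M + v). intros x Hx. apply HM. lra.
  - apply is_lim_spec in H. apply is_lim_spec. intros e. destruct (H e) as [M HM].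
    exists (M + v). intros x Hx. apply HM. lra.
Qed.

Lemma travelling_profile_solution a b c (Y : nat -> R -> R) :
  tower (fun _ => True) 4 Y ->
  (forall s, continuous (Y 4%nat) s) ->
  (forall s, c ^ 2 * Y 2%nat s + Y 4%nat s + a * pos_part (Y 0%nat s) - b * neg_part (Y 0%nat s) = 1) ->
  is_lim (Y 0%nat) p_infty (1 / a) -> is_lim (Y 0%nat) m_infty (1 / a) ->
  is_lim (Y 1%nat) p_infty 0 -> is_lim (Y 1%nat) m_infty 0 ->
  classical_solution a b (fun x t => Y 0%nat (x - c * t)).
Proof.
  intros HT HC4 Heq L1 L2 L3 L4.
  assert (HCY : forall k s, (k <= 4)%nat -> continuous (Y k) s).
  { intros k s Hk. destruct (Nat.eq_dec k 4) as [->|Hk4]; [apply HC4|].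
    apply continuous_derivable. exists (Y (S k) s). apply HT; [lia|easy]. }
  assert (Tx : forall t, tower (fun _ => True) 4 (fun k x => Y k (x - c * t))).
  { intros t k x Hk _.
    assert (Dl : is_derive (fun x => x - c * t) x 1) by (auto_derive; [easy|ring]).
    pose proof (is_derive_comp (Y k) (fun x => x - c * t) _ _ _ (HT k (x - c * t) Hk Logic.I) Dl) as D.
    unfold scal in D; simpl in D; unfold mult in D; simpl in D. rewrite Rmult_1_l in D. exact D. }
  assert (Tt : forall x, tower (fun _ => True) 2 (fun k t => (- c) ^ k * Y k (x - c * t))).
  { intros x k t Hk _.
    assert (Dl : is_derive (fun t => x - c * t) t (- c)) by (auto_derive; [easy|ring]).
    pose proof (is_derive_comp (Y k) (fun t => x - c * t) _ _ _ (HT k (x - c * t) ltac:(lia) Logic.I) Dl) as D.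
    unfold scal in D; simpl in D; unfold mult in D; simpl in D.
    eapply is_derive_eq; [derive_tac|]. simpl. ring. }
  assert (Ex : forall t k, (k <= 4)%nat -> forall x,
     ex_derive_n (fun x => Y 0%nat (x - c * t)) k x /\
     Derive_n (fun x => Y 0%nat (x - c * t)) k x = Y k (x - c * t)).
  { intros t k Hk x.
    exact (tower_Derive_n (fun _ => True) 4 (fun k x => Y k (x - c * t)) open_true (Tx t) k Hk x Logic.I). }
  assert (Et : forall x k, (k <= 2)%nat -> forall t,
     ex_derive_n (fun t => Y 0%nat (x - c * t)) k t /\
     Derive_n (fun t => Y 0%nat (x - c * t)) k t = (- c) ^ k * Y k (x - c * t)).
  { intros x k Hk t.
    destruct (tower_Derive_n (fun _ => True) 2 (fun k t => (- c) ^ k * Y k (x - c * t)) open_true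
      (Tt x) k Hk t Logic.I) as [E1 E2].
    assert (Eext : forall s, (- c) ^ 0 * Y 0%nat (x - c * s) = Y 0%nat (x - c * s)) by (intros; simpl; ring).
    split.
    - now apply (ex_derive_n_ext _ _ k t Eext).
    - rewrite <- E2. apply Derive_n_ext. intros s. now rewrite Eext. }
  assert (Cxt : forall k x t, (k <= 4)%nat ->
     continuous (fun p : R * R => Y k (fst p - c * snd p)) (x, t)).
  { intros k x t Hk.
    apply (continuous_comp (fun p : R * R => fst p - c * snd p) (Y k) (x, t)); [|now apply HCY].
    apply (continuous_minus (U := prod_UniformSpace R_UniformSpace R_UniformSpace) (V := R_NormedModule)
      (fun p : R * R => fst p) (fun p : R * R => c * snd p)).
    - apply continuous_fst.
    - apply (continuous_scal_r (U := prod_UniformSpace R_UniformSpace R_UniformSpace)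
        (V := R_NormedModule) c (fun p : R * R => snd p)). apply continuous_snd. }
  split; [|split; [|split; [|split; [|split]]]].
  - intros t _ x _ k Hk. now apply Ex.
  - intros x t _ k Hk. now apply Et.
  - intros k x t Hk _.
    apply continuous_ext with (fun p : R * R => Y k (fst p - c * snd p)); [|now apply Cxt].
    intros p. symmetry. unfold dx. now apply Ex.
  - intros k x t Hk _.
    apply continuous_ext with (fun p : R * R => scal ((- c) ^ k) (Y k (fst p - c * snd p))).
    + intros p. symmetry. unfold dt. now apply Et.
    + apply (continuous_scal_r (U := prod_UniformSpace R_UniformSpace R_UniformSpace)
        (V := R_NormedModule) ((- c) ^ k) (fun p : R * R => Y k (fst p - c * snd p))). apply Cxt. lia.
  - intros x t _. unfold dt, dx.
    rewrite (proj2 (Et x 2%nat ltac:(lia) t)), (proj2 (Ex t 4%nat ltac:(lia) x)).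
    rewrite <- (Heq (x - c * t)). ring.
  - intros t _.
    assert (E1 : forall x, Y 1%nat (x - c * t) = dx 1 (fun x t => Y 0%nat (x - c * t)) x t).
    { intros x. symmetry. unfold dx. apply (Ex t 1%nat). lia. }
    repeat split.
    + now apply is_lim_translate.
    + now apply is_lim_translate.
    + eapply is_lim_ext; [apply E1|]. now apply (is_lim_translate (Y 1%nat)).
    + eapply is_lim_ext; [apply E1|]. now apply (is_lim_translate (Y 1%nat)).
Qed.

Theorem theorem10 :
  forall a b : R, b > 0 -> a > b ->
  forall c : R,
    Rpower (4 * b / beta_star (a / b)) (1 / 4) < Rabs c < Rpower (4 * a) (1 / 4) ->
    exists u : R -> R -> R, travelling_wave_solution a b c u.
Proof.
  intros a b Hb Hab c [Hc1 Hc2].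
  assert (Hcpos : 0 < Rabs c) by (eapply Rlt_trans; [apply exp_pos|exact Hc1]).
  set (d := c ^ 2 / 2).
  assert (Hc : c <> 0) by (intros ->; rewrite Rabs_R0 in Hcpos; lra).
  assert (Hd : 0 < d) by (unfold d; pose proof (pow2_gt_0 c Hc); lra).
  assert (Hc4 : Rabs c ^ 4 = 4 * d ^ 2) by (rewrite pow4_abs; unfold d; field).
  assert (Hda : d ^ 2 < a).
  { assert (Rabs c ^ 4 < Rpower (4 * a) (1 / 4) ^ 4).
    { apply pow4_lt; lra. }
    rewrite Rpower_fourth_root in H by lra. lra. }
  destruct (root_parameters a d ltac:(lra) Hd Hda) as [ka [om [Hko [Hkd Hka]]]].
  assert (Hq : 1 < a / b).
  { apply Rmult_lt_reg_r with b; [lra|]. replace (a / b * b) with a by (field; lra). lra. }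
  destruct (fucik_above_of_beta_star (a / b) (b / d ^ 2) Hq) as [r [be [Hr [Hbe Hsp]]]].
  { intros Hbs.
    assert (Hlt : Rpower (4 * b / beta_star (a / b)) (1 / 4) ^ 4 < Rabs c ^ 4).
    { apply pow4_lt. split; [apply Rlt_le, exp_pos|easy]. }
    rewrite Rpower_fourth_root, Hc4 in Hlt by (apply Rdiv_lt_0_compat; lra).
    assert (Hd2 : 0 < d ^ 2) by now apply pow_lt.
    apply Rmult_lt_reg_r with (d ^ 2); [easy|]. replace (b / d ^ 2 * d ^ 2) with b by (field; lra).
    apply (Rmult_lt_compat_r (beta_star (a / b))) in Hlt; [|easy].
    replace (4 * b / beta_star (a / b) * beta_star (a / b)) with (4 * b) in Hlt by (field; lra). lra. }
  assert (Hbe2 : b < (om ^ 2 - ka ^ 2) ^ 2 * be).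
  { rewrite Hkd. assert (Hd2 : 0 < d ^ 2) by now apply pow_lt.
    apply (Rmult_lt_compat_r (d ^ 2)) in Hbe; [|easy].
    replace (b / d ^ 2 * d ^ 2) with b in Hbe by (field; lra). lra. }
  destruct (fucik_test_density ka om a b r be Hko (conj Hb Hab) (eq_sym Hka) Hr Hsp Hbe2)
    as [R0 [H0 [L [HR0 [HL [Hpos [HLip [Hz HI]]]]]]]].
  assert (Hth : 0 < / (a - b)) by (apply Rinv_0_lt_compat; lra).
  destruct (ground_state_exists ka om (/ (a - b)) R0 L H0) as
    [R1 [mu [H [HR1 [Hmu [HH [HZ [Hnz Heq]]]]]]]]; try easy; try lra.
  { rewrite (RInt_ext _ (fun x => H0 x * convolution ka om R0 H0 0 x - H0 x ^ 2 / (a - b))).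
    - exact HI.
    - intros x _. unfold Rdiv. now rewrite (Rmult_comm (H0 x ^ 2)). }
  set (W := convolution ka om R1 H).
  set (Y := fun k s => match k with 0%nat => 1 / a - W 0%nat s / (a * mu) | _ => - (W k s / (a * mu)) end).
  assert (Hk : 0 < ka) by lra. assert (Ho : 0 < om) by lra.
  pose proof (convolution_tower ka om R1 H Hk Ho HH) as TW. fold W in TW.
  assert (LW : forall k, (k <= 3)%nat -> is_lim (W k) p_infty 0 /\ is_lim (W k) m_infty 0).
  { intros k Hk3. now apply convolution_limits. }
  assert (Hamu : 0 < a * mu) by nra.
  exists (fun x t => Y 0%nat (x - c * t)). split.
  - assert (HS : forall k x, is_lim (W k) x 0 -> is_lim (fun s => W k s / (a * mu)) x 0).
    { intros k x Hl. replace (Finite 0) with (Rbar_mult 0 (/ (a * mu))) by (simpl; f_equal; ring).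
      now apply is_lim_scal_r. }
    assert (HY0 : forall x, is_lim (W 0%nat) x 0 -> is_lim (Y 0%nat) x (1 / a)).
    { intros x Hl. unfold Y. replace (Finite (1 / a)) with (Finite (1 / a - 0)) by (f_equal; ring).
      apply is_lim_minus'; [apply is_lim_const|now apply HS]. }
    assert (HY1 : forall x, is_lim (W 1%nat) x 0 -> is_lim (Y 1%nat) x 0).
    { intros x Hl. unfold Y. replace (Finite 0) with (Rbar_opp 0) by (simpl; f_equal; ring).
      apply is_lim_opp. now apply HS. }
    apply travelling_profile_solution.
    + intros k s Hlt _. pose proof (TW k s Hlt Logic.I) as D.
      destruct k as [|k]; unfold Y, Rdiv; (eapply is_derive_eq; [|]).
      * apply is_derive_Rminus; [apply is_derive_Rconst|]. derive_tac.
      * unfold Rdiv. ring.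
      * apply (is_derive_opp (V := R_NormedModule) (fun s => W (S k) s * / (a * mu))). derive_tac.
      * unfold opp; simpl. ring.
    + intros s.
      apply continuous_ext with (fun s => (H s - 2 * (om ^ 2 - ka ^ 2) * W 2%nat s
        - (ka ^ 2 + om ^ 2) ^ 2 * W 0%nat s) * (- / (a * mu))).
      { intros z. unfold Y, W, convolution. eqR. field. repeat split; nra. }
      assert (CW : forall k, (k <= 3)%nat -> continuous (W k) s).
      { intros k Hk3. apply continuous_derivable. exists (W (S k) s). apply TW; [lia|easy]. }
      apply continuous_Rmult; [|apply continuous_const].
      apply (continuous_minus (V := R_NormedModule)); [apply (continuous_minus (V := R_NormedModule))|].
      * apply HH.
      * apply continuous_Rmult; [apply continuous_const|apply CW; lia].
      * apply continuous_Rmult; [apply continuous_const|apply CW; lia].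
    + intros s.
      assert (E4 : W 4%nat s = H s - 2 * (om ^ 2 - ka ^ 2) * W 2%nat s
        - (ka ^ 2 + om ^ 2) ^ 2 * W 0%nat s) by reflexivity.
      rewrite Hkd, Hka in E4.
      assert (Hc2' : c ^ 2 = 2 * d) by (unfold d; field).
      assert (EN : (a - b) * neg_part (Y 0%nat s) = H s / (a * mu)).
      { rewrite Heq. fold W. unfold neg_part, pos_part, Y.
        replace ((W 0%nat s - mu) / / (a - b)) with ((a - b) * (a * mu) * ((W 0%nat s - mu) / (a * mu)))
          by (field; lra).
        replace (- (1 / a - W 0%nat s / (a * mu))) with ((W 0%nat s - mu) / (a * mu)) by (field; lra).
        rewrite <- (Rmult_0_r ((a - b) * (a * mu))) at 2. rewrite RmaxRmult by nra. field. lra. }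
      unfold Rminus at 1. rewrite Rplus_assoc.
      replace (a * pos_part (Y 0%nat s) + - (b * neg_part (Y 0%nat s)))
        with (a * Y 0%nat s + (a - b) * neg_part (Y 0%nat s)) by (case_parts (Y 0%nat s); ring).
      rewrite EN. unfold Y. rewrite E4, Hc2'. field. lra.
    + apply HY0, LW. lia.
    + apply HY0, LW. lia.
    + apply HY1, LW. lia.
    + apply HY1, LW. lia.
  - exists (Y 0%nat). split; [easy|]. exists 0. unfold Y.
    rewrite Heq in Hnz. fold W in Hnz. unfold pos_part in Hnz.
    assert (HW0 : mu < W 0%nat 0).
    { apply Rnot_le_lt. intros Hle. rewrite Rmax_right in Hnz; [lra|].
      unfold Rdiv. rewrite Rinv_inv. nra. }
    assert (0 < W 0%nat 0 / (a * mu)) by (apply Rdiv_lt_0_compat; lra). lra.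
Qed.
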